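(* The set of positive Thompson links coincides with the set of closures of bipartite arborescent tangles. That is, for an (unoriented) link $L\subset S^3$ the following are equivalent: (i) $L$ is isotopic to $\mathcal{L}(T)$ for some finite rooted binary plane tree $T$ with at least two leaves; (ii) $L$ is isotopic to the closure of the arborescent tangle $\tau(t)$ associated with some bipartite finite rooted plane tree $t$.
   Context: All links are unoriented links in $S^3$, considered up to isotopy. **Thompson links.** A pair $(T_+,T_-)$ of finite rooted binary plane trees with the same number $n$ of leaves represents an element of the Thompson group $F$. The link $\mathcal{L}(T_+,T_-)$ is defined as follows. Draw $T_+$ in the upper half-plane with its leaves at the points $1,\dots,n$ of the $x$-axis and the root on top, with an edge sprouting upwards from the root. At each trivalent vertex $v$ (including the root) add an edge going down from $v$, between its left and right child edges, to the point $i+\tfrac12$ of the $x$-axis, where $i$ is the right-most leaf of the left subtree at $v$. Each $v$ is now 4-valent; turn it into a crossing in which the strand formed by the two edges to the left and right child passes over the strand formed by the parent edge (for the root: the sprouting edge) and the new edge. Extend the strand sprouting from the root until it meets the $x$-axis at $0$. This gives a tangle consisting of $n$ arcs in the upper half-plane with endpoints $0,1,\tfrac32,2,\dots,n-\tfrac12,n$. Do the same with $T_-$ in the lower half-plane (drawn upside down relative to $T_+$, leaves on the $x$-axis, root at the bottom; again the strand formed by the two child edges passes over). Gluing the two tangles along the $x$-axis gives the link diagram $\mathcal{L}(T_+,T_-)$. The positive elements of $F$ (the elements of the positive monoid $F_+$) are those represented by pairs whose bottom tree $T_-$ is the right vine: the binary tree in which the left child of every interior vertex is a leaf. One writes $\mathcal{L}(T)=\mathcal{L}(T,T_-)$,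 where $T_-$ is the right vine with as many leaves as $T$. The links $\mathcal{L}(T)$ are called positive Thompson links. **Arborescent tangles.** Let $t$ be a finite rooted plane tree with integer vertex weights. The arborescent tangle $\tau(t)$ (with four endpoints NW, NE, SW, SE) is defined recursively. For an integer $w$ let $E(w)$ be the horizontal twist region with $|w|$ crossings side by side; a crossing is positive if its strand going from the bottom left to the top right is above the other strand, the crossings are positive if $w>0$ and negative if $w<0$, and $E(0)$ consists of two horizontal arcs. If the root of $t$ has weight $w$ and the subtrees rooted at its children are, in planar order, $t_1,\dots,t_k$ ($k\ge 0$), then $\tau(t)$ is the horizontal sum $\rho(\tau(t_1))+\dots+\rho(\tau(t_k))+E(w)$, where $\rho$ reflects a planar tangle diagram in the diagonal from bottom left to top right, keeping over/under information (so $\rho$ turns horizontal twist regions into vertical twist regions of the same sign). The closure of a tangle is obtained by joining NW to NE and SW to SE by simple arcs outside the tangle. **Bipartite trees.** A finite rooted plane tree with vertex weights is called bipartite if all weights are $\pm1$, adjacent vertices carry weights of different signs, the root and all leaves carry weight $-1$, and all vertices of weight $1$ have degree (valency) $2$. A bipartite arborescent tangle is the tangle $\tau(t)$ of a bipartite tree $t$. *)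

(* Defs.v *)
From HB Require Import structures.
From mathcomp Require Import all_boot all_order all_algebra.
From mathcomp Require Import all_classical all_reals.
From mathcomp Require Import topology normedtype.
Set Implicit Arguments.
Unset Strict Implicit.
Unset Printing Implicit Defensive.
Import Order.TTheory GRing.Theory Num.Theory.
Import numFieldNormedType.Exports.
Local Open Scope classical_set_scope.
Local Open Scope ring_scope.

(* Space is [R^3 = R * R * R]; a point is written [(x, y, z)].  Diagrams are
   drawn in the plane [z = 0] and seen from [z = +oo].  The strand passing over
   at a crossing point [(x, y)] is lifted to [(x, y, 1)] there, so that a
   diagram is an actual polygonal subset of [R^3]. *)

Notation space R := (R * R * R)%type.

(* The 3-sphere, as [R^3] together with a point at infinity. *)
Notation sphere3 R := (one_point_compactification (space R)).

Section Isotopy.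
Context {R : realType}.
Local Notation S3 := (sphere3 R).

Definition homeomorphism (X Y : topologicalType) (f : X -> Y) : Prop :=
  continuous f /\ exists g : Y -> X, [/\ continuous g, cancel f g & cancel g f].

(* A link: a closed (hence compact) subset of the 3-sphere which, near each of
   its points, looks like the z-axis in [R^3]; these are exactly the finite
   disjoint unions of tame circles. *)
Definition link (L : set S3) : Prop :=
  closed L /\
  forall p : S3, L p -> exists phi : space R -> S3,
    [/\ continuous phi, injective phi,
        forall U : set (space R), open U -> open (phi @` U),
        phi (0, 0, 0) = p &
        phi @^-1` L = [set q | q.1.1 = 0 /\ q.1.2 = 0]].

Definition ambient_isotopy (H : R -> S3 -> S3) : Prop :=
  [/\ {within `[0, 1] `*` setT, continuous (fun tp : R * S3 => H tp.1 tp.2)},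
      forall t, t \in `[0, 1] -> homeomorphism (H t) &
      forall p, H 0 p = p].

Definition isotopic (L L' : set S3) : Prop :=
  exists H, ambient_isotopy H /\ H 1 @` L = L'.

End Isotopy.

Section Drawing.
Context {R : realType}.
Local Notation point := (R * R)%type.

Definition in_sphere (X : set (space R)) : set (sphere3 R) := Some @` X.

Definition at_height (p : point) (z : R) : space R := (p, z).

Definition segment (p q : space R) : set (space R) :=
  [set (p.1.1 + t * (q.1.1 - p.1.1),
        p.1.2 + t * (q.1.2 - p.1.2),
        p.2 + t * (q.2 - p.2)) | t in `[0, 1]].

Definition planar_segment (p q : point) : set (space R) := segment (at_height p 0) (at_height q 0).

End Drawing.

Section Thompson.
Context {R : realType}.

Inductive btree := Leaf | Node of btree & btree.

Fixpoint nleaves (T : btree) : nat :=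
  if T is Node l r then (nleaves l + nleaves r)%N else 1.

Fixpoint right_vine (carets : nat) : btree :=
  if carets is k.+1 then Node Leaf (right_vine k) else Leaf.

(* Position of the root of [T], when the leaves of [T] are at the points
   [a + 1, ..., a + nleaves T] of the x-axis.  An interior vertex sits above
   the endpoint of the new edge issued from it, at height one less than the
   number of leaves below it; with straight edges this drawing is planar. *)
Definition vertex (a : nat) (T : btree) : R * R :=
  match T with
  | Leaf => (a.+1%:R, 0)
  | Node l r => ((a + nleaves l)%:R + 2^-1, (nleaves T).-1%:R)
  end.

(* The part of the tangle below the root of [T].  At an interior vertex [v],
   the two child edges form the over strand, hence start at [at_height v 1]; the
   parent edge and the new edge form the under strand, through [at_height v 0]. *)
Fixpoint below_root (a : nat) (T : btree) : set (space R) :=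
  match T with
  | Leaf => set0
  | Node l r =>
      let v := vertex a T in
      let b := (a + nleaves l)%N in
      segment (at_height v 1) (at_height (vertex a l) 0)
      `|` segment (at_height v 1) (at_height (vertex b r) 0)
      `|` planar_segment v (b%:R + 2^-1, 0)
      `|` below_root a l
      `|` below_root b r
  end.

Definition upper_tangle (T : btree) : set (space R) :=
  let v := vertex 0 T in
  let n : R := (nleaves T)%:R in
  below_root 0 T `|` planar_segment v (v.1, n) `|` planar_segment (v.1, n) (0, n) `|` planar_segment (0, n) (0, 0).

Definition lower_tangle (T : btree) : set (space R) :=
  [set (q.1.1, - q.1.2, q.2) | q in upper_tangle T].

(* Meaningful when [nleaves Tp = nleaves Tm]. *)
Definition thompson_link (Tp Tm : btree) : set (sphere3 R) :=
  in_sphere (upper_tangle Tp `|` lower_tangle Tm).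

Definition positive_thompson_link (T : btree) : set (sphere3 R) :=
  thompson_link T (right_vine (nleaves T).-1).

End Thompson.

Section Arborescent.
Context {R : realType}.
Local Notation tangle := (set (space R)).

(* Finite rooted plane trees with integer vertex weights. *)
Inductive wtree := WNode of int & seq wtree.

(* Tangles live over the square [-1, 1] x [-1, 1] and meet the boundary of the
   square exactly in its corners, the endpoints NW, NE, SW, SE. *)

Definition crossing (positive : bool) : tangle :=
  let zrising : R := if positive then 1 else 0 in
  let zfalling : R := if positive then 0 else 1 in
  segment (-1, -1, 0) (0, 0, zrising) `|` segment (0, 0, zrising) (1, 1, 0)
  `|` segment (-1, 1, 0) (0, 0, zfalling) `|` segment (0, 0, zfalling) (1, -1, 0).

Definition horizontal_arcs : tangle :=
  planar_segment (-1, 1) (0, 2^-1) `|` planar_segment (0, 2^-1) (1, 1)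
  `|` planar_segment (-1, -1) (0, - 2^-1) `|` planar_segment (0, - 2^-1) (1, -1).

(* [A] and [B] are put side by side, so that NE (SE) of [A] becomes NW (SW) of
   [B], in the rectangle [-1/2, 1/2] x [-1/2, 1/2], whose corners are then
   joined to those of the big square. *)
Definition hsum (A B : tangle) : tangle :=
  [set ((q.1.1 - 1) / 4, q.1.2 / 2, q.2) | q in A]
  `|` [set ((q.1.1 + 1) / 4, q.1.2 / 2, q.2) | q in B]
  `|` planar_segment (-1, 1) (- 2^-1, 2^-1) `|` planar_segment (1, 1) (2^-1, 2^-1)
  `|` planar_segment (-1, -1) (- 2^-1, - 2^-1) `|` planar_segment (1, -1) (2^-1, - 2^-1).

Definition twist (w : int) : tangle :=
  match w with
  | Posz 0 => horizontal_arcs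
  | Posz k.+1 => iter k (hsum (crossing true)) (crossing true)
  | Negz k => iter k (hsum (crossing false)) (crossing false)
  end.

Definition rho (A : tangle) : tangle := [set (q.1.2, q.1.1, q.2) | q in A].

Fixpoint tau (t : wtree) : tangle :=
  let: WNode w ts := t in
  foldr (fun s A => hsum (rho (tau s)) A) (twist w) ts.

Definition closure_link (A : tangle) : set (sphere3 R) :=
  in_sphere (A `|` planar_segment (-1, 1) (0, 2) `|` planar_segment (0, 2) (1, 1)
               `|` planar_segment (-1, -1) (0, - 2) `|` planar_segment (0, - 2) (1, -1)).

Definition weight (t : wtree) : int := let: WNode w _ := t in w.

(* The conditions at [t] and all its descendants, where [parent] is the weight
   of the parent of [t], or [None] if [t] is the root. *)
Fixpoint bipartite_at (parent : option int) (t : wtree) : bool :=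
  let: WNode w ts := t in
  let valency := (size ts + isSome parent)%N in
  [&& w \in [:: 1; -1],
      if parent is Some w' then w' != w else true,
      nilp ts ==> (w == -1),
      (w == 1) ==> (valency == 2)
    & all (bipartite_at (Some w)) ts].

Definition bipartite (t : wtree) : bool :=
  (weight t == -1) && bipartite_at None t.

End Arborescent.

(* Main.v *)
From Stdlib Require QArith_base Qreduction.
From Stdlib Require Import BinInt.
Require Import Defs.
From mathcomp Require Import all_boot all_order all_algebra.
From mathcomp Require Import all_classical all_reals.
From mathcomp Require Import topology normedtype.
From mathcomp Require Import ring lra.
From mathcomp Require Import ssrZ zify.
Set Implicit Arguments.
Unset Strict Implicit.
Unset Printing Implicit Defensive.
Import Order.TTheory GRing.Theory Num.Theory.
Import numFieldNormedType.Exports.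
Local Open Scope classical_set_scope.
Local Open Scope ring_scope.
Local Notation space R := (R * R * R)%type.

(* Isotopies are compositions of pushes [p |-> p + lambda(p) d], where [lambda] is the minimum of
   finitely many affine functionals, truncated to [0, 1].  A push is a bilipschitz homeomorphism at
   bounded distance from the identity, so by the Alexander trick it is the end of an ambient isotopy
   of the sphere; it moves exactly the part of a polygonal link lying in a convex region.  An explicit
   list of pushes between two explicit diagrams is validated by computation over the rationals, or
   over affine forms in nonnegative parameters when the positions depend on the tree.

   The lower tree of [L(T)] is a right vine, whose crossings lie on a line, between consecutive
   leaves of [T].  Each of them is turned into a box containing a negative crossing, and then the
   interior vertices of [T] are collapsed onto the line, from the leaves to the root: the vertex with
   subtrees [l] and [r] merges the boxes [A] and [B] of [l] and [r] into [hsum (stack A) B], with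
   [stack A = rho (hsum (rho A) E(1))].  Hence [L(T)] is the closure of [fill T V], where
   [fill (Node l r) B = hsum (stack (fill l E(-1))) (fill r B)] and [V] consists of two vertical arcs.
   The weighted tree with root [-1] and children [kids T] has tangle [fill T E(-1)], and every
   bipartite tree is of this form.  As [V] is isotopic to [hsum (stack E(-1)) E(-1)], [L(T)] is the
   closure of a bipartite tangle.  Conversely, for [T = Node (Node S Leaf) Leaf], the closure of
   [fill T V] can be unwound to the closure of [fill S E(-1)]. *)

(** * Ambient isotopies of the sphere from bilipschitz maps at bounded distance from the identity *)

Section AlexanderTrick.
Context {R : realType}.
Local Notation sp := (space R).

(** The Alexander trick builds an isotopy from its final map alone, so a geometric step is one map
    and the image of one set. The obstacle is that these sets are exact polygons of unbounded size:
    a step must move some strands exactly as claimed and fix all others. Hence supports are recorded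
    throughout, trees enter only through a few nonnegative parameters, and an unspecified tangle is
    known only to lie in its box. The auxiliary tangles come from a formal calculus of fractions:
    [E(w)] has fraction [w], [rho] inverts, sums add. Then [stack] is [F -> F/(1+F)] and adding
    [E(-1)] is [F -> F-1]. So [hsum (stack E(-1)) E(-1)] has fraction infinity, that of [V]. And
    [stack], then [E(-1)], then [stack] compose to [F -> -1/F], a quarter turn. Closing a sum with
    [V] gives the other closure of the left summand, and the quarter turn exchanges the closures
    back; this is the origin of [Node (Node S Leaf) Leaf]. The last box contains [V] and not a
    crossing because a vine with [n] leaves has [n-1] crossings only. *)

Definition lipschitz (f : sp -> sp) : Prop :=
  exists C : R, forall p q, `|f p - f q| <= C * `|p - q|.

(** The Lipschitz inverse makes [move_in] symmetric. The bounded displacement makes the dilates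
    converge to the identity at time 0 and extend continuously to infinity. *)
Definition supported_homeo (U : set sp) (f : sp -> sp) : Prop :=
  [/\ exists g, [/\ cancel f g, cancel g f & lipschitz g],
      lipschitz f,
      exists M : R, forall p, `|f p - p| <= M &
      forall p, ~ U p -> f p = p].

Definition move_in (U X Y : set sp) : Prop :=
  exists2 f, supported_homeo U f & f @` X = Y.

(** Alexander's [|t| f(x / |t|)], rewritten so that it is the identity at [t = 0] without a case
    distinction; [|t|] makes it meaningful at every real time. *)
Definition dilate (f : sp -> sp) (t : R) (x : sp) : sp :=
  x + `|t| *: (f (`|t|^-1 *: x) - `|t|^-1 *: x).

Lemma dilateE f t x : t != 0 -> dilate f t x = `|t| *: f (`|t|^-1 *: x).
Proof.
move=> t0; rewrite /dilate scalerBr scalerA mulfV ?normr_eq0// scale1r.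
by rewrite addrC subrK.
Qed.

Lemma dilate0 f x : dilate f 0 x = x.
Proof. by rewrite /dilate normr0 scale0r addr0. Qed.

Lemma dilate_dist f (M : R) : (forall p, `|f p - p| <= M) ->
  forall t x, `|dilate f t x - x| <= `|t| * M.
Proof.
move=> fM t x; rewrite /dilate addrC addrA addNr add0r prod_norm_scale normr_id.
by rewrite ler_wpM2l.
Qed.

Lemma dilateK f g : cancel f g -> forall t, cancel (dilate f t) (dilate g t).
Proof.
move=> fK t x; have [->|t0] := eqVneq t 0; first by rewrite !dilate0.
by rewrite !dilateE// scalerA mulVf ?normr_eq0// scale1r fK scalerA mulfV ?normr_eq0// scale1r.
Qed.

Lemma lipschitz_continuous f : lipschitz f -> continuous f.
Proof.
case=> C fC x; apply/cvgrPdist_lt => e e0 /=.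
have C1 : 0 < `|C| + 1 by rewrite ltr_pwDr.
near=> y; rewrite (le_lt_trans (fC _ _))//.
have : `|x - y| < e / (`|C| + 1).
  near: y; apply: (@cvgr_dist_lt _ _ _ (nbhs x) _ id x); last by rewrite divr_gt0.
  exact: cvg_id.
rewrite ltr_pdivlMr// => xy.
rewrite (le_lt_trans _ xy)// mulrC ler_wpM2l// (le_trans (ler_norm C))//.
by rewrite lerDl.
Unshelve. all: by end_near. Qed.

(** At time 0 continuity comes from the bound [|t| M] on the displacement; at other times the map is
    a composition of continuous maps. *)
Lemma dilate_continuous f : lipschitz f -> (exists M : R, forall p, `|f p - p| <= M) ->
  continuous (fun tx : R * sp => dilate f tx.1 tx.2).
Proof.
move=> /lipschitz_continuous fc [M fM] [t x].
have [->|t0] := eqVneq t 0.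
  rewrite /continuous_at /= dilate0; apply/cvgrPdist_lt => e e0 /=.
  have M0 : 0 <= M by rewrite (le_trans _ (fM 0)).
  have M1 : 0 < M + 1 by rewrite ltr_wpDl.
  near=> ty.
  have -> : x - dilate f ty.1 ty.2 = (x - ty.2) - (dilate f ty.1 ty.2 - ty.2).
    by rewrite opprB addrA subrK.
  rewrite (le_lt_trans (ler_normB _ _))// (splitr e) ltrD//.
    near: ty; apply: (@cvgr_dist_lt _ _ _ (nbhs (0 : R, x)) _ snd x); last by rewrite divr_gt0.
    exact: cvg_snd.
  rewrite (le_lt_trans (dilate_dist fM _ _))//.
  have : `|0 - ty.1| < e / 2 / (M + 1).
    near: ty; apply: (@cvgr_dist_lt _ _ _ (nbhs (0 : R, x)) _ fst 0); last by rewrite !divr_gt0.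
    exact: cvg_fst.
  rewrite sub0r normrN ltr_pdivlMr// => h; rewrite (le_lt_trans _ h)//.
  by rewrite ler_wpM2l// lerDl.
have c1 : (fun tx : R * sp => `|tx.1|) @ (t, x) --> `|t|.
  by apply: cvg_norm; exact: cvg_fst.
have c2 : (fun tx : R * sp => tx.2) @ (t, x) --> x by exact: cvg_snd.
have c3 : (fun tx : R * sp => `|tx.1|^-1 *: tx.2) @ (t, x) --> (`|t|^-1 *: x).
  by apply: cvgZ => //; apply: cvgV => //; rewrite normr_eq0.
rewrite /continuous_at /dilate; apply: cvgD => //; apply: cvgZ => //.
apply: cvgB => //.
by apply: (@cvg_comp _ _ _ (fun tx : R * sp => `|tx.1|^-1 *: tx.2) f _ _ _ c3); exact: fc.
Unshelve. all: by end_near. Qed.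

Definition sphere_map (f : sp -> sp) (p : sphere3 R) : sphere3 R := omap f p.

Lemma compact_ball (r : R) : compact [set x : sp | `|x| <= r].
Proof.
have -> : [set x : sp | `|x| <= r] = (`[- r, r] `*` `[- r, r]) `*` `[- r, r].
  apply/seteqP; split=> [[[x y] z]|[[x y] z]] /=;
    rewrite !prod_normE /= !ge_max !ler_norml !in_itv /=.
    by move=> /andP[/andP[-> ->] ->].
  by move=> [[-> ->] ->].
by apply: compact_setX; [apply: compact_setX|]; exact: segment_compact.
Qed.

Lemma sphere_dilate_continuous f : lipschitz f ->
    (exists M : R, forall p, `|f p - p| <= M) ->
  continuous (fun tp : R * sphere3 R => sphere_map (dilate f tp.1) tp.2).
Proof.
move=> fl fM [t [x|]] A /=.
  move=> nA; have /(_ (t, x)) := dilate_continuous fl fM.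
  move=> /(_ (Some @^-1` A)) /= [//|[P1 P2] /= [nP1 nP2] P12].
  exists (P1, Some @` P2) => /=; first by split=> //; exact: one_point_compactification_some_nbhs.
  by move=> [s _] /= [P1s [y P2y <-]]; exact: (P12 (s, y)).
case=> K [/compact_bounded[B [_ KB]] Kcl] KA.
have [M M0 {}fM] : exists2 M : R, 0 <= M & forall p, `|f p - p| <= M.
  by case: fM => M fM; exists M => //; rewrite (le_trans _ (fM 0)).
pose B1 := `|B| + 1; have B1K x : K x -> `|x| <= B1.
  by apply: KB; rewrite /B1 (le_lt_trans (ler_norm B))// ltrDl.
(* For [s] within 1 of [t] the displacement is at most [(|t| + 1) M], so a point outside the ball of
   radius [r] cannot land in [K]. *)
pose r := B1 + (`|t| + 1) * M.
exists (ball t 1, Some @` (~` [set x | `|x| <= r]) `|` [set None]) => /=.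
  split; first exact: nbhsx_ballx.
  exists [set x | `|x| <= r] => //; split; first exact: compact_ball.
  by apply: compact_closed; [exact: norm_hausdorff|exact: compact_ball].
move=> [s _] /= [st [[x /= xr <-]|->]]; last by apply: KA; right.
apply: KA; left => /=; exists (dilate f s x) => // Kfx; apply: xr.
have sM := dilate_dist fM s x.
rewrite -(subrK (dilate f s x) x) addrC (le_trans (ler_normD _ _))// lerD//.
  exact: B1K.
rewrite distrC (le_trans sM)// ler_wpM2r//.
move: st; rewrite /ball /= => st.
by rewrite -lerBlDl (le_trans (lerB_dist _ _))// distrC ltW.
Qed.

Lemma sphere_dilateK f g : cancel f g -> forall t,
  cancel (sphere_map (dilate f t)) (sphere_map (dilate g t)).
Proof. by move=> fK t [x|] //=; rewrite dilateK. Qed.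

Lemma supported_homeo_inv U f g : supported_homeo U f ->
  cancel f g -> cancel g f -> lipschitz g -> supported_homeo U g.
Proof.
case=> [_ fl [M fM] fU] fK gK gl; split=> //.
- by exists f.
- by exists M => p; rewrite -[X in _ - X]gK distrC.
- by move=> p /fU fp; rewrite -[in LHS]fp fK.
Qed.

Lemma sphere_map_homeo U f t : supported_homeo U f ->
  homeomorphism (sphere_map (dilate f t)).
Proof.
move=> fh; case: (fh) => [[g [fK gK gl]] fl fM _].
have [_ _ gM _] := supported_homeo_inv fh fK gK gl.
have slice h : lipschitz h -> (exists M : R, forall p, `|h p - p| <= M) ->
    continuous (sphere_map (dilate h t)).
  move=> hl hM p.
  have c1 : (fun q : sphere3 R => (t, q)) @ p --> (t, p).
    by apply: (@cvg_pair _ _ _ (nbhs p) (nbhs t) (nbhs p)); [exact: cvg_cst|exact: cvg_id].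
  move=> A /(sphere_dilate_continuous hl hM (x := (t, p))) /c1; exact.
split; first exact: slice.
by exists (sphere_map (dilate g t)); split; [exact: slice|exact: sphere_dilateK..].
Qed.

(** The two isotopies run simultaneously, the dilate of [f] at time [t] being applied after [H t];
    this avoids gluing two time intervals. *)
Lemma isotopic_move_in U (L : set (sphere3 R)) (X Y : set sp) :
  move_in U X Y -> isotopic L (in_sphere X) -> isotopic L (in_sphere Y).
Proof.
case=> f fh fXY [H [[Hc Hh H0] H1]].
case: (fh) => _ fl fM _.
exists (fun t => sphere_map (dilate f t) \o H t); split; [split|].
- apply/subspace_continuousP => tp tpA.
  have /subspace_continuousP/(_ tp tpA) Hcp := Hc.
  have c1 : (fun tp : R * sphere3 R => (tp.1, H tp.1 tp.2)) @
      within (`[0, 1] `*` setT) (nbhs tp) --> (tp.1, H tp.1 tp.2).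
    apply: (@cvg_pair _ _ _ _ (nbhs tp.1) (nbhs (H tp.1 tp.2))) => //=.
    by apply: cvg_within_filter; exact: cvg_fst.
  by move=> A /(sphere_dilate_continuous fl fM (x := (tp.1, H tp.1 tp.2))) /c1.
- move=> t t01; have [Htc [G [Gc HK GK]]] := Hh _ t01.
  have [fc [g [gc fK gK]]] := sphere_map_homeo t fh.
  split; first by move=> p; apply: continuous_comp; [exact: Htc|exact: fc].
  exists (G \o g); split.
  + by move=> p; apply: continuous_comp; [exact: gc|exact: Gc].
  + by move=> p /=; rewrite fK HK.
  + by move=> p /=; rewrite GK gK.
- by move=> p /=; rewrite H0; case: p => //= x; rewrite dilate0.
- rewrite -[LHS]/((sphere_map (dilate f 1) \o H 1) @` L) -image_comp H1.
  have -> : sphere_map (dilate f 1) = sphere_map f.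
    apply/funext => -[x|//] /=; congr Some.
    by rewrite dilateE ?oner_eq0// normr1 invr1 !scale1r.
  by rewrite /in_sphere -fXY !image_comp.
Qed.

Lemma move_in_refl U X : move_in U X X.
Proof.
exists id; last by rewrite image_id.
split=> //; first by exists id; split=> //; exists 1 => p q; rewrite mul1r.
  by exists 1 => p q; rewrite mul1r.
by exists 0 => p; rewrite subrr normr0.
Qed.

Lemma move_in_sym U X Y : move_in U X Y -> move_in U Y X.
Proof.
case=> f fh <-; case: (fh) => -[g [fK gK gl]] _ _ _.
exists g; first exact: supported_homeo_inv fK gK gl.
rewrite image_comp -[RHS]image_id; congr image.
by apply/funext => p /=; rewrite fK.
Qed.

Lemma lipschitz_comp f g : lipschitz f -> lipschitz g -> lipschitz (f \o g).
Proof.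
case=> C fC [D gD]; exists (`|C| * `|D|) => p q /=.
rewrite (le_trans (fC _ _))// (le_trans (ler_wpM2r _ (ler_norm C)))// -mulrA.
by rewrite ler_wpM2l// (le_trans (gD _ _))// ler_wpM2r// ler_norm.
Qed.

Lemma move_in_trans Y U X Z : move_in U X Y -> move_in U Y Z -> move_in U X Z.
Proof.
case=> f [[f' [fK f'K f'l]] fl [M fM] fU] <- [g [[g' [gK g'K g'l]] gl [N gN] gU] <-].
exists (g \o f); last by rewrite image_comp.
split.
- exists (f' \o g'); split; [exact: can_comp|exact: can_comp|exact: lipschitz_comp].
- exact: lipschitz_comp.
- exists (N + M) => p /=; rewrite -(subrK (f p) (g (f p))) -addrA.
  by rewrite (le_trans (ler_normD _ _))// lerD.
- by move=> p Up /=; rewrite fU// gU.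
Qed.

Lemma move_in_sub V U X Y : V `<=` U -> move_in V X Y -> move_in U X Y.
Proof.
by move=> VU [f [? ? ? fV] fXY]; exists f => //; split=> // p Up; apply: fV => /VU.
Qed.

(** Locality: a small diagram can be moved inside a larger one of which only the disjointness from
    the support is known. *)
Lemma move_inU Z U X Y : (forall p, Z p -> ~ U p) -> move_in U X Y ->
  move_in U (X `|` Z) (Y `|` Z).
Proof.
move=> ZU [f fh <-]; exists f => //; rewrite image_setU; congr setU.
case: fh => _ _ _ fU; apply/seteqP; split=> [_ [p Zp <-]|p Zp] /=.
  by rewrite fU//; exact: ZU.
by exists p => //; rewrite fU//; exact: ZU.
Qed.

Lemma move_in_conj (a b : sp -> sp) U X Y : cancel a b -> cancel b a ->
  lipschitz b -> (exists C : R, forall p q, `|a p - a q| <= C * `|p - q|) ->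
  move_in U X Y -> move_in (a @` U) (a @` X) (a @` Y).
Proof.
move=> aK bK bl al [f [[g [fK gK gl]] fl [M fM] fU] <-].
exists (a \o f \o b); last first.
  by rewrite !image_comp; congr image; apply/funext => p /=; rewrite aK.
split.
- exists (a \o g \o b); split.
  + by move=> p /=; rewrite aK fK bK.
  + by move=> p /=; rewrite aK gK bK.
  + by apply: lipschitz_comp => //; exact: lipschitz_comp.
- by apply: lipschitz_comp => //; exact: lipschitz_comp.
- case: al => C aC; exists (`|C| * `|M|) => p /=.
  rewrite -[X in _ - X]bK (le_trans (aC _ _))//.
  rewrite (le_trans (ler_wpM2r _ (ler_norm C)))// ler_wpM2l//.
  by rewrite (le_trans (fM _))// ler_norm.
- by move=> p Up /=; rewrite fU ?bK// => Ub; apply: Up; exists (b p).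
Qed.

End AlexanderTrick.

(** * Pushes, their inverses and their Lipschitz bounds *)

Section Push.
Context {R : realType}.
Local Notation sp := (space R).
Local Notation aff := (R * R * R * R)%type.

Definition ev (a : aff) (p : sp) : R :=
  a.1.1.1 * p.1.1 + a.1.1.2 * p.1.2 + a.1.2 * p.2 + a.2.

Definition slope (a : aff) (d : sp) : R :=
  a.1.1.1 * d.1.1 + a.1.1.2 * d.1.2 + a.1.2 * d.2.

Definition one_aff : aff := (0, 0, 0, 1).

Definition least (s : seq aff) (p : sp) : R :=
  foldr (fun a m => Num.min (ev a p) m) 1 s.

Definition weight_at (s : seq aff) (p : sp) : R := Num.max 0 (least s p).

Definition translate (p d : sp) (t : R) : sp :=
  (p.1.1 + t * d.1.1, p.1.2 + t * d.1.2, p.2 + t * d.2).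

Definition push (s : seq aff) (d p : sp) : sp := translate p d (weight_at s p).

Definition support (s : seq aff) : set sp :=
  [set p | forall a, a \in s -> 0 < ev a p].

Lemma ev_translate a p d t : ev a (translate p d t) = ev a p + t * slope a d.
Proof. by rewrite /ev /slope /translate /=; ring. Qed.

Lemma le_least s p (m : R) : m <= 1 -> (forall a, a \in s -> m <= ev a p) ->
  m <= least s p.
Proof.
move=> m1; elim: s => //= a s IH H; rewrite le_min H ?mem_head//=.
by apply: IH => b bs; apply: H; rewrite inE bs orbT.
Qed.

Lemma least_le1 s p : least s p <= 1.
Proof. by elim: s => //= a s IH; rewrite ge_min IH orbT. Qed.

Lemma least_le s p a : a \in s -> least s p <= ev a p.
Proof.
elim: s => //= b s IH; rewrite inE => /orP[/eqP->|/IH h]; first by rewrite ge_min lexx.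
by rewrite ge_min h orbT.
Qed.

Lemma leastP s p : least s p = 1 \/ exists2 a, a \in s & least s p = ev a p.
Proof.
elim: s => /= [|b s IH]; first by left.
rewrite /Num.min; case: ifP => _; first by right; exists b; rewrite ?mem_head.
by case: IH => [->|[a sa ->]]; [left|right; exists a => //; rewrite inE sa orbT].
Qed.

Lemma weight_ge0 s p : 0 <= weight_at s p.
Proof. by rewrite le_max lexx. Qed.

Lemma weight_le1 s p : weight_at s p <= 1.
Proof. by rewrite ge_max ler01 least_le1. Qed.

Lemma weight_at_out s p : ~ support s p -> weight_at s p = 0.
Proof.
move=> sp'; apply/eqP; rewrite eq_le weight_ge0 andbT ge_max lexx /= leNgt.
apply/negP => s0; apply: sp' => a sa; exact: lt_le_trans (least_le _ sa).
Qed.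

Lemma push_out s d p : ~ support s p -> push s d p = p.
Proof.
move=> /weight_at_out h; rewrite /push h /translate !mul0r !addr0.
by case: p h => [[]].
Qed.

Lemma weight_at_eq s p g : g \in one_aff :: s -> 0 <= ev g p ->
  (forall a, a \in one_aff :: s -> ev g p <= ev a p) -> weight_at s p = ev g p.
Proof.
move=> gs g0 gle; rewrite /weight_at; suff -> : least s p = ev g p by rewrite max_r.
have e1 : ev one_aff p = 1 by rewrite /ev /= !mul0r !add0r.
apply/eqP; rewrite eq_le; apply/andP; split; last first.
  apply: le_least => [|a sa]; first by rewrite -e1 gle ?mem_head.
  by rewrite gle// inE sa orbT.
move: gs; rewrite inE => /orP[/eqP->|]; last exact: least_le.
by rewrite e1 least_le1.
Qed.

(** Where [a] is the least functional, the push multiplies its value by [1 + slope a d]. Dividing by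
    this factor gives a functional that takes after the push the value of [a] before it. *)
Definition push_inv (d : sp) (a : aff) : aff :=
  let k := (1 + slope a d)^-1 in (k * a.1.1.1, k * a.1.1.2, k * a.1.2, k * a.2).

Lemma ev_push_inv d a p : ev (push_inv d a) p = ev a p / (1 + slope a d).
Proof. by rewrite /ev /push_inv /=; ring. Qed.

Definition opp_sp (d : sp) : sp := (- d.1.1, - d.1.2, - d.2).

Lemma translateN p d t : translate (translate p d t) (opp_sp d) t = p.
Proof.
case: p => [[x y] z]; rewrite /translate /opp_sp /=.
by congr (_, _, _); ring.
Qed.

Section Inverse.
Variables (s : seq aff) (d : sp).
Hypothesis sd : forall a, a \in s -> 0 < 1 + slope a d.

(** If [m] is the weight at [p], the rescaled functional of [a] takes at the pushed point the value
    [m + (ev a p - m) / (1 + slope a d)]. This is at least [m], with equality for the least [a]; the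
    inverse of a push is therefore a push in the opposite direction. *)
Lemma weight_at_push p : weight_at (map (push_inv d) s) (push s d p) = weight_at s p.
Proof.
have [l0|l0] := ltP 0 (least s p); last first.
  have w0 : weight_at s p = 0 by rewrite /weight_at max_l.
  rewrite push_out ?w0; last first.
    by move=> sp'; move: l0; rewrite leNgt; case: (leastP s p) => [->|[a /sp' h ->]]; rewrite ?ltr01 ?h.
  rewrite weight_at_out// => h.
  case: (leastP s p) l0 => [->|[a sa ->]]; first by rewrite ler10.
  have := h _ (map_f _ sa); rewrite ev_push_inv pmulr_lgt0 ?invr_gt0 ?sd//.
  by move=> ?; rewrite leNgt => /negP; apply.
have w : weight_at s p = least s p by rewrite /weight_at max_r// ltW.
rewrite /push w; set m := least s p.
have H a : a \in s -> ev (push_inv d a) (translate p d m) = m + (ev a p - m) / (1 + slope a d).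
  move=> /sd /lt0r_neq0 a0; rewrite ev_push_inv ev_translate.
  by apply: (mulIf a0); rewrite divfK// mulrDl divfK//; ring.
apply: etrans (_ : Num.max 0 m = _); last by rewrite max_r// ltW.
congr Num.max; apply/eqP; rewrite eq_le; apply/andP; split; last first.
  apply: le_least => [|_ /mapP[a sa ->]]; first exact: least_le1.
  by rewrite H// lerDl mulr_ge0// ?subr_ge0 ?least_le// invr_ge0 ltW// sd.
case: (leastP s p) => [m1|[a sa ma]]; first by rewrite [X in _ <= X]m1 least_le1.
have := @least_le (map (push_inv d) s) (translate p d m) _ (map_f _ sa).
by rewrite H// -ma subrr mul0r addr0.
Qed.

Lemma pushK : cancel (push s d) (push (map (push_inv d) s) (opp_sp d)).
Proof. by move=> p; rewrite {1}/push weight_at_push translateN. Qed.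
End Inverse.

(** Rescaling twice restores the functionals, so [pushK] applied to the inverse push yields the
    other cancellation. *)
Lemma push_invK s d : (forall a, a \in s -> 0 < 1 + slope a d) ->
  map (push_inv (opp_sp d)) (map (push_inv d) s) = s.
Proof.
move=> sd; rewrite -map_comp -[RHS]map_id; apply/eq_in_map => a sa /=.
have a0 := sd _ sa; have a1 := lt0r_neq0 a0.
have e : 1 + slope (push_inv d a) (opp_sp d) = (1 + slope a d)^-1.
  by move: a1; rewrite /push_inv /slope /opp_sp /= => a1; field.
rewrite /(push_inv (opp_sp d)) e invrK; move: a1; rewrite /push_inv /=.
by move=> a1; case: a {sa a0 e} a1 => [[[a b] c] e] /= a1; congr (_, _, _, _); rewrite mulVKf.
Qed.

Lemma slope_push_inv s d : (forall a, a \in s -> 0 < 1 + slope a d) ->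
  forall a, a \in map (push_inv d) s -> 0 < 1 + slope a (opp_sp d).
Proof.
move=> sd _ /mapP[a /sd a0 ->]; have a1 := lt0r_neq0 a0.
suff -> : 1 + slope (push_inv d a) (opp_sp d) = (1 + slope a d)^-1 by rewrite invr_gt0.
by move: a1; rewrite /push_inv /slope /opp_sp /= => a1; field.
Qed.

Lemma opp_spK : involutive opp_sp.
Proof. by case=> [[x y] z]; rewrite /opp_sp /= !opprK. Qed.

Lemma norm_coord (p : sp) (m : R) :
  `|p.1.1| <= m -> `|p.1.2| <= m -> `|p.2| <= m -> `|p| <= m.
Proof. by move=> h1 h2 h3; rewrite !prod_normE /= !ge_max h1 h2 h3. Qed.

Lemma coord_norm (p : sp) : [/\ `|p.1.1| <= `|p|, `|p.1.2| <= `|p| & `|p.2| <= `|p|].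
Proof. by rewrite !prod_normE /= !le_max !lexx ?orbT. Qed.

Lemma ev_lip a p q : `|ev a p - ev a q| <=
  (`|a.1.1.1| + `|a.1.1.2| + `|a.1.2|) * `|p - q|.
Proof.
have -> : ev a p - ev a q = a.1.1.1 * (p - q).1.1 + a.1.1.2 * (p - q).1.2 + a.1.2 * (p - q).2.
  by rewrite /ev /=; ring.
have [h1 h2 h3] := coord_norm (p - q).
rewrite (le_trans (ler_normD _ _))// mulrDl lerD//; last by rewrite normrM ler_wpM2l.
by rewrite (le_trans (ler_normD _ _))// mulrDl lerD// normrM ler_wpM2l.
Qed.

Lemma min_lip (a b c e m : R) : `|a - c| <= m -> `|b - e| <= m ->
  `|Num.min a b - Num.min c e| <= m.
Proof.
rewrite !ler_norml /Num.min => /andP[? ?] /andP[? ?].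
by case: ltP => ?; case: ltP => ?; apply/andP; split; lra.
Qed.

Lemma least_lip s : exists C : R, forall p q, `|least s p - least s q| <= C * `|p - q|.
Proof.
elim: s => [|a s [C IH]]; first by exists 0 => p q; rewrite subrr normr0 mul0r.
exists (`|a.1.1.1| + `|a.1.1.2| + `|a.1.2| + `|C|) => p q /=; apply: min_lip.
  by rewrite (le_trans (ev_lip _ _ _))// ler_wpM2r// lerDl.
rewrite (le_trans (IH _ _))// ler_wpM2r// (le_trans (ler_norm C))// lerDr.
by rewrite !addr_ge0.
Qed.

Lemma weight_lip s : exists C : R, forall p q, `|weight_at s p - weight_at s q| <= C * `|p - q|.
Proof.
have [C H] := least_lip s; exists C => p q; have := H p q; rewrite /weight_at.
have : 0 <= C * `|p - q| by rewrite (le_trans _ (H p q)).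
rewrite !ler_norml /Num.max => ? /andP[? ?].
by case: ltP => ?; case: ltP => ?; apply/andP; split; lra.
Qed.

Lemma push_lip s d : lipschitz (push s d).
Proof.
have [C H] := weight_lip s; exists (1 + C * `|d|) => p q.
have [h1 h2 h3] := coord_norm (p - q); have [k1 k2 k3] := coord_norm d.
have key (a b c e k : R) : `|a - b| <= `|p - q| -> `|k| <= `|d| ->
   `|c - e| <= C * `|p - q| -> `|(a + c * k) - (b + e * k)| <= (1 + C * `|d|) * `|p - q|.
  move=> l1 l2 l3; have -> : a + c * k - (b + e * k) = (a - b) + (c - e) * k by ring.
  rewrite (le_trans (ler_normD _ _))// [leRHS]mulrDl mul1r lerD//.
  by rewrite normrM mulrAC ler_pM.
by apply: norm_coord => /=; apply: key => //; exact: H.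
Qed.

Lemma push_bound s d p : `|push s d p - p| <= `|d|.
Proof.
have [k1 k2 k3] := coord_norm d.
have key (a k : R) : `|k| <= `|d| -> `|a + weight_at s p * k - a| <= `|d|.
  move=> kd; rewrite addrC addKr normrM (le_trans _ kd)// ler_piMl//.
  by rewrite ger0_norm ?weight_ge0 ?weight_le1.
by apply: norm_coord => /=; exact: key.
Qed.

Lemma push_supported s d : (forall a, a \in s -> 0 < 1 + slope a d) ->
  supported_homeo (support s) (push s d).
Proof.
move=> sd; split.
- exists (push (map (push_inv d) s) (opp_sp d)); split; last exact: push_lip.
    exact: pushK.
  move=> p; have := pushK (slope_push_inv sd) p.
  by rewrite push_invK// opp_spK.
- exact: push_lip.
- by exists `|d| => p; exact: push_bound.
- by move=> p; exact: push_out.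
Qed.

End Push.

(** * Computable rationals and their values in the real field *)

Notation Q := QArith_base.Q.
Definition qfrac (n : Z) (d : positive) : Q := QArith_base.Qmake n d.
Arguments qfrac n%_Z_scope d%_positive_scope.
Declare Scope qfrac_scope.
Delimit Scope qfrac_scope with qfrac.
Bind Scope qfrac_scope with QArith_base.Q.
Notation "n # d" := (qfrac n d) (at level 55, d at level 0) : qfrac_scope.
Notation "0" := (qfrac 0 1) : qfrac_scope.
Notation "1" := (qfrac 1 1) : qfrac_scope.

(** Fractions are reduced at each operation so that numerals stay small during the evaluation of
    long lists of moves. *)
Definition qadd (x y : Q) : Q := Qreduction.Qred (QArith_base.Qplus x y).
Definition qmul (x y : Q) : Q := Qreduction.Qred (QArith_base.Qmult x y).
Definition qopp (x : Q) : Q := QArith_base.Qopp x.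
Definition qsub (x y : Q) : Q := qadd x (qopp y).
Definition qinv (x : Q) : Q := QArith_base.Qinv x.
Definition qle (x y : Q) : bool := QArith_base.Qle_bool x y.
Definition qlt (x y : Q) : bool := ~~ qle y x.
Definition qeq (x y : Q) : bool := QArith_base.Qeq_bool x y.
Definition qmin (x y : Q) : Q := if qle x y then x else y.
Definition qabs (x : Q) : Q := if qle (qfrac 0 1) x then x else qopp x.

Section Rationals.
Context {R : realType}.

Fixpoint p2r (p : positive) : R :=
  match p with xH => 1 | xO p => 2 * p2r p | xI p => 1 + 2 * p2r p end.

Definition z2r (z : Z) : R :=
  match z with Z0 => 0 | Zpos p => p2r p | Zneg p => - p2r p end.

Definition q2r (q : Q) : R := z2r (QArith_base.Qnum q) / p2r (QArith_base.Qden q).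

Lemma p2rE p : p2r p = (Pos.to_nat p)%:R.
Proof.
elim: p => [p IH|p IH|//] /=; rewrite IH.
  by rewrite Pos2Nat.inj_xI -natrM -natr1 addrC.
by rewrite Pos2Nat.inj_xO -natrM.
Qed.

Lemma p2r_gt0 p : 0 < p2r p.
Proof. by rewrite p2rE ltr0n; apply/ssrnat.ltP; exact: Pos2Nat.is_pos. Qed.

Lemma z2rE z : z2r z = (ssrZ.int_of_Z z)%:~R.
Proof.
case: z => //= p; rewrite p2rE //.
by rewrite NegzE mulrNz; congr (- _%:R); rewrite prednK//; apply/ssrnat.ltP; exact: Pos2Nat.is_pos.
Qed.

Lemma z2rD x y : z2r (Z.add x y) = z2r x + z2r y.
Proof. by rewrite !z2rE (rmorphD ssrZ.int_of_Z x y) intrD. Qed.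

Lemma z2rM x y : z2r (Z.mul x y) = z2r x * z2r y.
Proof. by rewrite !z2rE (rmorphM ssrZ.int_of_Z x y) intrM. Qed.

Lemma z2rN x : z2r (Z.opp x) = - z2r x.
Proof. by case: x => [|p|p] /=; rewrite ?oppr0 ?opprK. Qed.

Lemma p2rM p q : p2r (Pos.mul p q) = p2r p * p2r q.
Proof. exact: (z2rM (Zpos p) (Zpos q)). Qed.

Lemma z2r_ge0 z : Z.le 0 z -> 0 <= z2r z.
Proof. by case: z => //= p _; exact/ltW/p2r_gt0. Qed.

Lemma z2r_le x y : Z.le x y -> z2r x <= z2r y.
Proof.
move=> xy; rewrite -subr_ge0 -z2rN -z2rD; apply: z2r_ge0.
exact/Z.le_0_sub.
Qed.

Lemma q2r_cross x y : (q2r x == q2r y) =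
  (z2r (QArith_base.Qnum x) * p2r (QArith_base.Qden y) ==
   z2r (QArith_base.Qnum y) * p2r (QArith_base.Qden x)).
Proof. by rewrite /q2r eqr_div// gt_eqF// p2r_gt0. Qed.

Lemma q2r_Qeq x y : QArith_base.Qeq x y -> q2r x = q2r y.
Proof.
rewrite /QArith_base.Qeq => xy; apply/eqP; rewrite q2r_cross.
by rewrite -[p2r (QArith_base.Qden y)]/(z2r (Zpos _)) -[p2r (QArith_base.Qden x)]/(z2r (Zpos _)) -!z2rM xy.
Qed.

Lemma q2rD x y : q2r (qadd x y) = q2r x + q2r y.
Proof.
rewrite /qadd (q2r_Qeq (Qreduction.Qred_correct _)) /q2r /= p2rM z2rD !z2rM /=.
by rewrite addf_div// gt_eqF// p2r_gt0.
Qed.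

Lemma q2rM x y : q2r (qmul x y) = q2r x * q2r y.
Proof.
rewrite /qmul (q2r_Qeq (Qreduction.Qred_correct _)) /q2r /= p2rM z2rM.
by rewrite mulf_div.
Qed.

Lemma q2rN x : q2r (qopp x) = - q2r x.
Proof. by rewrite /q2r /= z2rN mulNr. Qed.

Lemma q2rB x y : q2r (qsub x y) = q2r x - q2r y.
Proof. by rewrite /qsub q2rD q2rN. Qed.

Lemma q2r_le x y : qle x y -> q2r x <= q2r y.
Proof.
move=> /QArith_base.Qle_bool_iff; rewrite /QArith_base.Qle => /z2r_le.
by rewrite !z2rM /= /q2r ler_pdivlMr ?p2r_gt0// mulrAC ler_pdivrMr ?p2r_gt0.
Qed.

Lemma q2r_eq x y : qeq x y -> q2r x = q2r y.
Proof. by move=> /QArith_base.Qeq_bool_eq /q2r_Qeq. Qed.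

Lemma z2r_lt x y : Z.lt x y -> z2r x < z2r y.
Proof.
move=> /Z.lt_0_sub; rewrite -subr_gt0 -z2rN -z2rD.
by rewrite -/(Z.sub y x); case: (Z.sub y x) => // p _; exact: p2r_gt0.
Qed.

Lemma q2r_lt x y : qlt x y -> q2r x < q2r y.
Proof.
move=> /negP xy; have {}xy : QArith_base.Qlt x y.
  rewrite /QArith_base.Qlt; apply/Z.nle_gt => yx; apply: xy.
  exact/QArith_base.Qle_bool_iff.
have := z2r_lt xy; rewrite !z2rM /= => {}xy.
by rewrite /q2r ltr_pdivlMr ?p2r_gt0// mulrAC ltr_pdivrMr ?p2r_gt0.
Qed.

Lemma q2r0 : q2r (qfrac 0 1) = 0.
Proof. by rewrite /q2r /= mul0r. Qed.

Lemma q2r1 : q2r (qfrac 1 1) = 1.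
Proof. by rewrite /q2r /= divr1. Qed.

Lemma q2r_min x y : q2r (qmin x y) <= q2r x /\ q2r (qmin x y) <= q2r y.
Proof.
rewrite /qmin; case: ifPn => xy; first by split=> //; exact: q2r_le.
by split=> //; exact/ltW/q2r_lt.
Qed.

Lemma q2r_abs x : `|q2r x| <= q2r (qabs x).
Proof.
rewrite /qabs; case: ifPn => [/q2r_le|/q2r_lt]; rewrite q2r0 => x0.
  by rewrite ger0_norm.
by rewrite ltr0_norm// q2rN.
Qed.

End Rationals.

(** * Action of a push on segments *)

Section Planar.
Context {R : realType}.
Local Notation sp := (space R).

(** The tuple lists the 2 by 2 matrix by rows, then the translation; heights are kept, so that over
    and under are preserved. *)
Definition ap (m : R * R * R * R * R * R) (p : sp) : sp :=
  (m.1.1.1.1.1 * p.1.1 + m.1.1.1.1.2 * p.1.2 + m.1.2,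
   m.1.1.1.2 * p.1.1 + m.1.1.2 * p.1.2 + m.2, p.2).

(** All that is ever known of an unspecified tangle. *)
Definition slab : set sp :=
  [set p | [/\ -1 <= p.1.1 <= 1, -1 <= p.1.2 <= 1 & 0 <= p.2 <= 1]].

Definition lerp (p q : sp) (t : R) : sp :=
  (p.1.1 + t * (q.1.1 - p.1.1), p.1.2 + t * (q.1.2 - p.1.2), p.2 + t * (q.2 - p.2)).

Lemma segmentE (p q : sp) : segment p q = [set lerp p q t | t in `[0, 1]].
Proof. by []. Qed.

Lemma segmentP (p q x : sp) : segment p q x <-> exists2 t, 0 <= t <= 1 & lerp p q t = x.
Proof.
rewrite segmentE; split=> [[t /=]|[t t01 <-]].
  by rewrite in_itv /= => t01 <-; exists t.
by exists t => //=; rewrite in_itv.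
Qed.

Lemma lerp0 (p q : sp) : lerp p q 0 = p.
Proof. by case: p => [[x y] z]; rewrite /lerp /= !mul0r !addr0. Qed.

Lemma segment_sub (p q : sp) : segment p q `<=` segment q p.
Proof.
move=> x /segmentP[t /andP[t0 t1] <-]; apply/segmentP; exists (1 - t).
  by rewrite subr_ge0 t1 lerBlDr lerDl.
by rewrite /lerp; congr (_, _, _); ring.
Qed.

Lemma segmentC (p q : sp) : segment p q = segment q p.
Proof. by apply/seteqP; split; exact: segment_sub. Qed.

Lemma ev_lerp a (p q : sp) t : ev a (lerp p q t) = (1 - t) * ev a p + t * ev a q.
Proof. by rewrite /ev /lerp /=; ring. Qed.

Lemma segment_split (p q : sp) t : 0 <= t <= 1 ->
  segment p q = segment p (lerp p q t) `|` segment (lerp p q t) q.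
Proof.
move=> /andP[t0 t1]; apply/seteqP; split=> x.
  move=> /segmentP[u /andP[u0 u1] <-].
  have [ut|tu] := leP u t.
    left; apply/segmentP; have [t00|t00] := eqVneq t 0.
      exists 0; first by rewrite lexx ler01.
      have -> : u = 0 by apply/eqP; rewrite eq_le u0 andbT -t00.
      by rewrite t00 !lerp0.
    exists (u / t).
      by rewrite divr_ge0//= ler_pdivrMr ?mul1r// lt0r t00.
    by rewrite /lerp /=; congr (_, _, _); field.
  right; apply/segmentP; have t1' : 0 < 1 - t by rewrite subr_gt0 (lt_le_trans tu).
  exists ((u - t) / (1 - t)).
    by rewrite ler_pdivrMr// mul1r lerB// andbT divr_ge0// ?subr_ge0 ltW// -subr_gt0.
  by rewrite /lerp /=; congr (_, _, _); field; rewrite gt_eqF.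
case=> /segmentP[u /andP[u0 u1] <-]; apply/segmentP.
  exists (u * t); first by rewrite mulr_ge0//= mulr_ile1.
  by rewrite /lerp /=; congr (_, _, _); ring.
exists (t + u * (1 - t)).
  by rewrite addr_ge0 ?mulr_ge0 ?subr_ge0//=; nra.
by rewrite /lerp /=; congr (_, _, _); ring.
Qed.

Lemma ap_segment m (p q : sp) : ap m @` segment p q = segment (ap m p) (ap m q).
Proof.
rewrite !segmentE image_comp; congr image; apply/funext => t /=.
by rewrite /ap /lerp /=; congr (_, _, _); ring.
Qed.

(* [g] is the functional that realises the minimum defining [weight_at] at [p]. *)
Definition active (s : seq (R * R * R * R)) g (p : sp) : Prop :=
  0 <= ev g p /\ (forall a, a \in one_aff :: s -> ev g p <= ev a p).

Lemma push_active s d g p : g \in one_aff :: s -> active s g p ->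
  push s d p = translate p d (ev g p).
Proof. by move=> gs [g0 gle]; rewrite /push (weight_at_eq gs). Qed.

Lemma active_lerp s g p q t : 0 <= t <= 1 -> active s g p -> active s g q ->
  active s g (lerp p q t).
Proof.
move=> /andP[t0 t1] [p0 pl] [q0 ql]; have t1' : 0 <= 1 - t by rewrite subr_ge0.
split; first by rewrite ev_lerp addr_ge0// mulr_ge0.
by move=> a sa; rewrite !ev_lerp lerD// ler_wpM2l// ?pl ?ql.
Qed.

(** Being the least functional is a convex condition, so [g] is least along the whole segment, on
    which the push is then affine. *)
Lemma push_segment s d g p q : g \in one_aff :: s -> active s g p -> active s g q ->
  push s d @` segment p q = segment (translate p d (ev g p)) (translate q d (ev g q)).
Proof.
move=> gs gp gq; rewrite !segmentE image_comp.
apply: eq_imagel => t /=; rewrite in_itv /= => t01.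
rewrite (push_active _ gs (active_lerp t01 gp gq)) ev_lerp.
by rewrite /translate /lerp /=; congr (_, _, _); ring.
Qed.

Lemma push_avoid s d (A : set sp) : (forall p, A p -> ~ support s p) -> push s d @` A = A.
Proof.
move=> sA; apply/seteqP; split=> [_ [p Ap <-]|p Ap].
  by rewrite push_out//; exact: sA.
by exists p => //; rewrite push_out//; exact: sA.
Qed.

(** In the second case the combination [ev k q * j - ev j q * k] has nonnegative coefficients, not
    both zero. It vanishes at [q] and is nonpositive at [p], so [j] and [k] cannot both be positive
    at a point of the segment. *)
Lemma segment_avoid s j k (p q : sp) : j \in s -> k \in s ->
  (ev j p <= 0) && (ev j q <= 0) ||
  [&& ev j q <= 0, 0 <= ev k q, (ev j q < 0) || (0 < ev k q)
    & ev k q * ev j p <= ev j q * ev k p] ->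
  forall x, segment p q x -> ~ support s x.
Proof.
move=> js ks H x /segmentP[t /andP[t0 t1] <-] spx.
have := spx _ js; have := spx _ ks; rewrite !ev_lerp.
move: (ev j p) (ev j q) (ev k p) (ev k q) H => a b c d H.
have u0 : 0 <= 1 - t by rewrite subr_ge0.
move: (1 - t) u0 => u u0 h1 h2.
case/orP: H => [/andP[a0 b0]|/and4P[b0 d0 bd dab]].
  by have := mulr_ge0_le0 u0 a0; have := mulr_ge0_le0 t0 b0; lra.
have e : d * (u * a + t * b) - b * (u * c + t * d) <= 0.
  have -> : d * (u * a + t * b) - b * (u * c + t * d) = u * (d * a - b * c) by ring.
  by rewrite mulr_ge0_le0// subr_le0.
case/orP: bd => [b1|d1].
  have : 0 < (- b) * (u * c + t * d) by rewrite mulr_gt0// oppr_gt0.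
  have : 0 <= d * (u * a + t * b) by rewrite mulr_ge0// ltW.
  lra.
have : 0 < d * (u * a + t * b) by rewrite mulr_gt0.
have : 0 <= (- b) * (u * c + t * d) by rewrite mulr_ge0 ?oppr_ge0// ltW.
lra.
Qed.

End Planar.

(** * A decision procedure for isotopies of rational diagrams *)

Definition qpt := (Q * Q * Q)%type.
Definition qaff := (Q * Q * Q * Q)%type.
Definition qmap := (Q * Q * Q * Q * Q * Q)%type.

Definition q0 : Q := qfrac 0 1.
Definition q1 : Q := qfrac 1 1.

Definition qev (a : qaff) (p : qpt) : Q :=
  qadd (qadd (qmul a.1.1.1 p.1.1) (qmul a.1.1.2 p.1.2)) (qadd (qmul a.1.2 p.2) a.2).

Definition qslope (a : qaff) (d : qpt) : Q :=
  qadd (qadd (qmul a.1.1.1 d.1.1) (qmul a.1.1.2 d.1.2)) (qmul a.1.2 d.2).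

Definition qtranslate (p d : qpt) (t : Q) : qpt :=
  (qadd p.1.1 (qmul t d.1.1), qadd p.1.2 (qmul t d.1.2), qadd p.2 (qmul t d.2)).

Definition qdiff (p q : qpt) : qpt := (qsub p.1.1 q.1.1, qsub p.1.2 q.1.2, qsub p.2 q.2).

Definition qlerp (p q : qpt) (t : Q) : qpt := qtranslate p (qdiff q p) t.

Definition qcross (p q : qpt) : qpt :=
  (qsub (qmul p.1.2 q.2) (qmul p.2 q.1.2), qsub (qmul p.2 q.1.1) (qmul p.1.1 q.2),
   qsub (qmul p.1.1 q.1.2) (qmul p.1.2 q.1.1)).

Definition qsubaff (a b : qaff) : qaff :=
  (qsub a.1.1.1 b.1.1.1, qsub a.1.1.2 b.1.1.2, qsub a.1.2 b.1.2, qsub a.2 b.2).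

Definition qscale (k : Q) (a : qaff) : qaff :=
  (qmul k a.1.1.1, qmul k a.1.1.2, qmul k a.1.2, qmul k a.2).

Definition qpull (a : qaff) (m : qmap) : qaff :=
  (qadd (qmul a.1.1.1 m.1.1.1.1.1) (qmul a.1.1.2 m.1.1.1.2),
   qadd (qmul a.1.1.1 m.1.1.1.1.2) (qmul a.1.1.2 m.1.1.2),
   a.1.2, qadd (qadd (qmul a.1.1.1 m.1.2) (qmul a.1.1.2 m.2)) a.2).

(* The minimum of the functional over [[-1, 1] x [-1, 1] x [0, 1]]. *)
Definition qlow (a : qaff) : Q :=
  qadd (qsub (qsub a.2 (qabs a.1.1.1)) (qabs a.1.1.2)) (qmin a.1.2 q0).

Definition qone : qaff := (q0, q0, q0, q1).

Definition pteq (p q : qpt) : bool := [&& qeq p.1.1 q.1.1, qeq p.1.2 q.1.2 & qeq p.2 q.2].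

Definition mapeq (m n : qmap) : bool :=
  [&& qeq m.1.1.1.1.1 n.1.1.1.1.1, qeq m.1.1.1.1.2 n.1.1.1.1.2, qeq m.1.1.1.2 n.1.1.1.2,
      qeq m.1.1.2 n.1.1.2, qeq m.1.2 n.1.2 & qeq m.2 n.2].

(* A planar diagram piece: a segment, or the tangle with the given index placed by
   a planar affine map. *)
Inductive piece := Seg of qpt & qpt | Box of nat & qmap.

(** [Oct p p' u u' w w' c c'] pushes along [c' - c] inside the octahedron whose pairs of opposite
    vertices are [p p'], [u u'] and [w w']. Its typical use is at a corner [c] with neighbours [p]
    and [p']: with [c'] their midpoint, the corner is flattened and a [Join] erases it; after a
    [Cut], it creates a corner. *)
Inductive move :=
  | Cut of qpt & qpt & Q
  | Join of qpt & qpt & Q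
  | Push of seq qaff & qpt
  | Oct of qpt & qpt & qpt & qpt & qpt & qpt & qpt & qpt.

(** The hypothesis of [segment_avoid], each pair holding the values of one functional at the two
    ends. *)
Definition seg_out2 (u v : Q * Q) : bool :=
  (qle u.1 q0 && qle u.2 q0) ||
  [&& qle u.2 q0, qle q0 v.2, qlt u.2 q0 || qlt q0 v.2 & qle (qmul v.2 u.1) (qmul u.2 v.1)].

Definition seg_out (s : seq qaff) (p q : qpt) : bool :=
  let vs := [seq (qev a p, qev a q) | a <- s] in has (fun u => has (seg_out2 u) vs) vs.

Definition seg_active (s : seq qaff) (p q : qpt) : option (Q * Q) :=
  let vs := [seq (qev a p, qev a q) | a <- qone :: s] in
  ohead [seq u <- vs | [&& qle q0 u.1, qle q0 u.2 &
    all (fun v => qle u.1 v.1 && qle u.2 v.2) vs]].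

Definition box_out (s : seq qaff) (m : qmap) : bool :=
  has (fun a => qle q0 (qlow (qscale (qopp q1) (qpull a m)))) s.

(** The least functional must be independent of the height: only then does the push act on the whole
    box by a planar affine map. *)
Definition box_active (s : seq qaff) (m : qmap) : option qaff :=
  ohead [seq g <- qone :: s | [&& qeq g.1.2 q0, qle q0 (qlow (qpull g m)) &
    all (fun a => qle q0 (qlow (qpull (qsubaff a g) m))) (qone :: s)]].

Definition move_map (g : qaff) (d : qpt) (m : qmap) : qmap :=
  let h := qpull g m in
  (qadd m.1.1.1.1.1 (qmul d.1.1 h.1.1.1), qadd m.1.1.1.1.2 (qmul d.1.1 h.1.1.2),
   qadd m.1.1.1.2 (qmul d.1.2 h.1.1.1), qadd m.1.1.2 (qmul d.1.2 h.1.1.2),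
   qadd m.1.2 (qmul d.1.1 h.2), qadd m.2 (qmul d.1.2 h.2)).

Definition push_piece (s : seq qaff) (d : qpt) (i : piece) : option piece :=
  match i with
  | Seg p q => if seg_out s p q then Some i else
      if seg_active s p q is Some u then
        Some (Seg (qtranslate p d u.1) (qtranslate q d u.2)) else None
  | Box k m => if box_out s m then Some i else
      if box_active s m is Some g then
        if qeq d.2 q0 then Some (Box k (move_map g d m)) else None
      else None
  end.

Fixpoint push_pieces (s : seq qaff) (d : qpt) (l : seq piece) : option (seq piece) :=
  match l with
  | [::] => Some [::]
  | i :: l => if push_piece s d i is Some j then
                omap (cons j) (push_pieces s d l) else None
  end.

(** Checks that [w = k a + r] with [k > 0] and a constant [r >= 0]; the only candidate for [k] is
    read off a nonzero coefficient of [a]. *)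
Definition implies_wall (a w : qaff) : bool :=
  let k := if qeq a.1.1.1 q0 then if qeq a.1.1.2 q0 then qmul w.1.2 (qinv a.1.2)
             else qmul w.1.1.2 (qinv a.1.1.2) else qmul w.1.1.1 (qinv a.1.1.1) in
  let r := qsubaff w (qscale k a) in
  [&& qlt q0 k, qeq r.1.1.1 q0, qeq r.1.1.2 q0, qeq r.1.2 q0 & qle q0 r.2].

Definition do_push (walls s : seq qaff) (d : qpt) (l : seq piece) : option (seq piece) :=
  if all (fun a => qlt (qopp q1) (qslope a d)) s &&
     all (fun w => has (implies_wall^~ w) s) walls
  then push_pieces s d l else None.

(* The plane through three points, as a functional equal to 1 at [c]. *)
Definition facet (c p q r : qpt) : qaff :=
  let n := qcross (qdiff q p) (qdiff r p) in
  let f := (n.1.1, n.1.2, n.2, qopp (qadd (qadd (qmul n.1.1 p.1.1) (qmul n.1.2 p.1.2)) (qmul n.2 p.2))) in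
  qscale (qinv (qev f c)) f.

(** Faces and walls are all normalised to be 1 at [c], so the weight at [c] is 1 and the push takes
    [c] exactly to [c']. *)
Definition octahedron (walls : seq qaff) (p p' u u' w w' c : qpt) : seq qaff :=
  [seq facet c x.1 x.2 z | x <- [:: (p, u); (p, u'); (p', u); (p', u')], z <- [:: w; w']]
  ++ [seq qscale (qinv (qev a c)) a | a <- walls].

Definition is_seg (p q : qpt) (i : piece) : bool :=
  if i is Seg a b then pteq a p && pteq b q || pteq a q && pteq b p else false.

Definition do_move (walls : seq qaff) (o : move) (l : seq piece) : option (seq piece) :=
  match o with
  | Cut p q t => if qle q0 t && qle t q1 then
      Some (flatten [seq if is_seg p q i then [:: Seg p (qlerp p q t); Seg (qlerp p q t) q]
                         else [:: i] | i <- l]) else None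
  | Join p q t => let m := qlerp p q t in
      if [&& qle q0 t, qle t q1, has (is_seg p m) l & has (is_seg m q) l] then
        Some (Seg p q :: [seq i <- l | ~~ is_seg p m i && ~~ is_seg m q i]) else None
  | Push s d => do_push walls s d l
  | Oct p p' u u' w w' c c' => do_push walls (octahedron walls p p' u u' w w' c) (qdiff c' c) l
  end.

Definition piece_eq (i j : piece) : bool :=
  match i with
  | Seg p q => is_seg p q j
  | Box k m => if j is Box k' m' then (k == k') && mapeq m m' else false
  end.

Fixpoint connects (walls : seq qaff) (os : seq move) (l l' : seq piece) : bool :=
  match os with
  | [::] => all (fun i => has (piece_eq i) l') l && all (fun i => has (piece_eq i) l) l'
  | o :: os => if do_move walls o l is Some l1 then connects walls os l1 l' else false
  end.

(** * Soundness of the procedure, for arbitrary contents of the boxes *)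

Section Soundness.
Context {R : realType}.
Local Notation sp := (space R).
Variable env : nat -> set sp.
Hypothesis env_slab : forall k, env k `<=` slab.

Definition pt2r (p : qpt) : sp := (q2r p.1.1, q2r p.1.2, q2r p.2).
Definition aff2r (a : qaff) : R * R * R * R :=
  (q2r a.1.1.1, q2r a.1.1.2, q2r a.1.2, q2r a.2).
Definition map2r (m : qmap) : R * R * R * R * R * R :=
  (q2r m.1.1.1.1.1, q2r m.1.1.1.1.2, q2r m.1.1.1.2, q2r m.1.1.2, q2r m.1.2, q2r m.2).

Definition draw1 (i : piece) : set sp :=
  match i with
  | Seg p q => segment (pt2r p) (pt2r q)
  | Box k m => ap (map2r m) @` env k
  end.

Fixpoint draw (l : seq piece) : set sp :=
  if l is i :: l then draw1 i `|` draw l else set0.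

Lemma drawP l x : draw l x <-> exists2 i, List.In i l & draw1 i x.
Proof.
elim: l => [|i l IH] /=; first by split=> // -[].
split=> [[ix|/IH[j jl jx]]|[j [<- //|jl] jx]].
- by exists i => //; left.
- by exists j => //; right.
- by left.
- by right; apply/IH; exists j.
Qed.

Lemma draw_cat l l' : draw (l ++ l') = draw l `|` draw l'.
Proof. by elim: l => [|i l IH] /=; rewrite ?set0U// IH setUA. Qed.

Lemma aff2r_ev a p : q2r (qev a p) = ev (aff2r a) (pt2r p).
Proof. by rewrite /qev !q2rD !q2rM /ev /=; ring. Qed.

Lemma aff2r_slope a d : q2r (qslope a d) = slope (aff2r a) (pt2r d).
Proof. by rewrite /qslope !q2rD !q2rM. Qed.

Lemma pt2r_translate p d t : pt2r (qtranslate p d t) = translate (pt2r p) (pt2r d) (q2r t).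
Proof. by rewrite /pt2r /qtranslate /= !q2rD !q2rM. Qed.

Lemma pt2r_lerp p q t : pt2r (qlerp p q t) = lerp (pt2r p) (pt2r q) (q2r t).
Proof. by rewrite /qlerp pt2r_translate /pt2r /translate /lerp /= !q2rB. Qed.

Lemma aff2r_one : aff2r qone = one_aff.
Proof. by rewrite /aff2r /= /q0 /q1 q2r0 q2r1. Qed.

Lemma pteqP p q : pteq p q -> pt2r p = pt2r q.
Proof. by case/and3P => /(@q2r_eq R) e1 /(@q2r_eq R) e2 /(@q2r_eq R) e3; rewrite /pt2r e1 e2 e3. Qed.

Lemma is_segP p q i : is_seg p q i -> draw1 i = segment (pt2r p) (pt2r q).
Proof.
case: i => //= a b /orP[] /andP[/pteqP -> /pteqP ->] //.
exact: segmentC.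
Qed.

Lemma piece_eqP i j : piece_eq i j -> draw1 i = draw1 j.
Proof.
case: i => [p q /is_segP -> //|k m] /=; case: j => // k' m' /andP[/eqP ->].
do 5![case/andP => /(@q2r_eq R) ?]; move=> /(@q2r_eq R) ?.
by rewrite /= /map2r; congr (image _ (ap (_, _, _, _, _, _))).
Qed.

Lemma qpullP a m p : ev (aff2r (qpull a m)) p = ev (aff2r a) (ap (map2r m) p).
Proof. by rewrite /ev /= !q2rD !q2rM /=; ring. Qed.

Lemma qlowP a p : slab p -> qle q0 (qlow a) -> 0 <= ev (aff2r a) p.
Proof.
move=> [x01 y01 z01] /(@q2r_le R); rewrite /q0 q2r0 /qlow q2rD !q2rB.
have [h1 h2] := @q2r_min R a.1.2 q0; move: h2; rewrite /q0 q2r0.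
have := @q2r_abs R a.1.1.1; have := @q2r_abs R a.1.1.2; rewrite !ler_norml /ev /=.
move: (q2r (qmin _ _)) h1 (q2r (qabs a.1.1.1)) (q2r (qabs a.1.1.2)) => m h1 u v.
move: (q2r a.1.1.1) (q2r a.1.1.2) (q2r a.1.2) (q2r a.2) h1 => A B C D h1.
case: p x01 y01 z01 => [[x y] z] /= /andP[? ?] /andP[? ?] /andP[? ?] /andP[? ?] /andP[? ?] ? ?.
have hx : 0 <= A * x + u by nra.
have hy : 0 <= B * y + v by nra.
have hz : m <= C * z by nra.
lra.
Qed.

Lemma hasIn (T : Type) (f : pred T) (s : seq T) : has f s -> exists2 x, List.In x s & f x.
Proof.
elim: s => //= x s IH /orP[fx|/IH[y ys fy]]; first by exists x => //; left.
by exists y => //; right.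
Qed.

Lemma allIn (T : Type) (f : pred T) (s : seq T) x : all f s -> List.In x s -> f x.
Proof. by elim: s => //= y s IH /andP[fy fs] [<- //|]; exact: IH. Qed.

Lemma mapIn (T U : Type) (f : T -> U) (s : seq T) y :
  List.In y (map f s) -> exists2 x, List.In x s & y = f x.
Proof.
elim: s => //= x s IH [<-|/IH[z zs ->]]; first by exists x => //; left.
by exists z => //; right.
Qed.

Lemma In_map_mem s a : List.In a s -> aff2r a \in map aff2r s.
Proof. by elim: s => //= b s IH [->|/IH]; rewrite inE ?eqxx// => ->; rewrite orbT. Qed.

Lemma mem_map_In s b : b \in map aff2r s -> exists2 a, List.In a s & b = aff2r a.
Proof.
elim: s => //= c s IH; rewrite inE => /orP[/eqP->|/IH[a sa ->]]; first by exists c => //; left.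
by exists a => //; right.
Qed.

Lemma ohead_filterP (T : Type) (f : pred T) (s : seq T) x :
  ohead [seq y <- s | f y] = Some x -> List.In x s /\ f x.
Proof.
elim: s => //= y s IH; case: ifPn => [fy [<-]|_ /IH[? ?]]; first by split => //; left.
by split => //; right.
Qed.

Lemma seg_outP s p q : seg_out s p q ->
  forall x, segment (pt2r p) (pt2r q) x -> ~ support (map aff2r s) x.
Proof.
rewrite /seg_out; set vs := map _ _ => H.
have [u us /hasIn[v vs' {}H]] := hasIn H.
have [j js ju] := mapIn us; have [k ks kv] := mapIn vs'; subst u v.
apply: (segment_avoid (In_map_mem js) (In_map_mem ks)); rewrite -!aff2r_ev.
move: H; rewrite /seg_out2 /= => /orP[/andP[/(@q2r_le R) h1 /(@q2r_le R) h2]|/and4P[/(@q2r_le R) h1 /(@q2r_le R) h2 h3 /(@q2r_le R) h4]].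
  by move: h1 h2; rewrite /q0 q2r0 => -> ->.
move: h1 h2 h4 h3; rewrite !q2rM /q0 q2r0 => -> -> -> h3; rewrite /= andbT orbC.
by case/orP: h3 => /(@q2r_lt R); rewrite q2r0 => ->; rewrite ?orbT.
Qed.

Lemma active_of s g p :
  0 <= q2r (qev g p) :> R ->
  (forall a, List.In a (qone :: s) -> q2r (qev g p) <= q2r (qev a p) :> R) ->
  active (map aff2r s) (aff2r g) (pt2r p).
Proof.
move=> g0 gle; split => [|b]; first by rewrite -aff2r_ev.
rewrite -aff2r_one -map_cons.
by move=> /mem_map_In[a sa ->]; rewrite -!aff2r_ev; exact: gle.
Qed.

Lemma seg_activeP s p q u d : seg_active s p q = Some u ->
  push (map aff2r s) (pt2r d) @` segment (pt2r p) (pt2r q) =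
  segment (pt2r (qtranslate p d u.1)) (pt2r (qtranslate q d u.2)).
Proof.
rewrite /seg_active; set vs := map _ _ => H.
have [us /and3P[/(@q2r_le R) h1 /(@q2r_le R) h2 h3]] := ohead_filterP H.
have [g gs ug] := mapIn us; subst u.
rewrite !pt2r_translate !aff2r_ev; apply: push_segment.
- by rewrite -aff2r_one -map_cons; exact: In_map_mem.
- apply: active_of; first by rewrite -(@q2r0 R).
  move=> a sa; have /andP[/(@q2r_le R)]// := allIn h3 (List.in_map (fun a => (qev a p, qev a q)) _ _ sa).
- apply: active_of; first by rewrite -(@q2r0 R).
  move=> a sa; have /andP[_ /(@q2r_le R)]// := allIn h3 (List.in_map (fun a => (qev a p, qev a q)) _ _ sa).
Qed.

Lemma box_outP s k m : box_out s m ->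
  forall x, (ap (map2r m) @` env k) x -> ~ support (map aff2r s) x.
Proof.
rewrite /box_out => /hasIn[a sa h] x [p /env_slab /qlowP/(_ h) + <-] /(_ _ (In_map_mem sa)).
have -> : ev (aff2r (qscale (qopp q1) (qpull a m))) p = - ev (aff2r (qpull a m)) p.
  by rewrite /ev /= !q2rM !q2rN /q1 q2r1; ring.
by rewrite qpullP oppr_ge0 leNgt => /negP.
Qed.

Lemma box_activeP s k m g d : box_active s m = Some g -> qeq d.2 q0 ->
  push (map aff2r s) (pt2r d) @` (ap (map2r m) @` env k) =
  ap (map2r (move_map g d m)) @` env k.
Proof.
move=> H /(@q2r_eq R) d3.
have [gs /and3P[/(@q2r_eq R) g3 h1 h2]] := ohead_filterP H.
rewrite image_comp; apply: eq_imagel => p /env_slab pslab /=.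
have gs' : aff2r g \in one_aff :: map aff2r s.
  by rewrite -aff2r_one -map_cons; exact: In_map_mem.
rewrite (push_active _ gs'); last first.
  split; first by rewrite -qpullP; exact: qlowP.
  move=> b; rewrite -aff2r_one -map_cons => /mem_map_In[a sa ->].
  have /qlowP-/(_ _ pslab) := allIn h2 sa; rewrite qpullP.
  have -> x : ev (aff2r (qsubaff a g)) x = ev (aff2r a) x - ev (aff2r g) x.
    by rewrite /ev /= !q2rB; ring.
  by rewrite subr_ge0.
move: g3 d3; rewrite -qpullP /q0 q2r0 => g3 d3.
rewrite /translate /ap /move_map /= !q2rD !q2rM /ev /= !q2rD !q2rM /= g3 d3.
by congr (_, _, _); ring.
Qed.

Lemma push_pieceP s d i j : push_piece s d i = Some j ->
  push (map aff2r s) (pt2r d) @` draw1 i = draw1 j.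
Proof.
case: i => [p q|k m] /=.
  case: ifPn => [out [<-]|_].
    exact: push_avoid (seg_outP out).
  by case E : seg_active => [u|//] [<-]; exact: seg_activeP.
case: ifPn => [out [<-]|_].
  exact: push_avoid (box_outP out).
case E : box_active => [u|//]; case: ifPn => // d3 [<-].
exact: box_activeP.
Qed.

Lemma push_piecesP s d l l' : push_pieces s d l = Some l' ->
  push (map aff2r s) (pt2r d) @` draw l = draw l'.
Proof.
elim: l l' => [|i l IH] l' /=; first by case=> <-; rewrite image_set0.
case E : push_piece => [j|//]; case F : push_pieces => [l1|//] [<-].
by rewrite image_setU (push_pieceP E) (IH _ F).
Qed.

Lemma implies_wallP a w p : implies_wall a w -> 0 < ev (aff2r a) p -> 0 < ev (aff2r w) p.
Proof.
rewrite /implies_wall; set k := if _ then _ else _; move: k => k.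
move=> /and5P[/(@q2r_lt R) + /(@q2r_eq R) + /(@q2r_eq R) + /(@q2r_eq R) + /(@q2r_le R)].
rewrite /= !q2rB !q2rM /q0 q2r0 /ev /= => k0 /eqP e1 /eqP e2 /eqP e3 e4 a0.
move: e1 e2 e3; rewrite !subr_eq0 => /eqP -> /eqP -> /eqP ->.
have := mulr_gt0 k0 a0; lra.
Qed.

Lemma do_pushP walls s d l l' : do_push walls s d l = Some l' ->
  move_in (support (map aff2r walls)) (draw l) (draw l').
Proof.
rewrite /do_push; case: ifP => // /andP[sl sw] /push_piecesP H.
exists (push (map aff2r s) (pt2r d)) => //.
have [? ? ? out] : supported_homeo (support (map aff2r s)) (push (map aff2r s) (pt2r d)).
  apply: push_supported => b /mem_map_In[a sa ->].
  have /(@q2r_lt R) := allIn sl sa; rewrite q2rN /q1 q2r1 aff2r_slope.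
  by rewrite -subr_gt0 opprK addrC.
split=> // p wp; apply: out => sp'; apply: wp => b /mem_map_In[w ww ->].
have /hasIn[a sa /implies_wallP] := allIn sw ww; apply.
exact/sp'/In_map_mem.
Qed.

Lemma do_moveP walls o l l' : do_move walls o l = Some l' ->
  move_in (support (map aff2r walls)) (draw l) (draw l').
Proof.
case: o => [p q t|p q t|s d|p p' u u' w w' c c'] /=; first 1 last.
- case: ifPn => // /and4P[/(@q2r_le R) t0 /(@q2r_le R) t1 /hasIn[i il ip] /hasIn[j jl jq]] [<-] /=.
  have t01 : 0 <= (q2r t : R) <= 1 by rewrite -(@q2r0 R) t0 -(@q2r1 R) t1.
  suff -> : draw l = segment (pt2r p) (pt2r q) `|`
      draw [seq i <- l | ~~ is_seg p (qlerp p q t) i && ~~ is_seg (qlerp p q t) q i].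
    exact: move_in_refl.
  rewrite (segment_split _ _ t01) -pt2r_lerp -(is_segP ip) -(is_segP jq).
  apply/seteqP; split=> x.
    move=> /drawP[k kl kx].
    have [/is_segP e|np] := boolP (is_seg p (qlerp p q t) k).
      by left; left; rewrite (is_segP ip) -e.
    have [/is_segP e|nq] := boolP (is_seg (qlerp p q t) q k).
      by left; right; rewrite (is_segP jq) -e.
    right; apply/drawP; exists k => //; apply/List.filter_In; split=> //.
    by rewrite np nq.
  case=> [[ix|jx]|/drawP[k /List.filter_In[kl _] kx]]; apply/drawP.
  - by exists i.
  - by exists j.
  - by exists k.
- exact: do_pushP.
- exact: do_pushP.
case: ifPn => // /andP[/(@q2r_le R) t0 /(@q2r_le R) t1] [<-].
have t01 : 0 <= (q2r t : R) <= 1 by rewrite -(@q2r0 R) t0 -(@q2r1 R) t1.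
suff -> : draw (flatten [seq if is_seg p q i then
    [:: Seg p (qlerp p q t); Seg (qlerp p q t) q] else [:: i] | i <- l]) = draw l.
  exact: move_in_refl.
elim: l => [//|i l IH]; rewrite map_cons -cat1s flatten_cat draw_cat IH.
rewrite /= cats0; congr setU; case: ifPn => [/is_segP ->|_] /=; last by rewrite setU0.
by rewrite setU0 pt2r_lerp -segment_split.
Qed.

Theorem connectsP walls os l l' : connects walls os l l' ->
  move_in (support (map aff2r walls)) (draw l) (draw l').
Proof.
elim: os l => [|o os IH] l /=.
  move=> /andP[h1 h2].
  suff -> : draw l = draw l' by exact: move_in_refl.
  apply/seteqP; split=> x /drawP[i il ix]; apply/drawP.
    by have /hasIn[j jl /piece_eqP e] := allIn h1 il; exists j; rewrite -?e.
  by have /hasIn[j jl /piece_eqP e] := allIn h2 il; exists j; rewrite -?e.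
case E : do_move => [l1|//] /IH; exact/move_in_trans/(do_moveP E).
Qed.

End Soundness.

(** * Tangle expressions and their diagrams *)

Inductive texp := Var of nat | Cross of bool | Arcs | Sum of texp & texp | Rho of texp.

Definition qap (m : qmap) (p : qpt) : qpt :=
  (qadd (qadd (qmul m.1.1.1.1.1 p.1.1) (qmul m.1.1.1.1.2 p.1.2)) m.1.2,
   qadd (qadd (qmul m.1.1.1.2 p.1.1) (qmul m.1.1.2 p.1.2)) m.2, p.2).

Definition qcomp (m n : qmap) : qmap :=
  (qadd (qmul m.1.1.1.1.1 n.1.1.1.1.1) (qmul m.1.1.1.1.2 n.1.1.1.2),
   qadd (qmul m.1.1.1.1.1 n.1.1.1.1.2) (qmul m.1.1.1.1.2 n.1.1.2),
   qadd (qmul m.1.1.1.2 n.1.1.1.1.1) (qmul m.1.1.2 n.1.1.1.2),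
   qadd (qmul m.1.1.1.2 n.1.1.1.1.2) (qmul m.1.1.2 n.1.1.2),
   qadd (qadd (qmul m.1.1.1.1.1 n.1.2) (qmul m.1.1.1.1.2 n.2)) m.1.2,
   qadd (qadd (qmul m.1.1.1.2 n.1.2) (qmul m.1.1.2 n.2)) m.2).

Definition qid : qmap := (1, 0, 0, 1, 0, 0)%qfrac.
Definition qleft : qmap := (1#4, 0, 0, 1#2, -1#4, 0)%qfrac.
Definition qright : qmap := (1#4, 0, 0, 1#2, 1#4, 0)%qfrac.
Definition qswap : qmap := (0, 1, 1, 0, 0, 0)%qfrac.

Definition qcross_segs (b : bool) : seq (qpt * qpt) :=
  let u := if b then q1 else q0 in let v := if b then q0 else q1 in
  [:: ((-1#1, -1#1, 0), (0, 0, u)); ((0, 0, u), (1, 1, 0));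
      ((-1#1, 1, 0), (0, 0, v)); ((0, 0, v), (1, -1#1, 0))]%qfrac.

Definition qarcs_segs : seq (qpt * qpt) :=
  [:: ((-1#1, 1, 0), (0, 1#2, 0)); ((0, 1#2, 0), (1, 1, 0));
      ((-1#1, -1#1, 0), (0, -1#2, 0)); ((0, -1#2, 0), (1, -1#1, 0))]%qfrac.

Definition qsum_segs : seq (qpt * qpt) :=
  [:: ((-1#1, 1, 0), (-1#2, 1#2, 0)); ((1, 1, 0), (1#2, 1#2, 0));
      ((-1#1, -1#1, 0), (-1#2, -1#2, 0)); ((1, -1#1, 0), (1#2, -1#2, 0))]%qfrac.

Definition qclosure_segs : seq (qpt * qpt) :=
  [:: ((-1#1, 1, 0), (0, 2#1, 0)); ((0, 2#1, 0), (1, 1, 0));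
      ((-1#1, -1#1, 0), (0, -2#1, 0)); ((0, -2#1, 0), (1, -1#1, 0))]%qfrac.

Definition place (m : qmap) (l : seq (qpt * qpt)) : seq piece :=
  [seq Seg (qap m s.1) (qap m s.2) | s <- l].

(** Placements are composed down to the atoms, since the checker handles only a flat list of
    segments and boxes. *)
Fixpoint flat (m : qmap) (e : texp) : seq piece :=
  match e with
  | Var k => [:: Box k m]
  | Cross b => place m (qcross_segs b)
  | Arcs => place m qarcs_segs
  | Sum e1 e2 => flat (qcomp m qleft) e1 ++ flat (qcomp m qright) e2 ++ place m qsum_segs
  | Rho e => flat (qcomp m qswap) e
  end.

Section Interpretation.
Context {R : realType}.
Local Notation sp := (space R).
Variable env : nat -> set sp.

Fixpoint interp (e : texp) : set sp :=
  match e with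
  | Var k => env k
  | Cross b => crossing b
  | Arcs => horizontal_arcs
  | Sum e1 e2 => hsum (interp e1) (interp e2)
  | Rho e => rho (interp e)
  end.

Lemma qap_ap m p : pt2r (qap m p) = ap (map2r m) (pt2r p) :> sp.
Proof. by rewrite /ap /pt2r /= !q2rD !q2rM. Qed.

Lemma ap_qcomp m n (p : sp) : ap (map2r (qcomp m n)) p = ap (map2r m) (ap (map2r n) p).
Proof. by rewrite /ap /= !q2rD !q2rM; congr (_, _, _); ring. Qed.

Definition draw_segs (l : seq (qpt * qpt)) : set sp :=
  foldr (fun s X => segment (pt2r s.1) (pt2r s.2) `|` X) set0 l.

Lemma draw_place m l : draw env (place m l) = ap (map2r m) @` draw_segs l.
Proof.
elim: l => [|s l IH] /=; first by rewrite image_set0.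
by rewrite image_setU IH ap_segment !qap_ap.
Qed.

Lemma draw_flat m e : draw env (flat m e) = ap (map2r m) @` interp e.
Proof.
elim: e m => [k|b||e1 IH1 e2 IH2|e IH] m.
- by rewrite /= setU0.
- rewrite -[LHS]/(draw env (place m (qcross_segs b))) draw_place; congr image.
  case: b; rewrite /interp /crossing /= setU0 !setUA /pt2r /q2r /=;
    by congr (segment _ _ `|` segment _ _ `|` segment _ _ `|` segment _ _);
       congr (_, _, _); lra.
- rewrite -[LHS]/(draw env (place m qarcs_segs)) draw_place; congr image; rewrite /interp /horizontal_arcs /planar_segment /at_height /= setU0 !setUA /pt2r /q2r /=;
    by congr (segment _ _ `|` segment _ _ `|` segment _ _ `|` segment _ _);
       congr (_, _, _); lra.
- rewrite -[LHS]/(draw env (flat (qcomp m qleft) e1 ++ flat (qcomp m qright) e2 ++ place m qsum_segs)).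
  rewrite !draw_cat IH1 IH2 draw_place /= /hsum !image_setU image_set0 setU0 !setUA.
  have e1E (q : sp) : ap (map2r (qcomp m qleft)) q = ap (map2r m) ((q.1.1 - 1) / 4, q.1.2 / 2, q.2).
    by rewrite ap_qcomp; congr ap; rewrite /ap /map2r /q2r /=; congr (_, _, _); field.
  have e2E (q : sp) : ap (map2r (qcomp m qright)) q = ap (map2r m) ((q.1.1 + 1) / 4, q.1.2 / 2, q.2).
    by rewrite ap_qcomp; congr ap; rewrite /ap /map2r /q2r /=; congr (_, _, _); field.
  have i1 (X : set sp) : ap (map2r (qcomp m qleft)) @` X =
      ap (map2r m) @` [set ((q.1.1 - 1) / 4, q.1.2 / 2, q.2) | q in X].
    by rewrite image_comp; apply: eq_imagel => q _; exact: e1E.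
  have i2 (X : set sp) : ap (map2r (qcomp m qright)) @` X =
      ap (map2r m) @` [set ((q.1.1 + 1) / 4, q.1.2 / 2, q.2) | q in X].
    by rewrite image_comp; apply: eq_imagel => q _; exact: e2E.
  rewrite i1 i2 /planar_segment /at_height.
  congr (_ `|` _ `|` (ap _ @` _) `|` (ap _ @` _) `|` (ap _ @` _) `|` (ap _ @` _));
    congr segment; rewrite /pt2r /q2r /=; congr (_, _, _); lra.
- rewrite -[LHS]/(draw env (flat (qcomp m qswap) e)) IH /= /rho image_comp; congr image; apply/funext => q /=.
  by rewrite ap_qcomp; congr ap; rewrite /ap /map2r /q2r /=; congr (_, _, _); field.
Qed.

End Interpretation.

(** * Explicit lists of moves between diagrams of fixed size *)

Definition twist_moves : seq move :=
  ([:: Join (-3#8,-1#4,0) (-1#8,0,0) (1#2);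
   Join (-1#8,0,0) (-3#8,1#4,0) (1#2);
   Join (0,-1#2,0) (1#2,1#2,0) (1#2);
   Oct (-3#8,-1#4,0) (-1#1,-1#1,0) (-61#128,-31#64,0) (-91#128,-41#64,0) (-19#32,-9#16,1#8) (-19#32,-9#16,-1#8) (-1#2,-1#2,0) (-11#16,-5#8,0);
   Join (-3#8,-1#4,0) (-1#1,-1#1,0) (1#2);
   Oct (-3#8,1#4,0) (-1#1,1,0) (-61#128,31#64,0) (-91#128,41#64,0) (-19#32,9#16,-1#8) (-19#32,9#16,1#8) (-1#2,1#2,0) (-11#16,5#8,0);
   Join (-3#8,1#4,0) (-1#1,1,0) (1#2);
   Oct (-1#8,0,0) (-1#1,-1#1,0) (-45#128,-7#32,0) (-75#128,-17#32,0) (-15#32,-3#8,-1#8) (-15#32,-3#8,1#8) (-3#8,-1#4,0) (-9#16,-1#2,0);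
   Join (-1#8,0,0) (-1#1,-1#1,0) (1#2);
   Oct (-1#4,-1#8,1) (-1#4,1#8,1) (-25#64,0,-1#8) (-15#64,0,9#8) (-7#16,0,33#64) (-3#16,0,31#64) (-3#8,0,0) (-1#4,0,1);
   Join (-1#4,-1#8,1) (-1#4,1#8,1) (1#2);
   Oct (-1#8,0,0) (-1#1,1,0) (-45#128,7#32,0) (-75#128,17#32,0) (-15#32,3#8,1#8) (-15#32,3#8,-1#8) (-3#8,1#4,0) (-9#16,1#2,0);
   Join (-1#8,0,0) (-1#1,1,0) (1#2);
   Oct (-1#8,-1#4,0) (-1#4,1#8,1) (-33#128,-17#128,17#16) (-23#128,-7#128,7#16) (-3#32,-3#32,49#64) (-11#32,-3#32,47#64) (-1#4,-1#8,1) (-3#16,-1#16,1#2);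
   Join (-1#8,-1#4,0) (-1#4,1#8,1) (1#2);
   Oct (0,-1#2,0) (-1#4,1#8,1) (-1#8,-33#128,-1#16) (-1#8,-23#128,9#16) (-1#4,-9#32,33#128) (0,-5#32,31#128) (-1#8,-1#4,0) (-1#8,-3#16,1#2);
   Join (0,-1#2,0) (-1#4,1#8,1) (1#2);
   Oct (-1#8,1#4,0) (0,-1#2,0) (-35#128,5#32,9#8) (-5#128,-5#32,-1#8) (-9#32,-1#48,185#384) (-1#32,1#48,199#384) (-1#4,1#8,1) (-1#16,-1#8,0);
   Join (-1#8,1#4,0) (0,-1#2,0) (1#2);
   Oct (0,1#2,0) (0,-1#2,0) (-9#64,9#32,0) (1#64,-1#32,0) (-1#16,1#8,-1#8) (-1#16,1#8,1#8) (-1#8,1#4,0) (0,0,0);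
   Join (0,1#2,0) (0,-1#2,0) (1#2);
   Oct (1#2,1#2,0) (0,1#2,0) (-1#32,-5#8,0) (9#32,5#8,0) (1#8,0,1#8) (1#8,0,-1#8) (0,-1#2,0) (1#4,1#2,0);
   Join (1#2,1#2,0) (0,1#2,0) (1#2);
   Oct (1#4,0,1) (1#2,1#2,0) (-3#64,17#32,-1#16) (27#64,7#32,9#16) (3#16,1#2,5#16) (3#16,1#4,3#16) (0,1#2,0) (3#8,1#4,1#2);
   Join (1#4,0,1) (1#2,1#2,0) (1#2);
   Oct (1#2,-1#2,0) (1#2,1#2,0) (7#32,0,9#8) (17#32,0,-1#8) (1#2,0,17#32) (1#4,0,15#32) (1#4,0,1) (1#2,0,0);
   Join (1#2,-1#2,0) (1#2,1#2,0) (1#2);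
   Oct (1,-1#1,0) (1#2,1#2,0) (15#32,-17#32,0) (25#32,-7#32,0) (5#8,-3#8,1#8) (5#8,-3#8,-1#8) (1#2,-1#2,0) (3#4,-1#4,0);
   Join (1,-1#1,0) (1#2,1#2,0) (1#2);
   Push [:: (8#7,0,44#7,8#7); (8#7,0,-44#7,8#7); (-64#7,9#1,152#7,-1#7); (-64#7,9#1,-152#7,-1#7); (-64#7,-9#1,152#7,-1#7); (-64#7,-9#1,-152#7,-1#7); (8#7,0,0,8#7); (-8#9,0,0,8#9); (0,1,0,1); (0,-1#1,0,1)] (-3#8,0,0);
   Push [:: (-2#1,0,8#1,2#1); (-2#1,0,-8#1,2#1); (7#1,-9#1,26#1,2#1); (7#1,-9#1,-26#1,2#1); (32#11,18#11,52#11,-14#11); (32#11,18#11,-52#11,-14#11); (16#1,0,8#1,-7#1); (16#1,0,-8#1,-7#1); (2#3,0,0,2#3); (-2#1,0,0,2#1); (0,2#3,0,2#3); (0,-2#1,0,2#1)] (0,-1#2,0)])%qfrac.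

Definition unwind_moves : seq move :=
  ([:: Join (-17#64,-1#8,0) (-19#64,-3#32,0) (1#2);
   Join (-1#4,-3#16,0) (-3#16,-1#16,0) (1#2);
   Join (-1#8,0,0) (-3#8,1#4,0) (1#2);
   Oct (-1#2,-1#2,0) (0,-2#1,0) (-35#32,-31#32,0) (-5#32,-41#32,0) (-5#8,-9#8,-1#8) (-5#8,-9#8,1#8) (-1#1,-1#1,0) (-1#4,-5#4,0);
   Join (-1#2,-1#2,0) (0,-2#1,0) (1#2);
   Oct (-1#2,1#2,0) (0,2#1,0) (-35#32,31#32,0) (-5#32,41#32,0) (-5#8,9#8,1#8) (-5#8,9#8,-1#8) (-1#1,1,0) (-1#4,5#4,0);
   Join (-1#2,1#2,0) (0,2#1,0) (1#2);
   Oct (-3#8,-1#4,0) (0,-2#1,0) (-69#128,-27#64,0) (-19#128,-77#64,0) (-11#32,-13#16,-1#8) (-11#32,-13#16,1#8) (-1#2,-1#2,0) (-3#16,-9#8,0);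
   Join (-3#8,-1#4,0) (0,-2#1,0) (1#2);
   Oct (-3#8,1#4,0) (0,2#1,0) (-69#128,27#64,0) (-19#128,77#64,0) (-11#32,13#16,1#8) (-11#32,13#16,-1#8) (-1#2,1#2,0) (-3#16,9#8,0);
   Join (-3#8,1#4,0) (0,2#1,0) (1#2);
   Oct (-5#16,-3#16,0) (0,-2#1,0) (-103#256,-37#256,0) (-33#256,-307#256,0) (-17#64,-43#64,-1#8) (-17#64,-43#64,1#8) (-3#8,-1#4,0) (-5#32,-35#32,0);
   Join (-5#16,-3#16,0) (0,-2#1,0) (1#2);
   Oct (-5#16,-1#16,0) (-1#4,1#8,1) (-99#256,-1#256,-1#16) (-69#256,9#256,9#16) (-29#64,-7#64,9#32) (-13#64,9#64,7#32) (-3#8,0,0) (-9#32,1#32,1#2);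
   Join (-5#16,-1#16,0) (-1#4,1#8,1) (1#2);
   Oct (-19#64,-5#32,0) (0,-2#1,0) (-341#1024,-39#512,0) (-131#1024,-609#512,0) (-59#256,-81#128,-1#8) (-59#256,-81#128,1#8) (-5#16,-3#16,0) (-19#128,-69#64,0);
   Join (-19#64,-5#32,0) (0,-2#1,0) (1#2);
   Oct (-19#64,-3#32,0) (-1#4,1#8,1) (-325#1024,-37#512,-1#16) (-275#1024,13#512,9#16) (-107#256,-11#128,69#256) (-43#256,5#128,59#256) (-5#16,-1#16,0) (-35#128,1#64,1#2);
   Join (-19#64,-3#32,0) (-1#4,1#8,1) (1#2);
   Oct (-9#32,-7#64,1) (-1#4,-1#16,0) (-17#64,-97#1024,-1#16) (-17#64,-87#1024,9#16) (-9#32,-21#256,2047#8192) (-1#4,-25#256,2049#8192) (-17#64,-3#32,0) (-17#64,-11#128,1#2);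
   Join (-9#32,-7#64,1) (-1#4,-1#16,0) (1#2);
   Oct (-17#64,-1#8,0) (-1#4,1#8,1) (-309#1024,-27#256,-1#16) (-259#1024,3#256,9#16) (-75#256,-1#16,1041#4096) (-67#256,-1#32,1007#4096) (-19#64,-3#32,0) (-33#128,0,1#2);
   Join (-17#64,-1#8,0) (-1#4,1#8,1) (1#2);
   Oct (-17#64,-5#32,0) (-3#16,-1#16,0) (-259#1024,-101#512,0) (-229#1024,-51#512,0) (-61#256,-19#128,-1#8) (-61#256,-19#128,1#8) (-1#4,-3#16,0) (-29#128,-7#64,0);
   Join (-17#64,-5#32,0) (-3#16,-1#16,0) (1#2);
   Oct (-7#32,-1#8,1) (-9#32,-7#64,1) (-1#4,-57#1024,-1#8) (-1#4,-127#1024,9#8) (-65#256,-27#256,4089#8192) (-63#256,-19#256,4103#8192) (-1#4,-1#16,0) (-1#4,-15#128,1);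
   Join (-7#32,-1#8,1) (-9#32,-7#64,1) (1#2);
   Push [:: (-1927392#5819,-1378496#5819,31744#5819,-619854#5819); (-3160736#17457,6350272#17457,-478208#17457,199346#5819); (48416#14283,-517312#14283,48128#14283,-29306#4761); (3154016#157113,4795328#157113,-44032#157113,496834#52371); (-350496#5819,-1774400#5819,1024#5819,-293676#5819); (1569952#17457,5162560#17457,-570368#17457,525524#5819); (352736#52371,-1940800#52371,173056#52371,-286124#52371); (3679648#157113,4663360#157113,-54272#157113,177692#17457); (9370304#436161,1499782877312#64342034559,98523136#7149114951,553305846325#64342034559)] (-1#64,-3#128,-1#2);
   Join (-3#16,-3#16,0) (-9#32,-7#64,1) (1#2);
   Oct (-1#8,-1#4,0) (-9#32,-7#64,1) (-95#512,-193#1024,-1#16) (-105#512,-183#1024,9#16) (-101#512,-95#512,8191#32768) (-99#512,-93#512,8193#32768) (-3#16,-3#16,0) (-13#64,-23#128,1#2);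
   Join (-1#8,-1#4,0) (-9#32,-7#64,1) (1#2);
   Oct (-1#8,0,0) (-17#64,-5#32,0) (-191#1024,-31#512,0) (-201#1024,-41#512,0) (-49#256,-9#128,-1#8) (-49#256,-9#128,1#8) (-3#16,-1#16,0) (-25#128,-5#64,0);
   Join (-1#8,0,0) (-17#64,-5#32,0) (1#2);
   Oct (-1#4,1#8,1) (0,1#2,0) (-1#8,31#128,-1#16) (-1#8,41#128,9#16) (-1#4,11#32,31#128) (0,7#32,33#128) (-1#8,1#4,0) (-1#8,5#16,1#2);
   Join (-1#4,1#8,1) (0,1#2,0) (1#2);
   Oct (-1#8,0,0) (0,2#1,0) (-53#128,5#32,0) (-3#128,35#32,0) (-7#32,5#8,1#8) (-7#32,5#8,-1#8) (-3#8,1#4,0) (-1#16,1,0);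
   Join (-1#8,0,0) (0,2#1,0) (1#2);
   Oct (-17#64,-5#32,0) (0,2#1,0) (-127#1024,-59#512,0) (-137#1024,531#512,0) (-33#256,59#128,-1#8) (-33#256,59#128,1#8) (-1#8,0,0) (-17#128,59#64,0);
   Join (-17#64,-5#32,0) (0,2#1,0) (1#2);
   Oct (-1#8,-1#4,0) (1#8,0,0) (0,-35#64,0) (0,-5#64,0) (0,-5#16,-1#8) (0,-5#16,1#8) (0,-1#2,0) (0,-1#8,0);
   Join (-1#8,-1#4,0) (1#8,0,0) (1#2);
   Push [:: (3284332#8553,1129016#8553,345856#8553,1402697#17106); (1121644#8553,3291704#8553,-296192#8553,1943369#17106); (17020#111189,-2240456#555945,-227584#555945,12937#1111890); (-2077588#555945,-77768#555945,-869632#555945,553609#1111890); (907412#8553,-941624#8553,1377536#8553,-226853#17106); (-1255276#8553,1221064#8553,735488#8553,313819#17106); (48532#555945,-2272312#555945,-211712#555945,-12133#1111890); (-2114156#555945,-109624#555945,-170752#111189,528539#1111890); (4289#17,4483#17,1455#1088,13391#136)] (3#64,25#128,1#2);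
   Join (-9#32,-7#64,1) (1#8,0,0) (1#2);
   Oct (1,-1#1,0) (-19#64,-5#32,0) (-45#1024,-1115#512,0) (405#1024,-205#512,0) (45#256,-165#128,1#8) (45#256,-165#128,-1#8) (0,-2#1,0) (45#128,-37#64,0);
   Join (1,-1#1,0) (-19#64,-5#32,0) (1#2);
   Oct (1#8,0,0) (-1#4,1#8,1) (1#128,71#128,-1#16) (-9#128,1#128,9#16) (-5#32,1#4,53#256) (3#32,5#16,75#256) (0,1#2,0) (-1#16,1#16,1#2);
   Join (1#8,0,0) (-1#4,1#8,1) (1#2);
   Oct (1,1,0) (-17#64,-5#32,0) (-47#8192,8293#4096,0) (3055#8192,1627#4096,0) (47#256,155#128,-1#8) (47#256,155#128,1#8) (0,2#1,0) (47#128,27#64,0);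
   Join (1,1,0) (-17#64,-5#32,0) (1#2);
   Oct (-9#32,-7#64,1) (-1#4,1#8,1) (89#512,-1#1024,-1#8) (-161#512,9#1024,9#8) (-25#128,79#3840,433#960) (7#128,-49#3840,527#960) (1#8,0,0) (-17#64,1#128,1);
   Join (-9#32,-7#64,1) (-1#4,1#8,1) (1#2);
   Oct (-19#64,-1#8,0) (-1#4,1#8,1) (-2305#8192,-455#4096,129#128) (-2239#8192,7#4096,63#128) (-39#256,-137#1920,5747#7680) (-103#256,-73#1920,5773#7680) (-9#32,-7#64,1) (-35#128,0,1#2);
   Join (-19#64,-1#8,0) (-1#4,1#8,1) (1#2);
   Oct (1#2,-1#2,0) (1#2,1#2,0) (23#64,0,0) (33#64,0,0) (7#16,0,1#8) (7#16,0,-1#8) (3#8,0,0) (1#2,0,0);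
   Join (1#2,-1#2,0) (1#2,1#2,0) (1#2);
   Oct (1,-1#1,0) (1#2,1#2,0) (15#32,-17#32,0) (25#32,-7#32,0) (5#8,-3#8,1#8) (5#8,-3#8,-1#8) (1#2,-1#2,0) (3#4,-1#4,0);
   Join (1,-1#1,0) (1#2,1#2,0) (1#2);
   Oct (1,1,0) (1,-1#1,0) (63#128,65#128,0) (129#128,-1#128,0) (3#4,1#4,-1#8) (3#4,1#4,1#8) (1#2,1#2,0) (1,0,0);
   Join (1,1,0) (1,-1#1,0) (1#2);
   Oct (-17#64,-5#32,0) (1,-1#1,0) (65617#65536,32869#32768,0) (23983#65536,-19045#32768,0) (175#256,27#128,1#8) (175#256,27#128,-1#8) (1,1,0) (47#128,-37#64,0);
   Join (-17#64,-5#32,0) (1,-1#1,0) (1#2);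
   Push [:: (0,4#49,48#49,1#98); (0,132#17,-16#17,33#34); (-576#193,40#193,192#193,-148#193); (-192#43,40#129,128#129,-148#129); (-64#1,8#1,0,-16#1); (576#1,-232#17,-384#17,2878#17); (576#1,24#17,-448#17,2910#17); (64#1,-8#1,0,18#1); (-192#1,-8#1,0,-46#1); (-320#1,8#1,0,-80#1)] (0,0,-1#1);
   Push [:: (0,-32#27,-280#27,-5#27); (0,-32#27,280#27,-5#27); (-576#1,-23360#27,-78040#27,-7781#27); (-576#1,-23360#27,78040#27,-7781#27); (2752#2195,14656#19755,-79192#19755,9643#19755); (2752#2195,14656#19755,79192#19755,9643#19755); (-64#17,64#17,-8#1,145#17); (-64#17,64#17,8#1,145#17)] (-1#2,-1#2,0);
   Push [:: (0,4#1,30#1,1#2); (0,4#1,-30#1,1#2); (-576#59,272#59,240#59,-119#59); (-576#59,272#59,-240#59,-119#59); (576#1,-104#1,1164#1,158#1); (576#1,-104#1,-1164#1,158#1); (2816#37,-1536#37,8#1,933#37); (2816#37,-1536#37,-8#1,933#37)] (3#4,11#8,0);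
   Cut (1#2,3#2,0) (-19#64,-1#8,0) (1#2);
   Oct (1#2,3#2,0) (-19#64,-1#8,0) (-13#8192,2069#1024,0) (845#8192,683#1024,0) (13#256,43#32,-1#8) (13#256,43#32,1#8) (13#128,11#16,0) (0,2#1,0);
   Cut (1#2,-3#2,0) (-19#64,-5#32,0) (1#2);
   Oct (1#2,-3#2,0) (-19#64,-5#32,0) (-13#8192,-8267#4096,0) (845#8192,-3317#4096,0) (13#256,-181#128,1#8) (13#256,-181#128,-1#8) (13#128,-53#64,0) (0,-2#1,0);
   Cut (0,2#1,0) (-19#64,-1#8,0) (1#2);
   Oct (0,2#1,0) (-19#64,-1#8,0) (-557#1024,201#128,0) (-107#1024,111#128,0) (-83#256,39#32,-1#8) (-83#256,39#32,1#8) (-19#128,15#16,0) (-1#2,3#2,0);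
   Cut (0,-2#1,0) (-19#64,-5#32,0) (1#2);
   Oct (0,-2#1,0) (-19#64,-5#32,0) (-557#1024,-795#512,0) (-107#1024,-525#512,0) (-83#256,-165#128,1#8) (-83#256,-165#128,-1#8) (-19#128,-69#64,0) (-1#2,-3#2,0);
   Cut (-19#64,-1#8,0) (-1#2,3#2,0) (1#2);
   Push [:: (4288#729,18632#9477,-40#9,18878#9477); (4288#729,18632#9477,40#9,18878#9477); (-2368#81,-2552#1053,-40#1,-9458#1053); (-2368#81,-2552#1053,40#1,-9458#1053); (832#729,-10312#9477,-40#9,20876#9477); (832#729,-10312#9477,40#9,20876#9477); (-2752#81,-5768#1053,-40#1,-9236#1053); (-2752#81,-5768#1053,40#1,-9236#1053); (-512#185,2128#2405,-12212#925,-342#481)] (-201#640,39#80,0);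
   Cut (-19#64,-5#32,0) (-1#2,-3#2,0) (1#2);
   Push [:: (4288#729,-74528#31347,40#9,43094#31347); (4288#729,-74528#31347,-40#9,43094#31347); (-2368#81,10208#3483,40#1,-28634#3483); (-2368#81,10208#3483,-40#1,-28634#3483); (832#729,41248#31347,40#9,79760#31347); (832#729,41248#31347,-40#9,79760#31347); (-2752#81,23072#3483,40#1,-24560#3483); (-2752#81,23072#3483,-40#1,-24560#3483); (-512#185,-8512#7955,-1203#185,-7866#7955)] (-201#640,-129#320,0);
   (* The tangle occupies [[-19/64, -17/64] x [-5/32, -1/8]], its place in the nested sums. These
      four pushes stretch this box to the full square: each fixes one side and carries the opposite
      one to coordinate 1 or -1. *)
   Push [:: (0,-32#1,0,-4#1); (0,32#43,0,48#43); (64#109,0,0,128#109); (-64#145,0,0,128#145)] (0,-27#32,0);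
   Push [:: (0,8#7,0,8#7); (0,-8#13,0,12#13); (64#109,0,0,128#109); (-64#145,0,0,128#145)] (0,9#8,0);
   Push [:: (-32#1,0,0,-17#2); (64#109,0,0,128#109); (0,2#1,0,3#1); (0,-2#1,0,3#1)] (-45#64,0,0);
   Push [:: (64#47,0,0,64#47); (-64#145,0,0,128#145); (0,2#1,0,3#1); (0,-2#1,0,3#1)] (81#64,0,0);
   Join (0,-2#1,0) (1,-1#1,0) (1#2);
   Join (-3#5,-7#5,0) (0,-2#1,0) (1#6);
   Join (-1#1,-1#1,0) (0,-2#1,0) (2#5);
   Join (0,2#1,0) (1,1,0) (1#2);
   Join (-3#5,7#5,0) (0,2#1,0) (1#6);
   Join (-1#1,1,0) (0,2#1,0) (2#5)])%qfrac.

Definition node_moves : seq move :=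
  ([:: Cut (-11#8,1#8,0) (-5#4,1#2,0) (2#7);
   Cut (-75#56,13#56,0) (-5#4,1#2,0) (1#15);
   Push [:: (4#1,0,0,11#2); (-8#1,0,0,-8#1); (0,8#1,0,2#1); (0,-8#1,0,2#1)] (-7#32,0,0);
   Join (-43#32,-1#8,0) (-3#4,-1#8,0) (11#19);
   Join (-1#2,-1#8,0) (-43#32,-1#8,0) (8#27);
   Join (-3#8,-1#8,0) (-43#32,-1#8,0) (4#31);
   Push [:: (0,4#1,0,1#2); (0,-8#1,0,2#1); (8#1,0,0,12#1); (-32#11,0,0,-32#11)] (0,-7#32,0);
   Oct (-11#8,-3#32,0) (-4#3,1#4,0) (-7379#5376,775#3584,0) (-2423#1792,225#3584,0) (-1831#1344,125#896,1#8) (-1831#1344,125#896,-1#8) (-307#224,45#224,0) (-65#48,5#64,0);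
   Join (-11#8,-3#32,0) (-4#3,1#4,0) (1#2);
   Oct (-5#4,1#2,0) (-11#8,-3#32,0) (-171#128,131#512,0) (-503#384,101#512,0) (-127#96,29#128,-1#8) (-127#96,29#128,1#8) (-4#3,1#4,0) (-21#16,13#64,0);
   Join (-5#4,1#2,0) (-11#8,-3#32,0) (1#2);
   Push [:: (-89100#2131,-42256#2131,20144#2131,-88116#2131); (194780#6393,-224048#6393,-55088#6393,361892#6393); (-229700#57537,123728#57537,-112#57537,-291452#57537); (25820#6393,8816#19179,-12848#6393,111596#19179); (-68148#2131,17936#2131,53264#2131,-92022#2131); (257636#6393,-43472#6393,44272#6393,350174#6393); (-222716#57537,143792#57537,10928#57537,-292754#57537); (26596#6393,5168#6393,-34864#19179,37054#6393); (4#1,0,0,6#1); (-4#5,0,0,0); (0,2#3,0,2#3); (0,-2#1,0,2#1); (-14#9,344#171,-7#18,-667#342)] (1#16,-19#64,1#2);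
   Join (-1#1,1#2,1) (-11#8,-3#32,0) (1#2);
   Push [:: (-536#11,-8#7,-40#1,-3664#77); (-536#11,-8#7,40#1,-3664#77); (296#99,-8#7,-40#9,2864#693); (296#99,-8#7,40#9,2864#693); (-104#11,136#7,-40#1,-838#77); (-104#11,136#7,40#1,-838#77); (344#99,-8#9,-40#9,454#99); (344#99,-8#9,40#9,454#99); (2#1,0,0,3#1); (-1#1,0,0,0); (0,8#9,0,8#9); (0,-8#7,0,8#7); (16#11,16#7,-10#1,167#77)] (-11#64,21#64,0);
   Join (-1#1,1,0) (-43#32,-3#32,0) (1#2);
   Oct (-1#1,1#2,1) (-1#2,1#2,0) (-3#4,1#2,-1#16) (-3#4,1#2,9#16) (-3#4,5#8,1#4) (-3#4,3#8,1#4) (-3#4,1#2,0) (-3#4,1#2,1#2);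
   Join (-1#1,1#2,1) (-1#2,1#2,0) (1#2);
   Oct (-3#8,1#8,0) (-1#1,1#2,1) (-61#128,67#128,-1#16) (-91#128,37#128,9#16) (-23#32,35#96,3#16) (-15#32,43#96,5#16) (-1#2,1#2,0) (-11#16,5#16,1#2);
   Join (-3#8,1#8,0) (-1#1,1#2,1) (1#2);
   Push [:: (4#1,0,0,3#2); (-8#1,0,0,0); (0,8#1,0,2#1); (0,-8#1,0,2#1)] (-1#16,0,0);
   Cut (-3#8,-1#8,0) (-43#32,-1#8,0) (4#31);
   Cut (-3#8,1#8,0) (-1#1,1#2,1) (1#5);
   Push [:: (-16#3,0,0,-1#1); (8#1,0,0,4#1); (0,8#1,0,2#1); (0,-8#1,0,2#1)] (1#8,0,0);
   Join (-1#4,-1#8,0) (-43#32,-1#8,0) (8#35);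
   Push [:: (0,4#1,0,1#2); (0,-8#1,0,2#1); (4#1,0,0,2#1); (-16#3,0,0,0)] (0,-1#16,0);
   Cut (-1#4,-1#8,0) (-43#32,-1#8,0) (8#35);
   Push [:: (0,-16#3,0,1#3); (0,8#1,0,2#1); (4#1,0,0,2#1); (-16#3,0,0,0)] (0,1#16,0);
   Oct (-11#8,-3#32,0) (-1#2,1#5,1#5) (-1025#1024,10383#20480,649#640) (-959#1024,189#4096,11#128) (-241#256,97#640,6287#10240) (-255#256,257#640,4977#10240) (-1#1,1#2,1) (-15#16,17#320,1#10);
   Join (-11#8,-3#32,0) (-1#2,1#5,1#5) (1#2);
   Push [:: (-544#27,1744#27,-40#1,-1#1); (-544#27,1744#27,40#1,-1#1); (224#243,-4784#243,-40#9,-1#1); (224#243,-4784#243,40#9,-1#1); (32#27,7216#27,-40#1,35#1); (32#27,7216#27,40#1,35#1); (32#27,-464#27,-40#9,-5#9); (32#27,-464#27,40#9,-5#9); (1,0,0,3#2); (-2#1,0,0,0); (0,8#7,0,8#7); (0,-8#9,0,8#9); (-2#1,-8#1,-75#8,-1#1)] (-19#64,1#32,0);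
   Join (-1#4,-1#16,0) (-43#32,-1#8,0) (1#2);
   Cut (-1#1,1,0) (-43#32,-3#32,0) (24#35);
   Cut (-1#4,1#16,0) (-1#2,1#5,1#5) (105#121);
   Push [:: (8#1,0,0,12#1); (-32#35,0,0,-8#35); (0,8#1,0,2#1); (0,-32#11,0,8#11)] (69#64,3#32,0);
   Push [:: (112000#7047,-44596#7047,40#1,156596#7047); (112000#7047,-44596#7047,-40#1,156596#7047); (-22400#21141,-21148#21141,40#9,-1252#21141); (-22400#21141,-21148#21141,-40#9,-1252#21141); (31360#7047,149876#7047,40#1,8330#7047); (31360#7047,149876#7047,-40#1,8330#7047); (-76160#63423,-41836#63423,40#9,-20230#63423); (-76160#63423,-41836#63423,-40#9,-20230#63423); (140#37,0,0,210#37); (-140#173,0,0,0); (0,4#5,0,4#5); (0,-4#3,0,4#3); (-4867520#4702329,-78400#4702329,-3282485#1044962,-1292935#4702329)] (2701#4480,1#4,0);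
   Join (-1#1,1,0) (-17#64,0,0) (1#2);
   Oct (-245#968,97#484,21#121) (-19#64,0,0) (-217889#619520,8821#38720,2073#9680) (-165079#619520,3331#38720,703#9680) (-1580801#4801280,647147#2400640,89#4840) (-1387201#4801280,106277#2400640,1299#4840) (-151#440,47#220,1#5) (-4259#15488,97#968,21#242);
   Join (-245#968,97#484,21#121) (-19#64,0,0) (1#2);
   Push [:: (306151744#1167675,-76537936#389225,7786240#46707,90888799#1167675); (-1778417344#191607099,444604336#63869033,4119808#63869033,-527967649#191607099); (-1328512#3321,13312#1107,-36323#3321,-334624#3321); (91509952#1167675,-134974288#389225,13205248#46707,48185167#1167675); (-2499039136#41206731,105161584#13735577,-19298048#13735577,-644477581#41206731); (1688741824#25023421,-227359968#25023421,-57677312#75070263,501345229#25023421); (-185356864#76075269,140811616#25358423,-906752#25358423,-55027819#76075269); (22587617984#50401529,-4480922752#50401529,-232515584#50401529,6705699089#50401529); (37279290368#83823833,-7929903104#83823833,-503250944#83823833,11195779929#83823833); (968#1207,0,0,1452#1207); (-968#245,0,0,0); (0,484#581,0,484#581); (0,-484#387,0,484#387)] (-109#3872,-1431#7744,100#121);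
   Cut (-3#16,1#16,0) (0,1#8,0) (1#2);
   Push [:: (136#9,-40#3,-40#9,11#3); (136#9,-40#3,40#9,11#3); (-56#1,200#1,-40#1,-23#1); (-56#1,200#1,40#1,-23#1); (-8#9,-88#3,-40#9,11#3); (-8#9,-88#3,40#9,11#3); (-72#1,184#1,-40#1,-23#1); (-72#1,184#1,40#1,-23#1); (32#45,0,0,16#15); (-32#3,0,0,0); (0,32#35,0,32#35); (0,-32#29,0,32#29); (8#1,8#1,-8#1,1)] (-1#32,1#32,0);
   Cut (-3#16,-1#16,0) (0,-1#8,0) (1#2);
   Push [:: (136#9,40#3,40#9,11#3); (136#9,40#3,-40#9,11#3); (-56#1,-200#1,40#1,-23#1); (-56#1,-200#1,-40#1,-23#1); (-8#9,88#3,40#9,11#3); (-8#9,88#3,-40#9,11#3); (-72#1,-184#1,40#1,-23#1); (-72#1,-184#1,-40#1,-23#1); (32#45,0,0,16#15); (-32#3,0,0,0); (0,32#29,0,32#29); (0,-32#35,0,32#35); (48#5,-16#5,-1#1,8#5)] (-1#32,-1#32,0);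
   Cut (-9#32,1#64,1) (-1#4,1#16,0) (1#2);
   Push [:: (9698368#184329,6292480#184329,229376#184329,799990#61443); (-87488#20481,3845120#61443,16384#20481,-183050#61443); (3409472#20481,-6292480#20481,-229376#20481,428870#6827); (-7076288#20481,-1049600#20481,-311296#20481,-554170#6827); (4978624#184329,-3144704#184329,376832#184329,480400#61443); (-203968#6827,699392#61443,32768#20481,-502640#61443); (2885056#20481,-7341056#20481,-212992#20481,393360#6827); (-2533568#6827,-699392#6827,-98304#6827,-589680#6827); (64#79,0,0,96#79); (-64#17,0,0,0); (0,128#133,0,128#133); (0,-128#123,0,128#123); (-64#1,0,0,-16#1)] (0,-1#128,-1#2);
   Cut (-17#64,0,0) (-1#1,1,0) (1#2);
   Push [:: (6272#1105,6816#1105,-264#65,98#65); (6272#1105,6816#1105,264#65,98#65); (-132992#17,-97632#17,-264#1,-2078#1); (-132992#17,-97632#17,264#1,-2078#1); (255872#1105,185696#1105,-264#65,4128#65); (255872#1105,185696#1105,264#65,4128#65); (-129152#17,-94880#17,-264#1,-2016#1); (-129152#17,-94880#17,264#1,-2016#1); (128#111,0,0,64#37); (-128#81,0,0,0); (0,2#3,0,2#3); (0,-2#1,0,2#1); (-128#43,-8#43,-187#43,-34#43)] (43#128,-15#32,0);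
   Cut (-19#64,1#32,0) (-1#1,1,0) (1#2);
   Push [:: (416#63,48#7,40#9,110#63); (416#63,48#7,-40#9,110#63); (8864#7,6448#7,40#1,2430#7); (8864#7,6448#7,-40#1,2430#7); (-16288#63,-1328#7,40#9,-4336#63); (-16288#63,-1328#7,-40#9,-4336#63); (7008#7,5072#7,40#1,1936#7); (7008#7,5072#7,-40#1,1936#7); (128#109,0,0,192#109); (-128#83,0,0,0); (0,64#97,0,64#97); (0,-64#31,0,64#31); (-28#9,-10#29,-1075#261,-1753#2088)] (43#128,-29#64,0);
   Cut (-19#64,-1#32,0) (-3#2,-1#8,0) (1#2);
   Push [:: (-4064#2405,848#2405,-264#65,-236#481); (-4064#2405,848#2405,264#65,-236#481); (6176#37,-80048#37,-264#1,-668#37); (6176#37,-80048#37,264#1,-668#37); (-8224#2405,156848#2405,-264#65,1454#481); (-8224#2405,156848#2405,264#65,1454#481); (6112#37,-77648#37,-264#1,-538#37); (6112#37,-77648#37,264#1,-538#37); (128#77,0,0,192#77); (-128#115,0,0,0); (0,64#59,0,64#59); (0,-64#69,0,64#69); (-8#5,-4#5,-21#5,-1#2)] (75#128,1#64,0);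
   Cut (-1#1,1,0) (-5#16,1#16,0) (1#2);
   Push [:: (316#3,676#9,40#9,272#9); (316#3,676#9,-40#9,272#9); (-428#1,-316#1,40#1,-112#1); (-428#1,-316#1,-40#1,-112#1); (4#3,28#9,40#9,2#9); (4#3,28#9,-40#9,2#9); (-532#1,-388#1,40#1,-142#1); (-532#1,-388#1,-40#1,-142#1); (32#27,0,0,16#9); (-32#21,0,0,0); (0,32#49,0,32#49); (0,-32#15,0,32#15); (-21632#8731,2432#8731,-35360#8731,-6757#8731)] (9#32,-13#32,0);
   Cut (-3#2,-1#8,0) (-5#16,-1#16,0) (1#2);
   Oct (-3#2,-1#8,0) (-5#16,-1#16,0) (-79#256,-33#256,0) (-249#256,-23#256,0) (-41#64,-7#64,-1#8) (-41#64,-7#64,1#8) (-29#32,-3#32,0) (-3#8,-1#8,0);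
   Cut (-17#64,0,0) (-19#64,1#32,0) (1#2)])%qfrac.

Definition vine_moves : seq move :=
  ([:: Oct (-1#1,-1#8,0) (0,1#4,0) (1#128,-1#1024,0) (-65#128,65#1024,0) (-1#4,1#32,-1#8) (-1#4,1#32,1#8) (0,0,0) (-1#2,1#16,0);
   Join (-1#1,-1#8,0) (0,1#4,0) (1#2);
   Push [:: (87#134,957#134,221#134,-87#134); (-89#112,-979#112,23#112,89#112); (3378#1069,4830#1069,406#1069,663#1069); (3026#1025,-5378#1025,-782#1025,1807#1025); (-1497#134,2829#134,-1363#134,1497#134); (-239#16,-325#16,-223#16,239#16); (0,512#59,-440#59,499#59); (0,-1280#177,-1496#177,1673#177); (1,0,0,1); (0,1,0,1); (4#3,-4#1,0,1); (-1#1,-4#1,0,1); (-1#1,0,0,1)] (-1#4,0,0);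
   Cut (0,1#4,0) (-1#1,-1#8,0) (1#2);
   Oct (0,1#4,0) (-1#1,-1#8,0) (1#16,17#128,0) (-9#16,7#128,0) (-1#4,3#32,1#8) (-1#4,3#32,-1#8) (-1#2,1#16,0) (0,1#8,0);
   Cut (1,0,0) (-1#4,0,1) (1#2);
   Oct (1,0,0) (-1#4,0,1) (-3#64,-9#64,-1#16) (27#64,1#64,9#16) (13#64,-3#16,69#256) (11#64,1#16,59#256) (3#8,0,1#2) (0,-1#8,0);
   Cut (0,1#8,0) (-1#1,-1#8,0) (1#2);
   Oct (0,1#8,0) (-1#1,-1#8,0) (-5#64,9#64,0) (-35#64,-1#64,0) (-5#16,1#16,-1#8) (-5#16,1#16,1#8) (-1#2,0,0) (-1#8,1#8,0);
   Cut (-1#4,0,1) (0,-1#8,0) (1#2);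
   Oct (-1#4,0,1) (0,-1#8,0) (-1#8,-17#128,-1#16) (-1#8,-7#128,9#16) (-1#8,1#32,15#64) (-1#8,-7#32,17#64) (-1#8,-1#16,1#2) (-1#8,-1#8,0);
   Cut (-1#1,-1#8,0) (-1#8,1#8,0) (1#2);
   Oct (-1#1,-1#8,0) (-1#8,1#8,0) (-45#128,-9#64,0) (-75#128,1#64,0) (-15#32,-1#16,-1#8) (-15#32,-1#16,1#8) (-9#16,0,0) (-3#8,-1#8,0);
   Cut (-3#8,-1#8,0) (-1#8,1#8,0) (1#2)])%qfrac.

Definition left_arc_moves : seq move :=
  ([:: Oct (-1#1,-1#8,0) (-1#2,1#2,0) (3#32,-3#128,0) (-27#32,27#128,0) (-3#8,3#32,-1#8) (-3#8,3#32,1#8) (0,0,0) (-3#4,3#16,0);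
   Join (-1#1,-1#8,0) (-1#2,1#2,0) (1#2);
   Cut (-1#1,-1#8,0) (-1#2,1#2,0) (1#2);
   Oct (-1#1,-1#8,0) (-1#2,1#2,0) (-33#128,-3#128,0) (-103#128,27#128,0) (-17#32,3#32,-1#8) (-17#32,3#32,1#8) (-3#4,3#16,0) (-5#16,0,0);
   Cut (-5#16,0,0) (-1#2,1#2,0) (1#2);
   Oct (-5#16,0,0) (-1#2,1#2,0) (-95#256,7#64,0) (-105#256,17#64,0) (-25#64,3#16,1#8) (-25#64,3#16,-1#8) (-13#32,1#4,0) (-3#8,1#8,0);
   Cut (-1#1,-1#8,0) (-5#16,0,0) (1#2);
   Oct (-1#1,-1#8,0) (-5#16,0,0) (-87#256,-17#128,0) (-177#256,-7#128,0) (-33#64,-3#32,-1#8) (-33#64,-3#32,1#8) (-21#32,-1#16,0) (-3#8,-1#8,0)])%qfrac.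

Definition right_arc_moves : seq move :=
  ([:: Push [:: (-16#7,0,44#7,4#7); (-16#7,0,-44#7,4#7); (112#23,-288#23,124#23,44#23); (112#23,-288#23,-124#23,44#23); (128#7,36#1,278#7,31#7); (128#7,36#1,-278#7,31#7); (128#7,-192#7,8#1,31#7); (128#7,-192#7,-8#1,31#7); (16#1,0,0,4#1); (-16#7,0,0,4#7); (0,4#1,0,1); (0,-4#1,0,1)] (3#16,1#8,0);
   Cut (1#4,-1#4,0) (0,1#8,0) (1#2);
   Oct (1#4,-1#4,0) (0,1#8,0) (-1#64,-17#128,0) (9#64,-7#128,0) (1#16,-3#32,1#8) (1#16,-3#32,-1#8) (1#8,-1#16,0) (0,-1#8,0);
   Cut (0,1#8,0) (0,-1#8,0) (1#2);
   Oct (0,1#8,0) (0,-1#8,0) (-9#64,9#64,0) (1#64,-1#64,0) (-1#16,1#16,-1#8) (-1#16,1#16,1#8) (0,0,0) (-1#8,1#8,0);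
   Cut (0,-1#8,0) (-1#8,1#8,0) (1#2);
   Oct (0,-1#8,0) (-1#8,1#8,0) (-17#128,-9#64,0) (-7#128,1#64,0) (-3#32,-1#16,1#8) (-3#32,-1#16,-1#8) (-1#16,0,0) (-1#8,-1#8,0);
   Cut (-1#8,1#8,0) (-1#8,-1#8,0) (1#2);
   Oct (-1#8,1#8,0) (-1#8,-1#8,0) (-25#128,0,0) (-15#128,0,0) (-5#32,0,-1#8) (-5#32,0,1#8) (-1#8,0,0) (-3#16,0,0)])%qfrac.

Definition closure_moves : seq move :=
  ([:: Push [:: (25160#689,-10224#689,-3456#689,8157#689); (-20920#689,5136#689,-16896#689,-7203#689); (5080#2067,-21616#6201,17536#6201,3013#6201); (-10280#2067,-6256#6201,4096#6201,-12347#6201); (35384#689,19440#689,-4608#689,28101#689); (-10696#689,34800#689,-18048#689,12741#689); (16376#6201,-18320#6201,17408#6201,581#689); (-29704#6201,-2960#6201,3968#6201,-3377#2067); (-4#1,-4#3,-101#6,-5#3)] (1#8,-1#16,-1#2);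
   Join (-3#8,-1#8,0) (-3#8,-1#1,-1#1) (1#2);
   Push [:: (-467000#2889,669560#2889,-213184#2889,284140#2889); (-635960#2889,-175240#2889,526016#2889,115180#2889); (11560#37557,335224#187785,-475328#187785,69356#187785); (-22232#37557,-509576#187785,263872#187785,-99604#187785); (671800#2889,354440#2889,-313024#2889,296230#2889); (502840#2889,-490360#2889,426176#2889,127270#2889); (15064#37557,330376#187785,-476864#187785,69542#187785); (-18728#37557,-514424#187785,262336#187785,-99418#187785); (-204#2275,-316#455,-51#130,-274#2275)] (5#16,13#16,1);
   Join (1#4,-1#4,0) (-3#8,-1#8,0) (1#2);
   Push [:: (166132#705,-19492#141,-65216#705,74482#705); (2636#15,484#3,2432#15,686#15); (18932#45825,-16676#9165,-116416#45825,17522#45825); (-23308#45825,25564#9165,63104#45825,-24718#45825); (-38396#235,-10484#47,-20352#235,22704#235); (-52476#235,3596#47,39488#235,8624#235); (4868#15275,-1124#611,-38784#15275,5808#15275); (-196#325,36#13,448#325,-176#325); (-6#65,46#65,-51#130,-8#65)] (3#16,-13#16,1);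
   Join (-3#8,1#8,0) (1#4,1#4,0) (1#2);
   Oct (1#4,-1#4,0) (-1#8,-1#8,0) (-1#128,-15#128,0) (9#128,-25#128,0) (1#32,-5#32,-1#8) (1#32,-5#32,1#8) (0,-1#8,0) (1#16,-3#16,0);
   Join (1#4,-1#4,0) (-1#8,-1#8,0) (1#2);
   Oct (1#4,1#4,0) (-1#8,1#8,0) (-1#128,15#128,0) (9#128,25#128,0) (1#32,5#32,1#8) (1#32,5#32,-1#8) (0,1#8,0) (1#16,3#16,0);
   Join (1#4,1#4,0) (-1#8,1#8,0) (1#2);
   Push [:: (0,8#1,-8#1,-1#1); (0,8#1,8#1,-1#1); (72#37,-64#37,-152#37,35#37); (72#37,-64#37,152#37,35#37); (-72#1,224#1,-152#1,-37#1); (-72#1,224#1,152#1,-37#1); (0,-64#1,-8#1,17#1); (0,-64#1,8#1,17#1)] (-1#2,0,0);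
   Push [:: (0,-8#1,8#1,-1#1); (0,-8#1,-8#1,-1#1); (72#37,64#37,152#37,35#37); (72#37,64#37,-152#37,35#37); (-72#1,-224#1,152#1,-37#1); (-72#1,-224#1,-152#1,-37#1); (0,64#1,8#1,17#1); (0,64#1,-8#1,17#1)] (-1#2,0,0)])%qfrac.

(** * Moves inside horizontal sums, and the isotopies of tangles and closures *)

Section Tangles.
Context {R : realType}.
Local Notation sp := (space R).
Local Notation pmap := (R * R * R * R * R * R)%type.

Definition det (m : pmap) : R := m.1.1.1.1.1 * m.1.1.2 - m.1.1.1.1.2 * m.1.1.1.2.

Definition ap_inv (m : pmap) : pmap :=
  let k := (det m)^-1 in
  (k * m.1.1.2, - k * m.1.1.1.1.2, - k * m.1.1.1.2, k * m.1.1.1.1.1,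
   k * (m.1.1.1.1.2 * m.2 - m.1.1.2 * m.1.2),
   k * (m.1.1.1.2 * m.1.2 - m.1.1.1.1.1 * m.2)).

Lemma apK m : det m != 0 -> cancel (ap m) (ap (ap_inv m)).
Proof.
case: m => [[[[[a b] c] d] e] f]; rewrite /det /= => m0 [[x y] z].
by rewrite /ap /ap_inv /det /=; congr (_, _, _); field.
Qed.

Lemma ap_invK m : det m != 0 -> cancel (ap (ap_inv m)) (ap m).
Proof.
case: m => [[[[[a b] c] d] e] f]; rewrite /det /= => m0 [[x y] z].
by rewrite /ap /ap_inv /det /=; congr (_, _, _); field.
Qed.

Lemma ap_lipschitz (m : pmap) : lipschitz (ap m).
Proof.
exists (`|m.1.1.1.1.1| + `|m.1.1.1.1.2| + `|m.1.1.1.2| + `|m.1.1.2| + 1) => p q.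
have [h1 h2 h3] := coord_norm (p - q).
have key (a b u v : R) : `|u| <= `|p - q| -> `|v| <= `|p - q| ->
    `|a * u + b * v| <= (`|a| + `|b|) * `|p - q|.
  move=> u1 v1; rewrite (le_trans (ler_normD _ _))// !normrM mulrDl.
  by rewrite lerD// ler_wpM2l.
have n0 : 0 <= `|p - q| by [].
apply: norm_coord => /=.
- have -> : m.1.1.1.1.1 * p.1.1 + m.1.1.1.1.2 * p.1.2 + m.1.2 -
    (m.1.1.1.1.1 * q.1.1 + m.1.1.1.1.2 * q.1.2 + m.1.2) =
    m.1.1.1.1.1 * (p - q).1.1 + m.1.1.1.1.2 * (p - q).1.2 by rewrite /=; ring.
  rewrite (le_trans (key _ _ _ _ h1 h2))// ler_wpM2r// -!addrA lerD2l lerDl.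
  by rewrite !addr_ge0.
- have -> : m.1.1.1.2 * p.1.1 + m.1.1.2 * p.1.2 + m.2 -
    (m.1.1.1.2 * q.1.1 + m.1.1.2 * q.1.2 + m.2) =
    m.1.1.1.2 * (p - q).1.1 + m.1.1.2 * (p - q).1.2 by rewrite /=; ring.
  rewrite (le_trans (key _ _ _ _ h1 h2))// ler_wpM2r//.
  have := normr_ge0 m.1.1.1.1.1; have := normr_ge0 m.1.1.1.1.2; lra.
- rewrite (le_trans h3)// ler_peMl//.
  have := normr_ge0 m.1.1.1.1.1; have := normr_ge0 m.1.1.1.1.2.
  have := normr_ge0 m.1.1.1.2; have := normr_ge0 m.1.1.2; lra.
Qed.

Lemma move_in_ap m U X Y : det m != 0 -> move_in U X Y ->
  move_in (ap m @` U) (ap m @` X) (ap m @` Y).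
Proof.
move=> m0; apply: move_in_conj; [exact: apK|exact: ap_invK|exact: ap_lipschitz|].
exact: ap_lipschitz.
Qed.

Definition square : set sp := [set p | -1 < p.1.1 < 1 /\ -1 < p.1.2 < 1].

Definition left_map : pmap := (4^-1, 0, 0, 2^-1, - 4^-1, 0).
Definition right_map : pmap := (4^-1, 0, 0, 2^-1, 4^-1, 0).
Definition swap_map : pmap := (0, 1, 1, 0, 0, 0).

Definition corner_legs : set sp :=
  planar_segment (-1, 1) (- 2^-1, 2^-1) `|` planar_segment (1, 1) (2^-1, 2^-1)
  `|` planar_segment (-1, -1) (- 2^-1, - 2^-1) `|` planar_segment (1, -1) (2^-1, - 2^-1).

Lemma hsumE (A B : set sp) :
  hsum A B = ap left_map @` A `|` ap right_map @` B `|` corner_legs.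
Proof.
rewrite /hsum /corner_legs !setUA; congr (_ `|` _ `|` _ `|` _ `|` _ `|` _).
  by apply: eq_imagel => q _; rewrite /ap /left_map /=; congr (_, _, _); field.
by apply: eq_imagel => q _; rewrite /ap /right_map /=; congr (_, _, _); field.
Qed.

Lemma rhoE (A : set sp) : rho A = ap swap_map @` A.
Proof.
by apply: eq_imagel => q _; rewrite /ap /swap_map /=; congr (_, _, _); ring.
Qed.

Lemma segment_slab (p q : sp) : slab p -> slab q -> segment p q `<=` slab.
Proof.
move=> [/andP[? ?] /andP[? ?] /andP[? ?]] [/andP[? ?] /andP[? ?] /andP[? ?]] x.
move=> /segmentP[t /andP[t0 t1] <-]; split; rewrite /lerp /=; apply/andP; split; nra.
Qed.

Lemma crossing_slab b : (crossing b : set sp) `<=` slab.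
Proof.
by move=> x; case: b; rewrite /crossing /= => -[[[]|]|]; apply: segment_slab;
  split => /=; apply/andP; split; lra.
Qed.

Lemma arcs_slab : (horizontal_arcs : set sp) `<=` slab.
Proof.
by move=> x; rewrite /horizontal_arcs /planar_segment /at_height => -[[[]|]|];
  apply: segment_slab; split => /=; apply/andP; split; lra.
Qed.

Lemma legs_slab : corner_legs `<=` slab.
Proof.
by move=> x; rewrite /corner_legs /planar_segment /at_height => -[[[]|]|];
  apply: segment_slab; split => /=; apply/andP; split; lra.
Qed.

Lemma hsum_slab (A B : set sp) : A `<=` slab -> B `<=` slab -> hsum A B `<=` slab.
Proof.
move=> As Bs; rewrite hsumE => x [[[p + <-]|[p + <-]]|]; last exact: legs_slab.
  move=> /As[/andP[? ?] /andP[? ?] /andP[? ?]].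
  by split; rewrite /ap /left_map /=; apply/andP; split; lra.
move=> /Bs[/andP[? ?] /andP[? ?] /andP[? ?]].
by split; rewrite /ap /right_map /=; apply/andP; split; lra.
Qed.

Lemma rho_slab (A : set sp) : A `<=` slab -> rho A `<=` slab.
Proof. by move=> As _ [p /As[? ? ?] <-]; split. Qed.

Lemma legs_out p : corner_legs p -> 2^-1 <= p.1.2 \/ p.1.2 <= - 2^-1.
Proof.
rewrite /corner_legs /planar_segment /at_height.
by move=> [[[]|]|] /segmentP[t /andP[t0 t1] <-]; rewrite /lerp /=; [left|left|right|right]; lra.
Qed.

(** The summands move one after the other. The one at rest lies in its closed rectangle, hence off
    the open rectangle that supports the move of the other. *)
Lemma hsum_move (A A' B B' : set sp) : A' `<=` slab -> B `<=` slab ->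
  move_in square A A' -> move_in square B B' -> move_in square (hsum A B) (hsum A' B').
Proof.
move=> As Bs AA BB; apply: (@move_in_trans _ (hsum A' B)); rewrite !hsumE.
  rewrite -!setUA; apply: move_in_sub; last first.
    apply: (move_inU (Z := ap right_map @` B `|` corner_legs)); last first.
      apply: (move_in_ap _ AA); by rewrite /det /= mulr0 subr0 mulf_neq0// invr_eq0 pnatr_eq0.
    move=> x [[p /Bs [/andP[p1 p2] _ _] <-]|/legs_out lx] [q [/andP[q1 q2] /andP[q3 q4]]].
      by rewrite /ap /left_map /right_map /= => -[e _ _]; lra.
    by move=> E; move: lx; rewrite -E /ap /left_map /=; lra.
  move=> _ [q [/andP[? ?] /andP[? ?]] <-]; rewrite /square /ap /left_map /=.
  by split; apply/andP; split; lra.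
rewrite ![_ `|` ap right_map @` _]setUC -!setUA; apply: move_in_sub; last first.
  apply: (move_inU (Z := ap left_map @` A' `|` corner_legs)); last first.
    apply: (move_in_ap _ BB); by rewrite /det /= mulr0 subr0 mulf_neq0// invr_eq0 pnatr_eq0.
  move=> x [[p /As [/andP[p1 p2] _ _] <-]|/legs_out lx] [q [/andP[q1 q2] /andP[q3 q4]]].
    by rewrite /ap /left_map /right_map /= => -[e _ _]; lra.
  by move=> E; move: lx; rewrite -E /ap /right_map /=; lra.
move=> _ [q [/andP[? ?] /andP[? ?]] <-]; rewrite /square /ap /right_map /=.
by split; apply/andP; split; lra.
Qed.

(** A positive crossing on top of [A]. This is what a child of weight 1 contributes to the tangle of
    its parent, when [A] is the tangle of its only child. *)
Definition stack (A : set sp) : set sp := rho (hsum (rho A) (crossing true)).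

Fixpoint fill (T : btree) (B : set sp) : set sp :=
  if T is Node l r then hsum (stack (fill l (crossing false))) (fill r B) else B.

Lemma stack_slab A : A `<=` slab -> stack A `<=` slab.
Proof.
by move=> As; apply: rho_slab; apply: hsum_slab; [exact: rho_slab|exact: crossing_slab].
Qed.

Lemma fill_slab T B : B `<=` slab -> fill T B `<=` slab.
Proof.
elim: T B => //= l IHl r IHr B Bs; apply: hsum_slab; last exact: IHr.
by apply: stack_slab; apply: IHl; exact: crossing_slab.
Qed.

Lemma fill_move T B B' : B `<=` slab -> move_in square B B' ->
  move_in square (fill T B) (fill T B').
Proof.
elim: T B B' => //= l _ r IHr B B' Bs BB; apply: hsum_move.
- by apply: stack_slab; apply: fill_slab; exact: crossing_slab.
- exact: fill_slab.
- exact: move_in_refl.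
- exact: IHr.
Qed.

Definition vertical_arcs : set sp := rho horizontal_arcs.

Definition square_walls : seq qaff :=
  [:: (1, 0, 0, 1); (-1#1, 0, 0, 1); (0, 1, 0, 1); (0, -1#1, 0, 1)]%qfrac.

Lemma support_cons (a : R * R * R * R) s p : support (a :: s) p <-> 0 < ev a p /\ support s p.
Proof.
split=> [H|[a0 H] b]; last by rewrite inE => /orP[/eqP ->|/H].
by split=> [|b bs]; apply: H; rewrite inE ?eqxx// bs orbT.
Qed.

Lemma square_wallsE : support (map (@aff2r R) square_walls) `<=` square.
Proof.
move=> p /= /support_cons[+ /support_cons[+ /support_cons[+ /support_cons[+ _]]]].
rewrite /ev /aff2r /q2r /square /= => ? ? ? ?.
by split; apply/andP; split; lra.
Qed.

Lemma ap_qid (X : set sp) : ap (map2r qid) @` X = X.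
Proof.
rewrite -[RHS]image_id; apply: eq_imagel => -[[x y] z] _.
by rewrite /ap /map2r /q2r /=; congr (_, _, _); field.
Qed.

Lemma tangle_move env e e' os : (forall k, env k `<=` slab) ->
  connects square_walls os (flat qid e) (flat qid e') ->
  move_in square (interp env e) (interp env e').
Proof.
move=> envs /(connectsP envs); rewrite !draw_flat !ap_qid.
exact/move_in_sub/square_wallsE.
Qed.

Definition tstack (e : texp) : texp := Rho (Sum (Rho e) (Cross true)).

(** The two stacked crossings have opposite signs and cancel by a Reidemeister II move, leaving
    vertical arcs; the remaining crossing is then a kink, removed by Reidemeister I. *)
Lemma twist_move : move_in square (hsum (stack (crossing false)) (crossing false)) vertical_arcs.
Proof.
apply: (@tangle_move (fun=> set0) (Sum (tstack (Cross false)) (Cross false)) (Rho Arcs) twist_moves); last by vm_compute.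
by move=> k p.
Qed.

Definition closed_up (A : set sp) : set sp :=
  A `|` planar_segment (-1, 1) (0, 2) `|` planar_segment (0, 2) (1, 1)
    `|` planar_segment (-1, -1) (0, - 2) `|` planar_segment (0, - 2) (1, -1).

Lemma draw_closure env m e :
  draw env (flat m e ++ place m qclosure_segs) = ap (map2r m) @` closed_up (interp env e).
Proof.
rewrite draw_cat draw_flat draw_place /closed_up -!setUA !image_setU; congr setU.
rewrite image_set0 setU0 /planar_segment /at_height /=.
congr ((ap _ @` _) `|` ((ap _ @` _) `|` ((ap _ @` _) `|` (ap _ @` _))));
  by congr segment; rewrite /pt2r /q2r /=; congr (_, _, _); lra.
Qed.

Lemma closure_move (A B : set sp) : move_in square A B -> move_in setT (closed_up A) (closed_up B).
Proof.
move=> AB; rewrite /closed_up -!setUA; apply: (@move_in_sub _ square) => //.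
apply: move_inU AB; rewrite /planar_segment /at_height /square /=.
by move=> p [|[|[|]]] /segmentP[t /andP[t0 t1] <-]; rewrite /lerp /= => -[/andP[? ?] /andP[? ?]]; lra.
Qed.

(** Because of the vertical arcs, the closure joins the two left ends of the other summand, and its
    two right ends. The three crossings around [A] amount to a quarter turn, which changes this into
    the usual closure. *)
Lemma unwind_move (A : set sp) : A `<=` slab ->
  move_in setT (closed_up (hsum (stack (hsum (stack A) (crossing false))) vertical_arcs)) (closed_up A).
Proof.
move=> As.
have /(@connectsP R (fun=> A) (fun=> As)) : connects [::] unwind_moves
   (flat qid (Sum (tstack (Sum (tstack (Var 0)) (Cross false))) (Rho Arcs)) ++ place qid qclosure_segs)
   (flat qid (Var 0) ++ place qid qclosure_segs).
  by vm_compute.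
rewrite !draw_closure !ap_qid; exact: move_in_sub.
Qed.

End Tangles.

(** * Finite unions of real segments *)

Section Scenes.
Context {R : realType}.
Local Notation sp := (space R).
Local Notation aff := (R * R * R * R)%type.

Definition scene (l : seq (sp * sp)) : set sp :=
  foldr (fun e X => segment e.1 e.2 `|` X) set0 l.

Fixpoint some (P : aff -> Prop) (s : seq aff) : Prop :=
  if s is a :: s then P a \/ some P s else False.

Lemma someP (P : aff -> Prop) s : some P s -> exists2 a, a \in s & P a.
Proof.
elim: s => //= b s IH [Pb|/IH[a sa Pa]]; first by exists b; rewrite ?mem_head.
by exists a => //; rewrite inE sa orbT.
Qed.

Definition misses s (e : sp * sp) := some (fun a => ev a e.1 <= 0 /\ ev a e.2 <= 0) s.
Fixpoint misses_all s (l : seq (sp * sp)) : Prop :=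
  if l is e :: l then misses s e /\ misses_all s l else True.
Definition avoids s (Z : set sp) := forall p, Z p -> ~ support s p.

Lemma avoids_segment s e : misses s e -> avoids s (segment e.1 e.2).
Proof.
case/someP => a sa [h1 h2]; apply: (segment_avoid sa sa).
by rewrite h1 h2.
Qed.

Lemma avoidsU s (A B : set sp) : avoids s A -> avoids s B -> avoids s (A `|` B).
Proof. by move=> sA sB p [/sA|/sB]. Qed.

Lemma avoids_scene s l : misses_all s l -> avoids s (scene l).
Proof.
elim: l => [_ p //|e l IH] /= [/avoids_segment h /IH]; exact: avoidsU.
Qed.

Definition vec (c c' : sp) : sp := (c'.1.1 - c.1.1, c'.1.2 - c.1.2, c'.2 - c.2).

Lemma translate0 (p d : sp) : translate p d 0 = p.
Proof. by case: p => [[x y] z]; rewrite /translate !mul0r !addr0. Qed.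

Lemma scene_cat l1 l2 : scene (l1 ++ l2) = scene l1 `|` scene l2.
Proof. by elim: l1 => [|e l IH] /=; rewrite ?set0U// IH setUA. Qed.

Definition mid (p q : sp) : sp := lerp p q (2^-1).

Lemma segment_mid (p q : sp) : segment p q = segment p (mid p q) `|` segment (mid p q) q.
Proof. by apply: segment_split; rewrite invr_ge0 ler0n invf_le1// ler1n. Qed.

End Scenes.

(** * Sheared coordinates, and the isotopy that absorbs a crossing of the tree *)

Section Frames.
Context {R : realType}.
Local Notation sp := (space R).
Local Notation aff := (R * R * R * R)%type.
Local Notation pmap := (R * R * R * R * R * R)%type.

(* Diagrams are described near the point [(g, g - w)] of the line [y = x - w]
   carrying the crossings of the right vine, in coordinates sheared along this line. *)
Definition frame (w g : R) : pmap := (1, 0, 1, 1, g, g - w).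

Definition fp (w g : R) (q : qpt) : sp := ap (frame w g) (pt2r q).

Definition fa (w g : R) (a : aff) : aff :=
  (a.1.1.1 - a.1.1.2, a.1.1.2, a.1.2, a.2 - a.1.1.1 * g + a.1.1.2 * w).

(** The square [[-1, 1] x [-1, 1]] goes to [[-3/8, -1/8] x [-1/8, 1/8]], a box on the line of
    crossings just left of the origin of the frame. *)
Definition qbox : qmap := (1#8, 0, 0, 1#8, -1#4, 0)%qfrac.

Definition box (w g : R) (A : set sp) : set sp :=
  ap (frame w g) @` (ap (map2r qbox) @` A).

Definition qsegs (l : seq (qpt * qpt)) : seq piece := [seq Seg e.1 e.2 | e <- l].

Definition fl (w g : R) (l : seq (qpt * qpt)) : seq (sp * sp) :=
  [seq (fp w g e.1, fp w g e.2) | e <- l].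

Definition window (w g : R) (walls : seq qaff) : seq aff :=
  map (fa w g) (map (@aff2r R) walls).

Lemma det_frame w g : det (frame w g) != 0.
Proof. by rewrite /det /= mulr1 mul0r subr0 oner_eq0. Qed.

Lemma ev_fa w g a p : ev (fa w g a) (ap (frame w g) p) = ev a p.
Proof. by rewrite /ev /fa /ap /frame /=; ring. Qed.

Lemma frame_support w g s : ap (frame w g) @` support s `<=` support (map (fa w g) s).
Proof. by move=> _ [p sp' <-] _ /mapP[a sa ->]; rewrite ev_fa; exact: sp'. Qed.

Lemma draw_qsegs env w g l : ap (frame w g) @` draw env (qsegs l) = scene (fl w g l).
Proof.
elim: l => [|e l IH] /=; first by rewrite image_set0.
by rewrite image_setU IH ap_segment.
Qed.

Lemma frame_connects env w g walls os l l' P P' : (forall k, env k `<=` slab) ->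
  connects walls os (qsegs l ++ P) (qsegs l' ++ P') ->
  move_in (support (window w g walls))
    (scene (fl w g l) `|` ap (frame w g) @` draw env P)
    (scene (fl w g l') `|` ap (frame w g) @` draw env P').
Proof.
move=> envs /(connectsP envs)/(move_in_ap (det_frame w g)).
rewrite !draw_cat !image_setU !draw_qsegs.
exact/move_in_sub/frame_support.
Qed.

Lemma box_slab w g (A : set sp) p : A `<=` slab -> box w g A p ->
  [/\ g - 3 / 8 <= p.1.1 <= g - 1 / 8, -1/8 <= p.1.2 - p.1.1 + w <= 1/8 & 0 <= p.2 <= 1].
Proof.
move=> As [_ [[[x y] z] /As [/= /andP[? ?] /andP[? ?] z01] <-] <-].
by rewrite /ap /frame /map2r /qbox /q2r /=; split => //; apply/andP; split; lra.
Qed.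

(* The part of the link seen by a subtree, once collapsed to a single box. *)
Definition stub (w al g : R) (top : sp) (A : set sp) : set sp :=
  scene ((top, fp w g (-3#8, 1#8, 0)) ::
         (fp w al (0, -1#8, 0), fp w g (-3#8, -1#8, 0)) ::
         (fp w g (-1#8, 1#8, 0), fp w g (0, 1#8, 0)) ::
         (fp w g (-1#8, -1#8, 0), fp w g (0, -1#8, 0)) :: nil)%qfrac
  `|` box w g A.

Definition node_walls : seq qaff :=
  [:: (1, 0, 0, 3#2); (-1#1, 0, 0, 0); (0, 1, 0, 1); (0, -1#1, 0, 1)]%qfrac.

Definition node_source : seq (qpt * qpt) :=
  [:: ((-11#8, 1#8, 0), (-5#4, 1#2, 0)); ((-5#4, 1#2, 0), (-1#1, 1#2, 1));
      ((-1#1, 1#2, 1), (-3#4, 1#2, 0)); ((-3#4, 1#2, 0), (-1#2, 1#2, 0));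
      ((-1#2, 1#2, 0), (-3#8, 1#8, 0));
      ((-1#1, 1, 0), (-1#1, 1#8, 0)); ((-1#1, 1#8, 0), (-9#8, 1#8, 0));
      ((-3#2, -1#8, 0), (-11#8, -1#8, 0));
      ((-9#8, -1#8, 0), (-1#1, -1#8, 0)); ((-1#1, -1#8, 0), (-3#4, -1#8, 0));
      ((-3#4, -1#8, 0), (-1#2, -1#8, 0)); ((-1#2, -1#8, 0), (-3#8, -1#8, 0));
      ((-1#8, 1#8, 0), (0, 1#8, 0)); ((-1#8, -1#8, 0), (0, -1#8, 0))]%qfrac.

Definition node_target : seq (qpt * qpt) :=
  [:: ((-1#1, 1, 0), (-3#8, 1#8, 0)); ((-3#2, -1#8, 0), (-3#8, -1#8, 0));
      ((-1#8, 1#8, 0), (0, 1#8, 0)); ((-1#8, -1#8, 0), (0, -1#8, 0))]%qfrac.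

(** In the source, the over strand joins the NW corners of the two boxes, while the parent strand
    goes below it to the NE corner of [A]. Slid above [A], this is a positive crossing whose NE end
    leads to the NW corner of [B]. *)
Lemma node_const w g (A B : set sp) : A `<=` slab -> B `<=` slab ->
  move_in (support (window w g node_walls))
    (scene (fl w g node_source) `|` (box w (g - 1) A `|` box w g B))
    (scene (fl w g node_target) `|` box w g (hsum (stack A) B)).
Proof.
move=> As Bs; pose env k := if k is 0%N then A else B.
have envs k : env k `<=` slab by case: k.
have := @frame_connects env w g node_walls node_moves node_source node_target
  [:: Box 0 (1#8, 0, 0, 1#8, -5#4, 0)%qfrac; Box 1 qbox]
  (flat qbox (Sum (tstack (Var 0)) (Var 1))) envs.
rewrite draw_flat -/(box _ _ _) => H.
have -> : box w (g - 1) A `|` box w g B = ap (frame w g) @`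
    draw env [:: Box 0 (1#8, 0, 0, 1#8, -5#4, 0)%qfrac; Box 1 qbox].
  rewrite /= setU0 image_setU; congr setU; rewrite /box !image_comp; congr image.
  apply/funext => -[[x y] z]; rewrite /ap /frame /map2r /qbox /q2r /=.
  by congr (_, _, _); field.
by apply: H; vm_compute.
Qed.

End Frames.

(** * Diagrams whose positions depend on parameters *)

(* Affine forms in nonnegative parameters: the coefficient list starts with the
   constant term. *)
Definition lf := seq Q.

Fixpoint ladd (x y : lf) : lf :=
  match x, y with
  | [::], _ => y
  | _, [::] => x
  | a :: x, b :: y => qadd a b :: ladd x y
  end.
Definition lscale (k : Q) (x : lf) : lf := [seq qmul k a | a <- x].
Definition lopp (x : lf) : lf := lscale (qopp q1) x.
Definition lsub (x y : lf) : lf := ladd x (lopp y).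
Definition lcst (k : Q) : lf := [:: k].

(** Nonnegative coefficients are a sufficient condition because the parameters are nonnegative;
    positions are therefore expressed through their slacks. *)
Definition lge0 (x : lf) : bool := all (qle q0) x.
Definition lgt0 (x : lf) : bool := if x is a :: x then qlt q0 a && lge0 x else false.
Definition leq0 (x : lf) : bool := all (qeq q0) x.
Definition lle (x y : lf) : bool := lge0 (lsub y x).

Definition leqb (x y : lf) : bool := leq0 (lsub y x).

Definition spt := (lf * lf * Q)%type.
Definition saff := (Q * Q * lf * lf)%type.

Definition sev (a : saff) (p : spt) : lf :=
  ladd (ladd (lscale a.1.1.1 p.1.1) (lscale a.1.1.2 p.1.2)) (ladd (lscale p.2 a.1.2) a.2).
Definition sslope (a : saff) (d : spt) : lf :=
  ladd (ladd (lscale a.1.1.1 d.1.1) (lscale a.1.1.2 d.1.2)) (lscale d.2 a.1.2).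
Definition sadd (p d : spt) : spt := (ladd p.1.1 d.1.1, ladd p.1.2 d.1.2, qadd p.2 d.2).
Definition ssub (p d : spt) : spt := (lsub p.1.1 d.1.1, lsub p.1.2 d.1.2, qsub p.2 d.2).
Definition sscale (k : Q) (p : spt) : spt := (lscale k p.1.1, lscale k p.1.2, qmul k p.2).
Definition smid (p q : spt) : spt := sscale (qfrac 1 2) (sadd p q).
Definition spteq (p q : spt) : bool := [&& leqb p.1.1 q.1.1, leqb p.1.2 q.1.2 & qeq p.2 q.2].

Definition sfp (w g : lf) (q : qpt) : spt :=
  (ladd g (lcst q.1.1), ladd (lsub (ladd g (lcst q.1.1)) w) (lcst q.1.2), q.2).

Definition sbox_corners (w g : lf) : seq spt :=
  [seq sfp w g (u.1, u.2, z) | u <- [:: (-3#8, -1#8); (-3#8, 1#8); (-1#8, -1#8); (-1#8, 1#8)],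
                               z <- [:: q0; q1]]%qfrac.

(* Boxes are recorded by their contents and the position of their frame; a zone is
   a list of functionals that are nonnegative on an otherwise unspecified set. *)
Record sscene := SScene { segs : seq (spt * spt); boxes : seq (nat * lf) }.

(* [Shift s d] translates by [d] the points where every functional of [s] is at
   least the associated level, and fixes those where one of them is nonpositive. *)
Inductive smove :=
  | SShift of seq (saff * lf) & spt
  | SMid of nat
  | SUnmid of nat
  | SCut of nat & spt & qpt
  | SJoin of nat & qpt.

Definition core (s : seq (saff * lf)) (p : spt) : bool :=
  all (fun a => lle a.2 (sev a.1 p)) s.
(** For a segment from a fixed end [p] to a core end [q]: one functional grows from 0 at [p] to its
    level at [q], and the others are nonnegative at [p]. It is then the least, after normalisation,
    along the segment. *)
Definition outer (s : seq (saff * lf)) (p q : spt) : bool :=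
  has (fun a => [&& leqb (sev a.1 p) [::], leqb (sev a.1 q) a.2 &
    all (fun b => lge0 (sev b.1 p)) s]) s.
Definition smisses (s : seq (saff * lf)) (l : seq spt) : bool :=
  has (fun a => all (fun p => lge0 (lopp (sev a.1 p))) l) s.

Definition shift_seg (s : seq (saff * lf)) (d : spt) (e : spt * spt) : option (spt * spt) :=
  if smisses s [:: e.1; e.2] then Some e
  else if core s e.1 then
    if core s e.2 then Some (sadd e.1 d, sadd e.2 d)
    else if outer s e.2 e.1 then Some (sadd e.1 d, e.2) else None
  else if core s e.2 && outer s e.1 e.2 then Some (e.1, sadd e.2 d) else None.

(** A box may only slide along the line of crossings, hence equal horizontal and vertical shifts;
    its contents are controlled by its eight corners. *)
Definition shift_box (w : lf) (s : seq (saff * lf)) (d : spt) (b : nat * lf) : option (nat * lf) :=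
  let cs := sbox_corners w b.2 in
  if smisses s cs then Some b
  else if all (core s) cs && leqb d.1.1 d.1.2 && qeq d.2 q0 then Some (b.1, ladd b.2 d.1.1)
  else None.

Fixpoint omapm (T : Type) (f : T -> option T) (l : seq T) : option (seq T) :=
  if l is x :: l then
    if f x is Some y then omap (cons y) (omapm f l) else None
  else Some [::].

(** Some [a + c] is a nonpositive constant, so [a <= 0] wherever [c >= 0]. *)
Definition avoids_zone (s : seq (saff * lf)) (z : seq saff) : bool :=
  has (fun a => has (fun c => [&& qeq (qadd a.1.1.1.1 c.1.1.1) q0, qeq (qadd a.1.1.1.2 c.1.1.2) q0,
    leq0 (ladd a.1.1.2 c.1.2) & lge0 (lopp (ladd a.1.2 c.2))]) z) s.

(* Some functional of the clause [u] dominates one of [s]. *)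
Definition within (s : seq (saff * lf)) (u : seq saff) : bool :=
  has (fun c => has (fun a => [&& qeq a.1.1.1.1 c.1.1.1, qeq a.1.1.1.2 c.1.1.2,
    leqb a.1.1.2 c.1.2 & lle a.1.2 c.2]) s) u.

(* [v] is a nonnegative multiple of the rational vector [u]. *)
Definition along (u : qpt) (v : spt) : bool :=
  let t := if qeq u.1.1 q0 then lscale (qinv u.1.2) v.1.2 else lscale (qinv u.1.1) v.1.1 in
  [&& lge0 t, leqb v.1.1 (lscale u.1.1 t), leqb v.1.2 (lscale u.1.2 t)
    & leqb (lcst v.2) (lscale u.2 t)].

Definition nth_seg (k : nat) (l : seq (spt * spt)) : spt * spt :=
  nth (([::], [::], q0), ([::], [::], q0)) l k.

Definition splice (k n : nat) (new : seq (spt * spt)) (l : seq (spt * spt)) :=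
  take k l ++ new ++ drop (k + n) l.

Definition do_smove (w : lf) (us : seq (seq saff)) (zs : seq (seq saff)) (o : smove)
    (x : sscene) : option sscene :=
  match o with
  | SShift s d =>
      if [&& all (fun a => lgt0 a.2 && lgt0 (ladd a.2 (sslope a.1 d))) s,
          all (within s) us & all (avoids_zone s) zs] then
        if omapm (shift_seg s d) (segs x) is Some l then
          if omapm (shift_box w s d) (boxes x) is Some b then Some (SScene l b) else None
        else None
      else None
  | SMid k => if (k < size (segs x))%N then
      let e := nth_seg k (segs x) in let m := smid e.1 e.2 in
      Some (SScene (splice k 1 [:: (e.1, m); (m, e.2)] (segs x)) (boxes x)) else None
  | SUnmid k => if (k.+1 < size (segs x))%N then
      let e := nth_seg k (segs x) in let f := nth_seg k.+1 (segs x) in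
      let m := smid e.1 f.2 in
      if spteq e.2 m && spteq f.1 m then
        Some (SScene (splice k 2 [:: (e.1, f.2)] (segs x)) (boxes x)) else None else None
  | SCut k c u => if (k < size (segs x))%N then
      let e := nth_seg k (segs x) in
      if along u (ssub c e.1) && along u (ssub e.2 c) then
        Some (SScene (splice k 1 [:: (e.1, c); (c, e.2)] (segs x)) (boxes x)) else None else None
  | SJoin k u => if (k.+1 < size (segs x))%N then
      let e := nth_seg k (segs x) in let f := nth_seg k.+1 (segs x) in
      if [&& spteq e.2 f.1, along u (ssub e.2 e.1) & along u (ssub f.2 e.2)] then
        Some (SScene (splice k 2 [:: (e.1, f.2)] (segs x)) (boxes x)) else None else None
  end.

Definition seg_eq (e f : spt * spt) : bool :=
  (spteq e.1 f.1 && spteq e.2 f.2) || (spteq e.1 f.2 && spteq e.2 f.1).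
Definition box_eq (b c : nat * lf) : bool := (b.1 == c.1) && leqb b.2 c.2.

Definition same_scene (x y : sscene) : bool :=
  [&& all (fun e => has (seg_eq e) (segs y)) (segs x), all (fun e => has (seg_eq e) (segs x)) (segs y),
      all (fun e => has (box_eq e) (boxes y)) (boxes x) & all (fun e => has (box_eq e) (boxes x)) (boxes y)].

Fixpoint sconnects (w : lf) (us zs : seq (seq saff)) (os : seq smove) (x y : sscene) : bool :=
  match os with
  | [::] => same_scene x y
  | o :: os => if do_smove w us zs o x is Some x' then sconnects w us zs os x' y else false
  end.

(* Drag the vertex [c] to [c'] inside the convex region where the functionals are positive. *)
Definition drag (s : seq saff) (c c' : spt) : smove :=
  SShift [seq (a, sev a c) | a <- s] (ssub c' c).
Definition star (s : seq saff) (c c' : spt) : seq smove := [:: drag s c c'].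
Definition bend (k : nat) (s : seq saff) (p q c' : spt) : seq smove :=
  [:: SMid k; drag s (smid p q) c'].
Definition unbend (k : nat) (s : seq saff) (p c q : spt) : seq smove :=
  [:: drag s c (smid p q); SUnmid k].

(** * Soundness of the parametric procedure *)

Section SymbolicSoundness.
Context {R : realType}.
Local Notation sp := (space R).
Variables (env : nat -> set sp) (ps : seq R).
Hypothesis env_slab : forall k, env k `<=` slab.
Hypothesis ps_ge0 : all (fun x => 0 <= x) ps.

Fixpoint lv (x : lf) (v : seq R) : R :=
  match x, v with a :: x, b :: v => q2r a * b + lv x v | _, _ => 0 end.
Definition lval (x : lf) : R := lv x (1 :: ps).

Lemma lv_add x y v : lv (ladd x y) v = lv x v + lv y v.
Proof.
elim: x y v => [|a x IH] [|b y] [|c v] /=; rewrite ?addr0 ?add0r//.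
by rewrite IH q2rD; ring.
Qed.

Lemma lv_scale k x v : lv (lscale k x) v = q2r k * lv x v.
Proof.
elim: x v => [|a x IH] [|c v] /=; rewrite ?mulr0//.
by rewrite IH q2rM; ring.
Qed.

Lemma lvalD x y : lval (ladd x y) = lval x + lval y.
Proof. exact: lv_add. Qed.

Lemma lvalZ k x : lval (lscale k x) = q2r k * lval x.
Proof. exact: lv_scale. Qed.

Lemma lvalN x : lval (lopp x) = - lval x.
Proof. by rewrite lvalZ q2rN /q1 q2r1 mulN1r. Qed.

Lemma lvalB x y : lval (lsub x y) = lval x - lval y.
Proof. by rewrite lvalD lvalN. Qed.

Lemma lval_cst k : lval (lcst k) = q2r k.
Proof. by rewrite /lval /= mulr1 addr0. Qed.

Lemma lv_ge0 x v : all (fun x : R => 0 <= x) v -> lge0 x -> 0 <= lv x v.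
Proof.
elim: x v => [|a x IH] [|b v] //= /andP[b0 v0] /andP[/(@q2r_le R)].
by rewrite /q0 q2r0 => a0 x0; apply: addr_ge0; [exact: mulr_ge0|exact: IH].
Qed.

Lemma lval_ge0 x : lge0 x -> 0 <= lval x.
Proof. by apply: lv_ge0; rewrite /= ler01. Qed.

Lemma lval_gt0 x : lgt0 x -> 0 < lval x.
Proof.
case: x => //= a x /andP[/(@q2r_lt R)]; rewrite /q0 q2r0 => a0 x0.
by rewrite /lval /= mulr1 ltr_wpDr// lv_ge0.
Qed.

Lemma lval_eq0 x : leq0 x -> lval x = 0.
Proof.
rewrite /lval; elim: x (1 :: ps) => [|a x IH] [|b v] //= /andP[/(@q2r_eq R) <- /IH ->].
by rewrite /q0 q2r0 mul0r addr0.
Qed.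

Lemma lval_le x y : lle x y -> lval x <= lval y.
Proof. by move=> /lval_ge0; rewrite lvalB subr_ge0. Qed.

Lemma lval_eq x y : leqb x y -> lval x = lval y.
Proof. by move=> /lval_eq0/eqP; rewrite lvalB subr_eq0 => /eqP. Qed.

Definition spt2r (p : spt) : sp := (lval p.1.1, lval p.1.2, q2r p.2).
Definition saff2r (a : saff) : R * R * R * R :=
  (q2r a.1.1.1, q2r a.1.1.2, lval a.1.2, lval a.2).

Lemma sevE a p : lval (sev a p) = ev (saff2r a) (spt2r p).
Proof. by rewrite /sev !lvalD !lvalZ /ev /=; ring. Qed.

Lemma sslopeE a d : lval (sslope a d) = slope (saff2r a) (spt2r d).
Proof. by rewrite /sslope !lvalD !lvalZ /slope /=; ring. Qed.

Lemma saddE p d : spt2r (sadd p d) = translate (spt2r p) (spt2r d) 1.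
Proof. by rewrite /spt2r /translate /= !lvalD q2rD !mul1r. Qed.

Lemma smidE p q : spt2r (smid p q) = mid (spt2r p) (spt2r q).
Proof.
have h : q2r (qfrac 1 2) = 2^-1 :> R by rewrite /q2r /=; field.
rewrite /spt2r /mid /lerp /= !lvalZ q2rM !lvalD q2rD h.
by congr (_, _, _); field.
Qed.

Lemma ssubE p d : spt2r (ssub p d) = vec (spt2r d) (spt2r p).
Proof. by rewrite /spt2r /vec /= !lvalB q2rB. Qed.

Lemma spteqP p q : spteq p q -> spt2r p = spt2r q.
Proof. by case/and3P => /lval_eq e1 /lval_eq e2 /(@q2r_eq R) e3; rewrite /spt2r e1 e2 e3. Qed.

Lemma sfpE w g q : spt2r (sfp w g q) = fp (lval w) (lval g) q.
Proof.
rewrite /spt2r /fp /ap /pt2r /= !(lvalD, lvalN, lval_cst).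
by congr (_, _, _); ring.
Qed.

Definition seg2r (e : spt * spt) : sp * sp := (spt2r e.1, spt2r e.2).

Variable w : lf.

Definition draw_boxes (l : seq (nat * lf)) : set sp :=
  foldr (fun b X => box (lval w) (lval b.2) (env b.1) `|` X) set0 l.

Definition draw_scene (x : sscene) : set sp := scene (map seg2r (segs x)) `|` draw_boxes (boxes x).

(** A conjunction of disjunctions, since the region allotted to a subtree is not convex. *)
Definition region (us : seq (seq saff)) : set sp :=
  [set p | forall u, List.In u us -> exists2 c, List.In c u & 0 < ev (saff2r c) p].

Definition in_zones (zs : seq (seq saff)) : set sp :=
  [set p | exists2 z, List.In z zs & forall c, List.In c z -> 0 <= ev (saff2r c) p].

Lemma along_spec u v : along u v ->
  exists2 t : R, 0 <= t & spt2r v = (q2r u.1.1 * t, q2r u.1.2 * t, q2r u.2 * t).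
Proof.
rewrite /along; set t := if _ then _ else _; move: t => t.
case/and4P => /lval_ge0 t0 /lval_eq e1 /lval_eq e2 /lval_eq e3; exists (lval t) => //.
by move: e1 e2 e3; rewrite !lvalZ lval_cst /spt2r => -> -> ->.
Qed.

Lemma alongP u p c q : along u (ssub c p) -> along u (ssub q c) ->
  exists2 t, 0 <= t <= 1 & lerp (spt2r p) (spt2r q) t = spt2r c.
Proof.
move=> /along_spec[t1 t10 +] /along_spec[t2 t20 +]; rewrite !ssubE.
move: (spt2r p) (spt2r q) (spt2r c) (q2r u.1.1) (q2r u.1.2) (q2r u.2).
move=> [[x1 y1] z1] [[x2 y2] z2] [[x y] z] a b c0 [a1 a2 a3] [b1 b2 b3].
have [t0|t0] := eqVneq (t1 + t2) 0.
  exists 0; rewrite ?lexx ?ler01// lerp0.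
  have e1 : t1 = 0 by lra.
  by move: a1 a2 a3; rewrite e1 !mulr0 => a1 a2 a3; congr (_, _, _); lra.
have t0' : 0 < t1 + t2 by rewrite lt0r t0 addr_ge0.
exists (t1 / (t1 + t2)).
  apply/andP; split; first by apply: divr_ge0 => //; exact: ltW.
  by rewrite ler_pdivrMr// mul1r lerDl.
have key (x' y' z' k : R) : y' - x' = k * t1 -> z' - y' = k * t2 ->
    x' + t1 / (t1 + t2) * (z' - x') = y'.
  move=> h1 h2; have -> : z' - x' = k * (t1 + t2) by rewrite mulrDr -h1 -h2; ring.
  by rewrite -mulrA [_^-1 * _]mulrC -mulrA divff// mulr1 mulrC -h1; ring.
by rewrite /lerp /=; congr (_, _, _); apply: key; eassumption.
Qed.

Definition level (a : saff * lf) : R * R * R * R :=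
  let k := (lval a.2)^-1 in let b := saff2r a.1 in
  (k * b.1.1.1, k * b.1.1.2, k * b.1.2, k * b.2).

Definition levels (s : seq (saff * lf)) : seq (R * R * R * R) := map level s.

Lemma levelsP s b : b \in levels s -> exists2 a, List.In a s &
  (forall p, ev b p = ev (saff2r a.1) p / lval a.2) /\
  (forall d, slope b d = slope (saff2r a.1) d / lval a.2).
Proof.
elim: s => //= a s IH; rewrite inE => /orP[/eqP ->|/IH[c sc H]]; last by exists c => //; right.
exists a; first by left.
by split=> p; rewrite /level; move: (lval a.2)^-1 => k; rewrite /ev /slope /=; ring.
Qed.

Lemma In_levels s a : List.In a s -> exists2 b, b \in levels s &
  (forall p, ev b p = ev (saff2r a.1) p / lval a.2).
Proof.
elim: s => //= c s IH [->|/IH[b sb H]]; last by exists b => //; rewrite inE sb orbT.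
exists (level a); first exact: mem_head.
by move=> p; rewrite /level; move: (lval a.2)^-1 => k; rewrite /ev /=; ring.
Qed.

Section Shift.
Variables (s : seq (saff * lf)) (d : spt).
Hypothesis lev_gt0 : forall a, List.In a s -> 0 < lval a.2.

Lemma levels_support p : support (levels s) p -> forall a, List.In a s -> 0 < ev (saff2r a.1) p.
Proof.
move=> H a sa; have [b sb e] := In_levels sa.
by have := H _ sb; rewrite e pmulr_lgt0// invr_gt0 lev_gt0.
Qed.

Lemma coreP p : core s p -> active (levels s) one_aff (spt2r p).
Proof.
move=> cp; have e1 q : ev one_aff q = 1 :> R by rewrite /ev /= !mul0r !add0r.
have H a (sa : List.In a s) := allIn cp sa.
split; first by rewrite e1.
move=> b; rewrite inE => /orP[/eqP ->//|/levelsP[a sa [-> _]]].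
by rewrite e1 ler_pdivlMr ?lev_gt0// mul1r -sevE lval_le// H.
Qed.

Lemma outerP p q : outer s p q -> core s q -> exists2 g, g \in levels s &
  [/\ active (levels s) g (spt2r p), active (levels s) g (spt2r q),
      ev g (spt2r p) = 0 & ev g (spt2r q) = 1].
Proof.
case/hasIn => a sa /and3P[/lval_eq p0 /lval_eq q1' pa] /coreP[_ Hq].
have pge b (sb : List.In b s) := allIn pa sb.
have [g sg e] := In_levels sa; exists g => //.
have gp : ev g (spt2r p) = 0 by rewrite e -sevE p0 /lval /= mul0r.
have gq : ev g (spt2r q) = 1 by rewrite e -sevE q1' divff// gt_eqF// lev_gt0.
have e1 r : ev one_aff r = 1 :> R by rewrite /ev /= !mul0r !add0r.
split=> //; split; rewrite ?gp ?gq// => b.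
  rewrite inE => /orP[/eqP ->|/levelsP[c sc [-> _]]]; first by rewrite e1.
  apply: divr_ge0; last exact/ltW/lev_gt0.
  by rewrite -sevE; exact/lval_ge0/pge.
by move=> /Hq; rewrite e1.
Qed.

Lemma smissesP l : smisses s l -> exists2 a, List.In a s &
  forall p, List.In p l -> ev (saff2r a.1) (spt2r p) <= 0.
Proof.
case/hasIn => a sa H; exists a => // p pl; have /lval_ge0 := allIn H pl.
by rewrite lvalN sevE oppr_ge0.
Qed.

Let f := push (levels s) (spt2r d).

Lemma shift_segP e e' : shift_seg s d e = Some e' ->
  f @` segment (spt2r e.1) (spt2r e.2) = segment (spt2r e'.1) (spt2r e'.2).
Proof.
have e1 r : ev one_aff r = 1 :> R by rewrite /ev /= !mul0r !add0r.
have fixes g p q : g \in levels s -> ev g p = 0 -> active (levels s) g p -> f p = p.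
  move=> gs g0 gp; rewrite /f (push_active _ _ gp) ?g0 ?translate0//.
  by rewrite inE gs orbT.
have key p q : outer s p q -> core s q ->
    f @` segment (spt2r p) (spt2r q) = segment (spt2r p) (spt2r (sadd q d)).
  move=> pq cq; have [g gs [gp gq g0 g1]] := outerP pq cq.
  rewrite /f (push_segment _ _ gp gq) ?inE ?gs ?orbT//.
  by rewrite g0 g1 translate0 saddE.
rewrite /shift_seg; case: ifPn => [/smissesP[a sa H] [<-]|_].
  apply: push_avoid => x xs /levels_support/(_ _ sa).
  move: xs => /segmentP[t /andP[t0 t1] <-]; rewrite ev_lerp.
  have h1 := H _ (or_introl erefl); have h2 := H _ (or_intror (or_introl erefl)).
  have u0 : 0 <= 1 - t by rewrite subr_ge0.
  by have := mulr_ge0_le0 u0 h1; have := mulr_ge0_le0 t0 h2; lra.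
case: ifPn => [c1|_].
  case: ifPn => [c2 [<-]|_].
    rewrite /f (push_segment _ (mem_head _ _) (coreP c1) (coreP c2)).
    by rewrite !e1 !saddE.
  by case: ifPn => // o [<-]; rewrite segmentC key// segmentC.
by case: ifPn => // /andP[c2 o] [<-]; rewrite key.
Qed.

Lemma sbox_cornersP g x e z : List.In (x, e) [:: (-3#8, -1#8); (-3#8, 1#8); (-1#8, -1#8); (-1#8, 1#8)]%qfrac ->
  List.In z [:: q0; q1] -> List.In (sfp w g (x, e, z)) (sbox_corners w g).
Proof. by case=> [[<- <-]|[[<- <-]|[[<- <-]|[[<- <-]|[]]]]] [<-|[<-|[]]]; rewrite /sbox_corners /=; tauto. Qed.

Lemma affine_between (lo hi u b k m : R) : lo <= u <= hi ->
  m <= b + k * lo -> m <= b + k * hi -> m <= b + k * u.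
Proof. by move=> /andP[? ?] ? ?; have [k0|k0] := leP 0 k; nra. Qed.

(** An affine functional on a box attains its minimum at a corner; the coordinates are treated one
    at a time by [affine_between]. *)
Lemma box_corner_bound (a : R * R * R * R) m g (A : set sp) p : A `<=` slab ->
  (forall c, List.In c (sbox_corners w g) -> m <= ev a (spt2r c)) ->
  box (lval w) (lval g) A p -> m <= ev a p.
Proof.
move=> As H [_ [[[x y] z] /As [/= /andP[x0 x1] /andP[y0 y1] z01] <-] <-].
have {}H u v k : List.In (u, v) [:: (-3#8, -1#8); (-3#8, 1#8); (-1#8, -1#8); (-1#8, 1#8)]%qfrac ->
    List.In k [:: q0; q1] -> m <= (a.1.1.1 * lval g + a.1.1.2 * (lval g - lval w) + a.2) +
      (a.1.1.1 + a.1.1.2) * q2r u + a.1.1.2 * q2r v + a.1.2 * q2r k.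
  move=> uv kk; have := H _ (sbox_cornersP g uv kk).
  by rewrite sfpE /ev /fp /ap /frame /pt2r /=; congr (_ <= _); ring.
have {}H u v k : u = q2r (-3#8)%qfrac \/ u = q2r (-1#8)%qfrac -> v = q2r (-1#8)%qfrac \/ v = q2r (1#8)%qfrac ->
    k = q2r q0 \/ k = q2r q1 -> m <= (a.1.1.1 * lval g + a.1.1.2 * (lval g - lval w) + a.2) +
      (a.1.1.1 + a.1.1.2) * u + a.1.1.2 * v + a.1.2 * k.
  by move=> [->|->] [->|->] [->|->]; apply: H; rewrite /=; tauto.
have -> : ev a (ap (frame (lval w) (lval g)) (ap (map2r qbox) (x, y, z))) =
    (a.1.1.1 * lval g + a.1.1.2 * (lval g - lval w) + a.2) +
      (a.1.1.1 + a.1.1.2) * (x / 8 - 1 / 4) + a.1.1.2 * (y / 8) + a.1.2 * z.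
  by rewrite /ev /ap /frame /map2r /qbox /q2r /=; field.
move: (a.1.1.1 * lval g + a.1.1.2 * (lval g - lval w) + a.2) (a.1.1.1 + a.1.1.2) H => K P.
move: a.1.1.2 a.1.2 => Q' S H.
have h1 u v : u = q2r (-3#8)%qfrac \/ u = q2r (-1#8)%qfrac ->
    v = q2r (-1#8)%qfrac \/ v = q2r (1#8)%qfrac -> m <= K + P * u + Q' * v + S * z.
  by move=> uu vv; apply: (affine_between z01);
    [rewrite -(@q2r0 R)|rewrite -(@q2r1 R)]; apply: H => //; [left|right].
have h2 u : u = q2r (-3#8)%qfrac \/ u = q2r (-1#8)%qfrac -> m <= K + P * u + Q' * (y / 8) + S * z.
  move=> uu; rewrite addrAC; apply: (@affine_between (q2r (-1#8)%qfrac) (q2r (1#8)%qfrac)).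
  - by rewrite /q2r /=; apply/andP; split; lra.
  - by rewrite addrAC; apply: h1 => //; left.
  - by rewrite addrAC; apply: h1 => //; right.
rewrite -!addrA addrCA addrC addrA; apply: (@affine_between (q2r (-3#8)%qfrac) (q2r (-1#8)%qfrac)).
- by rewrite /q2r /=; apply/andP; split; lra.
- by have := h2 _ (or_introl erefl); lra.
- by have := h2 _ (or_intror erefl); lra.
Qed.

Lemma frame_shift (g k : lf) (A : set sp) :
  box (lval w) (lval (ladd g k)) A = (fun p => translate p (lval k, lval k, 0) 1) @` box (lval w) (lval g) A.
Proof.
rewrite /box !image_comp; congr image; apply/funext => -[[x y] z].
by rewrite /ap /frame /translate /= lvalD; congr (_, _, _); ring.
Qed.

Lemma shift_boxP b b' : shift_box w s d b = Some b' ->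
  f @` box (lval w) (lval b.2) (env b.1) = box (lval w) (lval b'.2) (env b'.1).
Proof.
rewrite /shift_box; case: ifPn => [/smissesP[a sa H] [<-]|_].
  apply: push_avoid => x xs /levels_support/(_ _ sa); apply/negP; rewrite -leNgt -oppr_ge0.
  pose a' : R * R * R * R := (- (saff2r a.1).1.1.1, - (saff2r a.1).1.1.2, - (saff2r a.1).1.2, - (saff2r a.1).2).
  have e p : - ev (saff2r a.1) p = ev a' p by rewrite /ev /a' /=; ring.
  rewrite e; apply: (box_corner_bound (@env_slab b.1) _ xs) => c /H.
  by rewrite -e oppr_ge0.
case: ifPn => // /andP[/andP[cs /lval_eq d12] /(@q2r_eq R) d3] [<-] /=.
rewrite frame_shift; apply: eq_imagel => p bp.
have cp : active (levels s) one_aff p.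
  have e1 q : ev one_aff q = 1 :> R by rewrite /ev /= !mul0r !add0r.
  split; first by rewrite e1.
  move=> c sc; rewrite e1; apply: (box_corner_bound (@env_slab b.1) _ bp) => q qc.
  by have [_ /(_ _ sc)] := coreP (allIn cs qc); rewrite e1.
rewrite /f (push_active _ (mem_head _ _) cp) /spt2r -d12 d3 /q0 q2r0.
by rewrite {1}/ev /= !mul0r !add0r.
Qed.

Lemma within_support us p : all (within s) us -> support (levels s) p -> region us p.
Proof.
move=> H /levels_support sp' u uu; have /hasIn[c cu] := allIn H uu.
case/hasIn => a sa /and4P[/(@q2r_eq R) e1 /(@q2r_eq R) e2 /lval_eq e3 /lval_le e4].
exists c => //; have := sp' _ sa; rewrite /ev /saff2r /= e1 e2 e3; lra.
Qed.

Lemma avoids_zoneP zs p : all (avoids_zone s) zs -> in_zones zs p -> ~ support (levels s) p.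
Proof.
move=> H [z zz pz] /levels_support sp'; have /hasIn[a sa] := allIn H zz.
case/hasIn => c cz /and4P[/(@q2r_eq R) + /(@q2r_eq R) + /lval_eq0 + /lval_ge0].
rewrite /q0 q2r0 !q2rD lvalN !lvalD => e1 e2 e3 e4.
have E : (q2r a.1.1.1.1 + q2r c.1.1.1) * p.1.1 + (q2r a.1.1.1.2 + q2r c.1.1.2) * p.1.2 +
    (lval a.1.1.2 + lval c.1.2) * p.2 = 0 by rewrite e1 e2 e3; ring.
have := sp' _ sa; have := pz _ cz; rewrite /ev /saff2r /= => h1 h2; lra.
Qed.

End Shift.

Lemma omapmP (T : Type) (h : T -> option T) l l' : omapm h l = Some l' ->
  forall (U : Type) (g g' : T -> U), (forall x y, h x = Some y -> g x = g' y) ->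
  map g l = map g' l'.
Proof.
elim: l l' => [|x l IH] l' /=; first by case=> <-.
case E : (h x) => [y|//]; case F : (omapm h l) => [l1|//] [<-] U g g' H /=.
by rewrite (H _ _ E) (IH _ F _ _ _ H).
Qed.

Lemma scene_foldr l : scene (map seg2r l) =
  foldr setU set0 (map (fun e => segment (spt2r e.1) (spt2r e.2)) l).
Proof. by elim: l => //= e l ->. Qed.

Lemma boxes_foldr l : draw_boxes l =
  foldr setU set0 (map (fun b => box (lval w) (lval b.2) (env b.1)) l).
Proof. by elim: l => //= e l ->. Qed.

Lemma image_foldr (f : sp -> sp) (l : seq (set sp)) :
  f @` foldr setU set0 l = foldr setU set0 (map (image ^~ f) l).
Proof. by elim: l => [|X l IH] /=; rewrite ?image_set0// image_setU IH. Qed.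

Lemma splice_scene k n new l : (k < size l)%N ->
  scene (map seg2r new) = scene (map seg2r (take n (drop k l))) ->
  scene (map seg2r (splice k n new l)) = scene (map seg2r l).
Proof.
move=> _ H; rewrite /splice !map_cat !scene_cat H -!scene_cat -!map_cat.
by rewrite addnC -drop_drop cat_take_drop cat_take_drop.
Qed.

Lemma take1_drop k l : (k < size l)%N -> take 1 (drop k l) = [:: nth_seg k l].
Proof.
by move=> kl; rewrite /nth_seg (drop_nth (([::], [::], q0), ([::], [::], q0)) kl) /= take0.
Qed.

Lemma take2_drop k l : (k.+1 < size l)%N ->
  take 2 (drop k l) = [:: nth_seg k l; nth_seg k.+1 l].
Proof.
move=> kl; rewrite /nth_seg (drop_nth (([::], [::], q0), ([::], [::], q0)) (ltnW kl)).
by rewrite (drop_nth (([::], [::], q0), ([::], [::], q0)) kl) /= take0.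
Qed.

Lemma do_smoveP us zs o x x' Z : Z `<=` in_zones zs -> do_smove w us zs o x = Some x' ->
  move_in (region us) (draw_scene x `|` Z) (draw_scene x' `|` Z).
Proof.
move=> Zz; case: o => [s d|k|k|k c u|k u]; rewrite /do_smove.
- case: ifPn => // /and3P[sl su sz].
  case E : omapm => [l|//]; case F : omapm => [b|//] [<-].
  have lev a (sa : List.In a s) : 0 < lval a.2.
    by have /andP[/lval_gt0] := allIn sl sa.
  exists (push (levels s) (spt2r d)).
    have [? ? ? out] : supported_homeo (support (levels s)) (push (levels s) (spt2r d)).
      apply: push_supported => _ /levelsP[a sa [_ ->]].
      have /andP[/lval_gt0 l0 /lval_gt0] := allIn sl sa; rewrite lvalD sslopeE => l1.
      by rewrite -[X in X + _](@divff _ (lval a.2)) ?gt_eqF// -mulrDl divr_gt0.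
    by split=> // p pu; apply: out => /(within_support lev su).
  rewrite /draw_scene !image_setU !scene_foldr !boxes_foldr !image_foldr -!map_comp.
  congr (_ `|` _ `|` _).
  + congr foldr; apply: (omapmP E) => e e'; exact: shift_segP.
  + congr foldr; apply: (omapmP F) => e e'; exact: shift_boxP.
  + apply: push_avoid => p /Zz; exact: (avoids_zoneP lev sz).
- case: ifPn => // kl [<-]; rewrite /draw_scene /= splice_scene//; first exact: move_in_refl.
  by rewrite take1_drop// /= !setU0 smidE -segment_mid.
- case: ifPn => // kl; case: ifPn => // /andP[/spteqP e1 /spteqP e2] [<-].
  rewrite /draw_scene /= splice_scene ?(ltnW kl)//; first exact: move_in_refl.
  by rewrite take2_drop// /= !setU0 e1 e2 smidE -segment_mid.
- case: ifPn => // kl; case: ifPn => // /andP[h1 h2] [<-].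
  rewrite /draw_scene /= splice_scene//; first exact: move_in_refl.
  have [t t01 tc] := alongP h1 h2.
  by rewrite take1_drop// /= !setU0 [RHS](segment_split _ _ t01) tc.
- case: ifPn => // kl; case: ifPn => // /and3P[/spteqP e1 h1 h2] [<-].
  rewrite /draw_scene /= splice_scene ?(ltnW kl)//; first exact: move_in_refl.
  have [t t01 tc] := alongP h1 h2.
  by rewrite take2_drop// /= !setU0 -e1 (segment_split _ _ t01) tc.
Qed.

Lemma seg_eqP e f : seg_eq e f -> segment (spt2r e.1) (spt2r e.2) = segment (spt2r f.1) (spt2r f.2).
Proof. by case/orP => /andP[/spteqP -> /spteqP ->] //; exact: segmentC. Qed.

Lemma InU (T : Type) (g : T -> set sp) l p :
  foldr setU set0 (map g l) p <-> exists2 x, List.In x l & g x p.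
Proof.
elim: l => [|x l IH] /=; first by split=> // -[].
split=> [[xp|/IH[y yl yp]]|[y [<-|yl] yp]].
- by exists x => //; left.
- by exists y => //; right.
- by left.
- by right; apply/IH; exists y.
Qed.

Lemma same_sceneP x y : same_scene x y -> draw_scene x = draw_scene y.
Proof.
case/and4P => h1 h2 h3 h4; rewrite /draw_scene !scene_foldr !boxes_foldr.
have key (T : Type) (r : T -> T -> bool) (g : T -> set sp) l l' :
    (forall a b, r a b -> g a = g b) ->
    all (fun e => has (r e) l') l -> all (fun e => has (r e) l) l' ->
    foldr setU set0 (map g l) = foldr setU set0 (map g l').
  move=> rg H H'; apply/seteqP; split=> p /InU[a al ap]; apply/InU.
    by have /hasIn[b bl /rg e] := allIn H al; exists b; rewrite -?e.
  by have /hasIn[b bl /rg e] := allIn H' al; exists b; rewrite -?e.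
congr setU; first by apply: key h1 h2; exact: seg_eqP.
by apply: key h3 h4 => b c /andP[/eqP -> /lval_eq ->].
Qed.

Theorem sconnectsP us zs os x y Z : Z `<=` in_zones zs -> sconnects w us zs os x y ->
  move_in (region us) (draw_scene x `|` Z) (draw_scene y `|` Z).
Proof.
move=> Zz; elim: os x => [|o os IH] x /=.
  by move=> /same_sceneP ->; exact: move_in_refl.
case E : do_smove => [x'|//] /IH; exact: move_in_trans (do_smoveP Zz E).
Qed.

End SymbolicSoundness.

(** * Collapse of one interior vertex *)

Local Open Scope qfrac_scope.
(** The parameters are [al; a; b; c; d; e]: the left end of the strip, the horizontal distances from
    the root of the left subtree to its first and last leaves, the same two for the right subtree,
    and the number of leaves further right. *)
Definition node_al : lf := [:: 0; 1].
Definition node_be : lf := [:: 1; 1; 1; 1].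
Definition node_ga : lf := [:: 2#1; 1; 1; 1; 1; 1].
Definition node_w : lf := [:: 2#1; 1; 1; 1; 1; 1; 1].
Definition node_xl : lf := [:: 1#2; 1; 1].
Definition node_xr : lf := [:: 3#2; 1; 1; 1; 1].
Definition node_hl : lf := [:: 0; 0; 1; 1].
Definition node_hr : lf := [:: 0; 0; 0; 0; 1; 1].
Definition node_h : lf := [:: 1; 0; 1; 1; 1; 1].

(* [eta] is the sheared coordinate [y - x + w]. *)
Definition x_gt (k : lf) : saff := (1, 0, [::], lopp k).
Definition x_lt (k : lf) : saff := (-1#1, 0, [::], k).
Definition y_lt (k : lf) : saff := (0, -1#1, [::], k).
Definition y_lt_z (k : lf) : saff := (0, -1#1, lcst 1, k).
Definition z_gt0 : saff := (0, 0, lcst 1, [::]).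
Definition eta_gt (w : lf) (k : Q) : saff := (-1#1, 1, [::], lsub w (lcst k)).
Definition eta_lt (w : lf) (k : Q) : saff := (1, -1#1, [::], lsub (lcst k) w).

Definition near_be x y z := sfp node_w node_be (x, y, z).
Definition near_ga x y z := sfp node_w node_ga (x, y, z).

Definition strip_clauses w al ga h := [:: [:: x_gt al]; [:: x_lt ga]; [:: eta_gt w (-1#1)]; [:: y_lt h; y_lt_z h]].
Definition lf_plus (k : Q) (x : lf) := ladd x (lcst k).

Definition gather_src : sscene := SScene
  [:: ((node_xl, node_hl, q0), near_be (-3#8) (1#8) q0); ((node_be, node_h, q1), (node_xl, node_hl, q0)); ((node_be, node_h, q1), (node_xr, node_hr, q0));
   ((node_xr, node_hr, q0), near_ga (-3#8) (1#8) q0);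
   ((node_be, node_h, q0), near_be 0 (1#8) q0); (near_be (-1#8) (1#8) q0, near_be 0 (1#8) q0);
   (sfp node_w node_al (0, -1#8, q0), near_be (-3#8) (-1#8) q0);
   (near_be (-1#8) (-1#8) q0, near_be 0 (-1#8) q0); (near_be 0 (-1#8) q0, near_ga (-3#8) (-1#8) q0);
   (near_ga (-1#8) (1#8) q0, near_ga 0 (1#8) q0); (near_ga (-1#8) (-1#8) q0, near_ga 0 (-1#8) q0)]
  [:: (0%N, node_be); (1%N, node_ga)].

Definition gather_moves : seq smove :=
  star [:: x_gt node_al; x_lt node_be; eta_gt node_w (1#8); y_lt node_h] (node_xl, node_hl, q0) (near_be (-1#4) (1#2) q0) ++
  star [:: x_gt node_be; x_lt node_ga; eta_gt node_w (1#8); y_lt node_h] (node_xr, node_hr, q0) (near_ga (-1#2) (1#2) q0) ++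
  bend 2 [:: x_gt node_be; x_lt (lf_plus (-1#2) node_ga); eta_gt node_w (1#8); y_lt node_h]
    (node_be, node_h, q1) (near_ga (-1#2) (1#2) q0) (near_be (1#4) (1#2) q0) ++
  star [:: z_gt0; y_lt_z node_h; x_gt (lf_plus (-1#4) node_be); x_lt (lf_plus (1#4) node_be); eta_gt node_w (1#4)]
    (node_be, node_h, q1) (near_be 0 (1#2) q1) ++
  [:: SCut 5 (near_be 0 1 q0) (0, -1#1, 0);
      SCut 10 (near_be (1#4) (-1#8) q0) (1, 1, 0);
      SCut 11 (near_ga (-1#2) (-1#8) q0) (1, 1, 0);
      (* The left box and the crossing slide together by [c + d], which takes the frame of the box
         from [be] to [ga - 1]. *)
      SShift [:: (x_gt node_al, lsub (lf_plus (-3#8) node_be) node_al);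
                 (x_lt (lf_plus (-1#2) node_ga), lsub (lf_plus (-3#4) node_ga) node_be);
                 (y_lt node_h, lsub node_h (lsub (lf_plus (1) node_be) node_w));
                 (eta_gt node_w (-1#1), lcst (1#2))] (node_hr, node_hr, q0);
      SCut 8 (near_ga (-3#2) (-1#8) q0) (1, 1, 0)].

Definition slift (w g : lf) (l : seq (qpt * qpt)) : seq (spt * spt) := [seq (sfp w g e.1, sfp w g e.2) | e <- l].

Definition gather_tgt : sscene := SScene
  ((node_be, node_h, q0, near_ga (-1#1) 1 q0) :: (sfp node_w node_al (0, -1#8, q0), near_ga (-3#2) (-1#8) q0) :: slift node_w node_ga node_source)
  [:: (0%N, lf_plus (-1#1) node_ga); (1%N, node_ga)].

Definition straighten_src : sscene := SScene
  [:: (node_be, node_h, q0, near_ga (-1#1) 1 q0); (near_ga (-1#1) 1 q0, near_ga (-3#8) (1#8) q0);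
      (sfp node_w node_al (0, -1#8, q0), near_ga (-3#2) (-1#8) q0); (near_ga (-3#2) (-1#8) q0, near_ga (-3#8) (-1#8) q0);
      (near_ga (-1#8) (1#8) q0, near_ga 0 (1#8) q0); (near_ga (-1#8) (-1#8) q0, near_ga 0 (-1#8) q0)]
  [:: (0%N, node_ga)].
Definition straighten_tgt : sscene := SScene
  [:: (node_be, node_h, q0, near_ga (-3#8) (1#8) q0); (sfp node_w node_al (0, -1#8, q0), near_ga (-3#8) (-1#8) q0);
      (near_ga (-1#8) (1#8) q0, near_ga 0 (1#8) q0); (near_ga (-1#8) (-1#8) q0, near_ga 0 (-1#8) q0)]
  [:: (0%N, node_ga)].
Definition straighten_moves : seq smove := SJoin 2 (1, 1, 0) ::
  unbend 0 [:: x_gt node_al; x_lt node_ga; eta_gt node_w (1#8); y_lt node_h] (node_be, node_h, q0) (near_ga (-1#1) 1 q0) (near_ga (-3#8) (1#8) q0).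
Close Scope qfrac_scope.
Arguments sfp : simpl never.
Arguments lopp : simpl never.
Arguments lsub : simpl never.
Arguments ladd : simpl never.
Arguments lcst : simpl never.
Arguments lscale : simpl never.

Ltac scene_ac := apply/seteqP; split=> ?; rewrite /setU /=; tauto.

Section NodeStep.
Context {R : realType}.
Local Notation sp := (space R).

(** The over strand of the root vertex, at height 1 above [y = h], has to move and so lies inside.
    What arrives from above has to stay: an under strand at [z = 0], or an over strand descending to
    the root with [z <= y - h]. The disjunct [y - h < z] separates them. *)
Definition strip (w al ga h : R) : set sp :=
  [set p | [/\ al < p.1.1, p.1.1 < ga, -1 < p.1.2 - p.1.1 + w & p.1.2 < h \/ p.1.2 - h < p.2]].

Lemma lval_nil (ps : seq R) : lval ps [::] = 0.
Proof. by []. Qed.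

Lemma sliftE (ps : seq R) w g l : scene (map (seg2r ps) (slift w g l)) = scene (fl (lval ps w) (lval ps g) l).
Proof. by elim: l => //= e l ->; rewrite /seg2r !sfpE. Qed.

(** Only the dragging depends on the sizes of the subtrees. It brings the boxes and the crossing
    into a window of fixed shape at [ga], where the certificate behind [node_const] applies. *)
Lemma node_step (al a b c d e : R) be ga w h A B :
  all (fun x => 0 <= x) [:: al; a; b; c; d; e] -> A `<=` slab -> B `<=` slab ->
  be = al + 1 + a + b -> ga = be + 1 + c + d -> w = ga + e -> h = a + b + c + d + 1 ->
  let l : sp := (al + 2^-1 + a, a + b, 0) in
  let r : sp := (be + 2^-1 + c, c + d, 0) in
  move_in (strip w al ga h)
   (scene [:: ((be, h, 1), l); ((be, h, 1), r); ((be, h, 0), fp w be (0, 1#8, 0)%qfrac)] `|`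
    stub w al be l A `|` stub w be ga r B)
   (stub w al ga (be, h, 0) (hsum (stack A) B)).
Proof.
move=> ps0 As Bs beE gaE wE hE l r.
have /and5P[al0 a0 b0 c0 /and3P[d0 e0 _]] := ps0.
pose ps := [:: al; a; b; c; d; e].
pose env1 k := if k is 0%N then A else B.
have env1s k : env1 k `<=` slab by case: k.
pose env2 (_ : nat) := hsum (stack A) B.
have env2s k : env2 k `<=` slab by exact: hsum_slab (stack_slab As) Bs.
have EW : lval ps node_w = w by rewrite wE gaE beE /lval /ps /= /q2r /=; field.
have EA : lval ps node_al = al by rewrite /lval /ps /= /q2r /=; field.
have EB : lval ps node_be = be by rewrite beE /lval /ps /= /q2r /=; field.
have EG : lval ps node_ga = ga by rewrite gaE beE /lval /ps /= /q2r /=; field.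
have EH : lval ps node_h = h by rewrite hE /lval /ps /= /q2r /=; field.
have Z0 : @set0 sp `<=` in_zones ps [::] by [].
have m1 := @sconnectsP R env1 ps env1s ps0 node_w _ _ gather_moves gather_src gather_tgt _ Z0 (erefl : sconnects node_w (strip_clauses node_w node_al node_ga node_h) [::] gather_moves gather_src gather_tgt).
have m2 := @sconnectsP R env2 ps env2s ps0 node_w _ _ straighten_moves straighten_src straighten_tgt _ Z0 (erefl : sconnects node_w (strip_clauses node_w node_al node_ga node_h) [::] straighten_moves straighten_src straighten_tgt).

have SU : region ps (strip_clauses node_w node_al node_ga node_h) `<=` strip w al ga h.
  move=> p H; split.
  - have [u [<-|//]] := H _ (or_introl erefl).
    by rewrite /ev /= lvalN EA lval_nil /q2r /=; lra.
  - have [u [<-|//]] := H _ (or_intror (or_introl erefl)).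
    by rewrite /ev /= EG lval_nil /q2r /=; lra.
  - have [u [<-|//]] := H _ (or_intror (or_intror (or_introl erefl))).
    by rewrite /ev /= lvalB EW lval_cst lval_nil /q2r /=; lra.
  - have [u [<-|[<-|//]]] := H _ (or_intror (or_intror (or_intror (or_introl erefl)))).
      by rewrite /ev /= EH ?lval_nil /q2r /=; left; lra.
    by rewrite /ev /= EH lval_cst ?lval_nil /q2r /=; right; lra.
have EL : spt2r ps (node_xl, node_hl, q0) = l.
  by rewrite /spt2r /l /lval /ps /= /q2r /=; congr (_, _, _); field.
have ER : spt2r ps (node_xr, node_hr, q0) = r.
  by rewrite /spt2r /r beE /lval /ps /= /q2r /=; congr (_, _, _); field.
have EV0 : spt2r ps (node_be, node_h, q0) = (be, h, 0) by rewrite /spt2r /= EB EH /q2r /=; congr (_, _, _); field.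
have EV1 : spt2r ps (node_be, node_h, q1) = (be, h, 1) by rewrite /spt2r /= EB EH /q2r /=; congr (_, _, _); field.
(* The two strands that lead into the window from outside, at rest during [node_const]. *)
pose Z := scene [:: ((be, h, 0), fp w ga (-1#1, 1, 0)%qfrac);
  (fp w al (0, -1#8, 0)%qfrac, fp w ga (-3#2, -1#8, 0)%qfrac)].
have Zout : forall p, Z p -> ~ support (window w ga node_walls) p.
  apply: avoids_scene => /=; split; last split=> //.
    right; right; right; left; rewrite /ev /fp /ap /= /q2r /=; split; rewrite ?hE ?wE ?gaE ?beE; lra.
  left; rewrite /ev /fp /ap /= /q2r /=; split; rewrite ?hE ?wE ?gaE ?beE; lra.
have m3 := move_inU Zout (@node_const R w ga A B As Bs).
apply: (@move_in_trans _ (draw_scene env1 ps node_w gather_src)).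
  rewrite (_ : _ `|` _ `|` _ = draw_scene env1 ps node_w gather_src); first exact: move_in_refl.
  rewrite /draw_scene /= /seg2r /= !sfpE EL ER EV0 EV1 EW EA EB EG /stub.
  by rewrite /q0; scene_ac.
rewrite !setU0 in m1 m2.
apply: move_in_trans (move_in_sub SU m1) _.
have SN : support (window w ga node_walls) `<=` strip w al ga h.
  move=> p /support_cons[h1 /support_cons[h2 /support_cons[h3 /support_cons[h4 _]]]].
  move: h1 h2 h3 h4; rewrite /ev /fa /= /q2r /= hE wE gaE beE => h1 h2 h3 h4.
  by clear -h1 h2 h3 h4 a0 b0 c0 d0 e0; split; [lra|lra|lra|left; lra].
have T1 : draw_scene env1 ps node_w gather_tgt =
    scene (fl w ga node_source) `|` (box w (ga - 1) A `|` box w ga B) `|` Z.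
  rewrite /draw_scene (_ : segs gather_tgt = [:: (node_be, node_h, q0, near_ga (-1#1) 1 q0);
     (sfp node_w node_al (0, -1#8, q0), near_ga (-3#2) (-1#8) q0)] ++ slift node_w node_ga node_source)%qfrac//.
  rewrite map_cat scene_cat sliftE EW EG /Z; set X := scene (fl _ _ _).
  rewrite /seg2r /= !sfpE EV0 EW EA EG lvalD EG lval_cst.
  have -> : ga + q2r (-1#1)%qfrac = ga - 1 by rewrite /q2r /=; field.
  by rewrite /q0; scene_ac.
rewrite T1; apply: move_in_trans (move_in_sub SN m3) _.

have -> : scene (fl w ga node_target) `|` box w ga (hsum (stack A) B) `|` Z = draw_scene env2 ps node_w straighten_src.
  rewrite /draw_scene /Z /seg2r /fl /= !sfpE EV0 EW EA EG.
  by rewrite /q0; scene_ac.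
have -> : stub w al ga (be, h, 0) (hsum (stack A) B) = draw_scene env2 ps node_w straighten_tgt.
  rewrite /stub /draw_scene /Z /seg2r /fl /= !sfpE EV0 EW EA EG.
  by rewrite /q0; scene_ac.
exact: move_in_sub SU m2.
Qed.
End NodeStep.

(** * Collapse of a whole tree *)

Section Spread.
Context {R : realType}.
Local Notation sp := (space R).

Lemma segment_between (lo hi : R) (p q x : sp) : lo <= p.1.1 <= hi -> lo <= q.1.1 <= hi ->
  segment p q x -> lo <= x.1.1 <= hi.
Proof.
move=> /andP[p1 p2] /andP[q1 q2] /segmentP[t /andP[t0 t1] <-] /=.
by apply/andP; split; nra.
Qed.

Lemma nleaves_gt0 T : (0 < nleaves T)%N.
Proof. by elim: T => //= l lh r rh; rewrite addn_gt0 lh. Qed.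

(** [c] and [d] are the distances of the vertex from the verticals through its first and last
    leaves, the slacks used as parameters in the symbolic checks. *)
Lemma vertex_params a T : exists c d : R, [/\ 0 <= c, 0 <= d, (vertex a T).1 = a%:R + 2^-1 + 2^-1 + c,
  (vertex a T).2 = c + d & (nleaves T)%:R = c + d + 1 :> R].
Proof.
case: T => [|l r] /=.
  by exists 0, 0; split; rewrite ?addr0 ?add0r// -addn1 natrD; field.
have := nleaves_gt0 l; have := nleaves_gt0 r.
rewrite -!(ltr_nat R) => hr hl.
have hl' : 1 <= (nleaves l)%:R :> R by rewrite ler1n nleaves_gt0.
have hr' : 1 <= (nleaves r)%:R :> R by rewrite ler1n nleaves_gt0.
exists ((nleaves l)%:R - 2^-1), ((nleaves r)%:R - 2^-1).
have e : ((nleaves l + nleaves r).-1)%:R = (nleaves l)%:R + (nleaves r)%:R - 1 :> R.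
  by rewrite -subn1 natrB ?natrD// addn_gt0 nleaves_gt0.
by rewrite e !natrD; split; lra.
Qed.

Lemma vertex_between a T : a%:R + 2^-1 <= (vertex a T : R * R).1 <= (a + nleaves T)%:R + 2^-1.
Proof.
have [c [d [c0 d0 -> _ e]]] := vertex_params a T.
by rewrite natrD e; apply/andP; split; lra.
Qed.

(* The upper tangle below the root of [T], made disjoint from the crossings of the vine,
   which appear as boxes, the last one containing [B]. *)
Fixpoint spread (w : R) (a : nat) (T : btree) (B : set sp) : set sp :=
  match T with
  | Leaf => stub w (a%:R + 2^-1) (a.+1%:R + 2^-1) (vertex a T, 0) B
  | Node l r =>
      let v := vertex a T in
      let b := (a + nleaves l)%N in
      scene [:: ((v, 1), (vertex a l, 0)); ((v, 1), (vertex b r, 0));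
                ((v, 0), fp w (b%:R + 2^-1) (0, 1#8, 0)%qfrac)]
      `|` spread w a l (crossing false) `|` spread w b r B
  end.

Lemma stub_between w al ga top (A : set sp) : A `<=` slab -> al + 1 <= ga ->
  al <= top.1.1 <= ga -> stub w al ga top A `<=` [set x | al <= x.1.1 <= ga].
Proof.
move=> As alga htop p; rewrite /stub; case; last first.
  by move=> /(box_slab As)[/andP[? ?] _ _] /=; apply/andP; split; lra.
rewrite /scene /=; case=> [|[|[|[|//]]]]; apply: segment_between => //;
  rewrite /fp /ap /= /q2r /=; apply/andP; split; lra.
Qed.

Lemma spread_between w a T (B : set sp) : B `<=` slab ->
  spread w a T B `<=` [set x | a%:R + 2^-1 <= x.1.1 <= (a + nleaves T)%:R + 2^-1].
Proof.
elim: T a B => [|l IHl r IHr] a B Bs.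
  rewrite [spread _ _ _ _]/= [nleaves _]/= addn1; apply: stub_between => //=.
    by rewrite -[a.+1]addn1 natrD; lra.
  by rewrite -[a.+1]addn1 natrD; apply/andP; split; lra.
have vl := vertex_between a l; have vr := vertex_between (a + nleaves l) r.
have n1 : 0 <= (nleaves l)%:R :> R by rewrite ler0n.
have n2 : 0 <= (nleaves r)%:R :> R by rewrite ler0n.
move=> p; rewrite [spread _ _ _ _]/= [nleaves (Node l r)]/=; rewrite !natrD in vl vr *.
case=> [[[|[|[|//]]]|/IHl]|/IHr].
- apply: segment_between => //=; move/andP: vl => [? ?]; apply/andP; split; lra.
- apply: segment_between => //=; move/andP: vr => [? ?]; apply/andP; split; lra.
- apply: segment_between => //=; rewrite /q2r /=; apply/andP; split; lra.
- move=> /(_ (@crossing_slab _ _))/=; rewrite natrD => /andP[? ?]; apply/andP; split; lra.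
- by move=> /(_ Bs)/=; rewrite !natrD => /andP[? ?]; apply/andP; split; lra.
Qed.

Lemma strip_sub (w al ga h al' ga' h' : R) : al' <= al -> ga <= ga' -> h <= h' ->
  strip w al ga h `<=` strip w al' ga' h'.
Proof.
move=> h1 h2 h3 p [p1 p2 p3 p4]; split; [lra|lra|lra|].
by case: p4 => p4; [left|right]; lra.
Qed.

(* Along the segment from [(v, 1)] to a lower vertex [(u, 0)], the height over [u] is at least [z]. *)
Lemma over_avoids_strip (w al ga h : R) (v u : R * R) : u.2 + 1 <= v.2 -> u.2 = h ->
  forall p, segment (v, 1) (u, 0) p -> ~ strip w al ga h p.
Proof.
move=> uv <- p /segmentP[t /andP[t0 t1] <-] /= [_ _ _]; rewrite /lerp /=.
by move=> [H|H]; nra.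
Qed.

Lemma out_of_strip w (al ga h : R) (X : set sp) (lo hi : R) : X `<=` [set x | lo <= x.1.1 <= hi] ->
  hi <= al \/ ga <= lo -> forall p, X p -> ~ strip w al ga h p.
Proof. by move=> Xs ho p /Xs /= /andP[? ?] [? ? _ _]; case: ho; lra. Qed.

(** Both subtrees are collapsed before their root. Their strips lie on either side of the vertical
    line through the root, and the over strands of the root stay outside because they are high
    enough above the subtrees. *)
Theorem spread_move n a T (B : set sp) : (a + nleaves T <= n)%N -> B `<=` slab ->
  let w := n%:R + 2^-1 in let al := a%:R + 2^-1 in let ga := (a + nleaves T)%:R + 2^-1 in
  move_in (strip w al ga (vertex a T).2) (spread w a T B) (stub w al ga (vertex a T, 0) (fill T B)).
Proof.
elim: T a B => [|l IHl r IHr] a B aT Bs w al ga.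
  by rewrite /ga addn1; exact: move_in_refl.
set b := (a + nleaves l)%N; pose be : R := b%:R + 2^-1.
have al0 : 0 <= a%:R :> R by [].
have [a1 [b1 [a10 b10 xlE hlE nlE]]] := vertex_params a l.
have [c1 [d1 [c10 d10 xrE hrE nrE]]] := vertex_params b r.
have hE : (vertex a (Node l r)).2 = a1 + b1 + c1 + d1 + 1 :> R.
  by rewrite /= -subn1 natrB ?addn_gt0 ?nleaves_gt0// natrD nlE nrE; ring.
have beE : be = al + 1 + a1 + b1 by rewrite /be /b /al natrD nlE; ring.
have gaE : ga = be + 1 + c1 + d1 by rewrite /ga /= addnA natrD nrE -/b /be; ring.
have wE : w = ga + (n - (a + nleaves (Node l r)))%:R.
  by rewrite /w /ga natrB//; ring.
have blr : (b + nleaves r <= n)%N by rewrite /b -addnA.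
have ble : (b <= n)%N by apply: leq_trans blr; exact: leq_addr.
have lv : (vertex a l).2 + 1 <= (vertex a (Node l r)).2 :> R by rewrite hlE hE; lra.
have rv : (vertex b r).2 + 1 <= (vertex a (Node l r)).2 :> R by rewrite hrE hE; lra.
have gabr : (b + nleaves r)%:R + 2^-1 = ga by rewrite /ga /= addnA.
have Ml := IHl a (crossing false) ble (@crossing_slab _ _); have Mr := IHr b B blr Bs.
rewrite gabr -/be -/w -/al -/b in Ml Mr.
pose over := scene [:: ((vertex a (Node l r), 1), (vertex a l, 0)); ((vertex a (Node l r), 1), (vertex b r, 0));
                ((vertex a (Node l r), 0), fp w be (0, 1#8, 0)%qfrac)]%R.
have -> : spread w a (Node l r) B = spread w a l (crossing false) `|` (over `|` spread w b r B).
  by rewrite /= -/b -/be -/w /over /= !setUA [_ `|` spread w a l _]setUC -!setUA.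
have vlb := vertex_between a l; have vrb := vertex_between b r; rewrite gabr -/be -/al -/b in vlb vrb.
have Zl p : (over `|` spread w b r B) p -> ~ strip w al be (vertex a l).2 p.
  case; last first.
    apply: out_of_strip; first exact: spread_between.
    by right.
  case=> [|[|[|//]]].
  - exact: over_avoids_strip.
  - apply: (@out_of_strip _ _ _ _ _ be ga); last by right.
    by move=> q; apply: segment_between; rewrite //= -/b -/be lexx; lra.
  - apply: (@out_of_strip _ _ _ _ _ be ga); last by right.
    by move=> q; apply: segment_between; rewrite //= ?/q2r /= -/b -/be; apply/andP; split; lra.
apply: (@move_in_trans _ (stub w al be (vertex a l, 0) (fill l (crossing false)) `|` (over `|` spread w b r B))).
  by apply: move_in_sub (move_inU Zl Ml); apply: strip_sub; lra.
set L := stub _ _ _ _ (fill l _).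
have Lslab : (fill l (crossing false) : set sp) `<=` slab by apply: fill_slab; exact: crossing_slab.
have Zr p : (over `|` L) p -> ~ strip w be ga (vertex b r).2 p.
  case; last first.
    apply: (@out_of_strip _ _ _ _ _ al be); last by left.
    by apply: stub_between => //=; lra.
  case=> [|[|[|//]]].
  - apply: (@out_of_strip _ _ _ _ _ al be); last by left.
    by move=> q; apply: segment_between => //=; rewrite -/b -/be lexx; lra.
  - exact: over_avoids_strip.
  - apply: (@out_of_strip _ _ _ _ _ al be); last by left.
    by move=> q; apply: segment_between; rewrite //= ?/q2r /= -/b -/be; apply/andP; split; lra.
apply: (@move_in_trans _ (stub w be ga (vertex b r, 0) (fill r B) `|` (over `|` L))).
  rewrite [L `|` _]setUC -setUA [over `|` (_ `|` L)]setUCA.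
  by apply: move_in_sub (move_inU Zr Mr); apply: strip_sub; lra.
have hE' : (vertex a (Node l r)).2 = a1 + b1 + c1 + d1 + 1 :> R by rewrite hE; ring.
have ps0 : all (fun x : R => 0 <= x) [:: al; a1; b1; c1; d1; (n - (a + nleaves (Node l r)))%:R].
  by rewrite /= ?ler0n a10 b10 c10 d10 /al !andbT addr_ge0// ?invr_ge0 ler0n.
have := node_step ps0 Lslab (@fill_slab _ r _ Bs) beE gaE wE hE'; cbv zeta.
have -> : (al + 2^-1 + a1, a1 + b1, 0) = (vertex a l, 0) :> sp.
  by rewrite -hlE -xlE; case: (vertex a l).
have -> : (be + 2^-1 + c1, c1 + d1, 0) = (vertex b r, 0) :> sp.
  by rewrite -hrE -xrE; case: (vertex b r).
move=> N; rewrite [_ `|` (over `|` L)]setUC; exact: N.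
Qed.
End Spread.

(** * The crossings of the right vine become boxes *)

Local Open Scope qfrac_scope.
Definition step_al : lf := [:: 0; 1].
Definition step_be : lf := [:: 1; 1].
Definition step_w : lf := [:: 2#1; 1; 1].
Definition step_leaf : spt := ([:: 1#2; 1], [::], 0).
Definition step_pt x y z := sfp step_w step_be (x, y, z).

Definition step_src : sscene := SScene
  [:: (step_pt 0 0 1, step_leaf); (step_pt 0 0 1, step_pt 1 0 0);
      (step_pt 0 0 0, (step_be, [::], 0));
      (step_pt (-1#1) (-1#8) 0, step_pt 0 0 0)] [::].
Definition step_tgt : sscene := SScene
  [:: (step_leaf, step_pt (-3#8) (1#8) 0); (step_pt 0 (1#4) 0, (step_be, [::], 0));
      (step_pt (-1#1) (-1#8) 0, step_pt 0 0 0);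
      (step_pt (-3#8) (1#8) 0, step_pt 0 0 1); (step_pt 0 0 1, step_pt 1 0 0);
      (step_pt 0 0 0, step_pt 0 (1#4) 0)] [::].
Definition step_moves : seq smove :=
  SCut 2 (step_pt 0 (1#4) 0) (0, 1, 0) ::
  bend 0 [:: x_gt (lf_plus (-1#2) step_be); x_lt step_be; eta_gt step_w 0; y_lt [::]]
    step_leaf (step_pt 0 0 1) (step_pt (-3#8) (1#8) 0).
Definition step_us := [:: [:: x_gt step_al]; [:: y_lt [::]]].
Definition rest_zone := [:: x_gt (lf_plus (1#2) step_be)].

Close Scope qfrac_scope.

(** The two slanted upper walls pass through the points [(-3/8, 1/8)], [(0, 1/4)] and [(1, 0)] at
    which strands leave the picture. *)
Definition vine_walls : seq qaff :=
  [:: (1, 0, 0, 1); (0, 1, 0, 1); (1#3, -1#1, 0, 1#4); (-1#4, -1#1, 0, 1#4);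
      (-1#1, 0, 0, 1)]%qfrac.

Definition vine_source : seq (qpt * qpt) :=
  [:: ((-1#1, -1#8, 0), (0, 0, 0)); ((-3#8, 1#8, 0), (0, 0, 1));
      ((0, 0, 1), (1, 0, 0)); ((0, 0, 0), (0, 1#4, 0))]%qfrac.

Definition vine_target : seq (qpt * qpt) :=
  [:: ((-1#1, -1#8, 0), (-3#8, -1#8, 0)); ((-1#8, 1#8, 0), (0, 1#8, 0));
      ((0, 1#8, 0), (0, 1#4, 0)); ((-1#8, -1#8, 0), (0, -1#8, 0));
      ((0, -1#8, 0), (1, 0, 0))]%qfrac.

Section Vine.
Context {R : realType}.
Local Notation sp := (space R).

(** At a crossing of the vine the over strand runs from the leaf on the upper left to the next
    crossing on the lower right; this is why the crossing is negative. *)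
Lemma vine_const w g :
  move_in (support (window w g vine_walls) : set sp)
    (scene (fl w g vine_source))
    (scene (fl w g vine_target) `|` box w g (crossing false)).
Proof.
have envs k : (fun _ : nat => @set0 sp) k `<=` slab by [].
have H : connects vine_walls vine_moves (qsegs vine_source ++ [::]) (qsegs vine_target ++ flat qbox (Cross false)).
  by vm_compute.
have := frame_connects w g envs H.
by rewrite draw_flat [draw _ [::]]/= image_set0 setU0.
Qed.

Lemma move_in_eq (U X Y : set sp) : X = Y -> move_in U X Y.
Proof. by move=> ->; exact: move_in_refl. Qed.

Lemma vertical_split (x y1 y z : R) (q : sp) : q.1.1 = x -> q.2 = z -> q.1.2 <= y <= y1 ->
  segment (x, y1, z) q = segment (x, y1, z) (x, y, z) `|` segment (x, y, z) q.
Proof.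
case: q => -[_ y2] _ /= -> -> /andP[h1 h2].
have [e|ne] := eqVneq y1 y2.
  have -> : y = y1 by lra.
  rewrite -e setUid//.
have h : y1 - y2 != 0 by rewrite subr_eq0.
have h0 : 0 < y1 - y2 by rewrite lt0r h subr_ge0 (le_trans h1).
have t01 : 0 <= (y1 - y) / (y1 - y2) <= 1.
  by rewrite divr_ge0 ?subr_ge0 ?(le_trans h1)//= ler_pdivrMr// mul1r; lra.
rewrite (segment_split _ _ t01); congr (segment _ _ `|` segment _ _);
  by rewrite /lerp /=; congr (_, _, _); [ring|field|ring].
Qed.

(* [Z] is the part of the vine to the right of the crossing. *)
Lemma vine_step (al e : R) be w (Z : set sp) : 0 <= al -> 0 <= e -> be = al + 1 -> w = be + 1 + e ->
  (forall p, Z p -> [/\ be + 2^-1 <= p.1.1, 0 <= p.1.2 - p.1.1 + w & be + 1 <= p.1.2 + w]) ->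
  let leaf : sp := (al + 2^-1, 0, 0) in
  move_in [set p : sp | al < p.1.1 /\ p.1.2 < 0]
    (scene [:: (fp w al (0, -1#8, 0)%qfrac, fp w be (0, 0, 0)%qfrac);
       (fp w be (0, 0, 1)%qfrac, leaf);
       (fp w be (0, 0, 1)%qfrac, fp w (be + 1) (0, 0, 0)%qfrac);
       (fp w be (0, 0, 0)%qfrac, (be, 0, 0))] `|` Z)
    (stub w al be leaf (crossing false) `|` segment (be, 0, 0) (fp w be (0, 1#8, 0)%qfrac) `|`
     (segment (fp w be (0, -1#8, 0)%qfrac) (fp w (be + 1) (0, 0, 0)%qfrac) `|` Z)).
Proof.
move=> al0 e0 beE wE Zb leaf.
pose ps := [:: al; e].
have ps0 : all (fun x => 0 <= x) ps by rewrite /= al0 e0.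
pose env (_ : nat) := @set0 sp.
have envs k : env k `<=` slab by [].
have EW : lval ps step_w = w by rewrite wE beE /lval /ps /= /q2r /=; field.
have EA : lval ps step_al = al by rewrite /lval /ps /= /q2r /=; field.
have EB : lval ps step_be = be by rewrite beE /lval /ps /= /q2r /=; field.
have EL : spt2r ps step_leaf = leaf.
  by rewrite /spt2r /leaf /lval /ps /= /q2r /=; congr (_, _, _); field.
have EP : spt2r ps (step_be, [::], 0%qfrac) = (be, 0, 0) by rewrite /spt2r /= EB lval_nil /q2r /=; congr (_, _, _); field.
have Zz : Z `<=` in_zones ps [:: rest_zone].
  move=> p /Zb[h1 _ _]; exists rest_zone; first by left.
  move=> u [<-|//]; rewrite /ev /= lvalN lvalD EB lval_cst lval_nil /q2r /=; lra.
have m1 := sconnectsP envs ps0 Zz (erefl : sconnects step_w step_us [:: rest_zone] step_moves step_src step_tgt).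
have SU : region ps step_us `<=` [set p : sp | al < p.1.1 /\ p.1.2 < 0].
  move=> p H; split.
  - have [u [<-|//]] := H _ (or_introl erefl).
    by rewrite /ev /= lvalN EA lval_nil /q2r /=; lra.
  - have [u [<-|//]] := H _ (or_intror (or_introl erefl)).
    by rewrite /ev /= lval_nil /q2r /=; lra.
have E1 : fp w (be + 1) (0, 0, 0)%qfrac = fp w be (1, 0, 0)%qfrac :> sp.
  by rewrite /fp /ap /= /q2r /=; congr (_, _, _); field.
have E2 : fp w al (0, -1#8, 0)%qfrac = fp w be (-1#1, -1#8, 0)%qfrac :> sp.
  by rewrite beE /fp /ap /= /q2r /=; congr (_, _, _); field.
pose Z' := scene [:: (leaf, fp w be (-3#8, 1#8, 0)%qfrac); (fp w be (0, 1#4, 0)%qfrac, (be, 0, 0))] `|` Z.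
have Zout p : Z' p -> ~ support (window w be vine_walls) p.
  have WE : window w be vine_walls = [:: fa w be (1, 0, 0, 1); fa w be (0, 1, 0, 1);
      fa w be (3^-1, -1, 0, 4^-1); fa w be (- 4^-1, -1, 0, 4^-1); fa w be (-1, 0, 0, 1)].
    by rewrite /window /aff2r /q2r /=; congr [:: fa _ _ (_, _, _, _); fa _ _ (_, _, _, _);
      fa _ _ (_, _, _, _); fa _ _ (_, _, _, _); fa _ _ (_, _, _, _)]; field.
  rewrite WE; case=> [|/Zb[h1 h2 h3]]; last first.
    move=> /support_cons[_ /support_cons[_ /support_cons[h4 /support_cons[h5 _]]]].
    by move: h4 h5; rewrite /ev /fa /= /q2r /=; lra.
  apply: avoids_scene => /=; split; last split=> //.
    by right; right; left; rewrite /leaf /ev /fp /ap /fa /= /q2r /=; split; lra.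
  by right; right; left; rewrite /leaf /ev /fp /ap /fa /= /q2r /=; split; lra.
have m2 := move_inU Zout (vine_const w be).
have SN : support (window w be vine_walls) `<=` [set p : sp | al < p.1.1 /\ p.1.2 < 0].
  move=> p /support_cons[h1 /support_cons[_ /support_cons[_ /support_cons[h4 /support_cons[h5 _]]]]].
  by move: h1 h4 h5; rewrite /ev /fa /= /q2r /= => h1 h4 h5; split; lra.
rewrite E1 E2; apply: (@move_in_trans _ (draw_scene env ps step_w step_src `|` Z)).
  rewrite (_ : scene _ = draw_scene env ps step_w step_src); first exact: move_in_refl.
  rewrite /draw_scene /= /seg2r /= !sfpE EL EP EW EB.
  scene_ac.
apply: move_in_trans (move_in_sub SU m1) _.
have -> : draw_scene env ps step_w step_tgt `|` Z = scene (fl w be vine_source) `|` Z'.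
  rewrite /Z' /draw_scene /fl /= /seg2r /= !sfpE EL EP EW EB.
  scene_ac.
apply: move_in_trans (move_in_sub SN m2) _.
apply: move_in_eq.
(* The vertical strand is cut where it enters the window of the crossing, at sheared height 1/4. *)
rewrite (@vertical_split be 0 (4^-1 + be - w) 0 (fp w be (0, 1#8, 0)%qfrac)); first last.
- by rewrite /fp /ap /= /q2r /= wE; lra.
- by rewrite /fp /ap /= /q2r /=; field.
- by rewrite /fp /ap /= /q2r /=; field.
have -> : (be, 4^-1 + be - w, 0) = fp w be (0, 1#4, 0)%qfrac :> sp.
  by rewrite /fp /ap /= /q2r /=; congr (_, _, _); field.
rewrite /Z' /stub E2 [segment (be, 0, 0) _]segmentC [segment (fp w be (0, 1#4, 0)%qfrac) (fp w be _)]segmentC /=.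
scene_ac.
Qed.

Definition cross w (a : nat) z : sp := fp w (a%:R + 2^-1) (0, 0, z)%qfrac.
Definition leaf_pt (a : nat) : sp := (a%:R, 0, 0).
Definition foot (a : nat) : sp := (a%:R + 2^-1, 0, 0).

(* The crossings [a + 1, ..., a + k] of the vine, with its last edge pulled to the line of crossings. *)
Fixpoint vine_rest (w : R) (a k : nat) : set sp :=
  match k with
  | 0%N => segment (cross w a.+1 q0) (leaf_pt a.+1)
  | k.+1 => scene [:: (cross w a.+1 q1, leaf_pt a.+1); (cross w a.+1 q1, cross w a.+2 q0);
                 (cross w a.+1 q0, foot a.+1)] `|` vine_rest w a.+1 k
  end.

Fixpoint vine_units (w : R) (a k : nat) : set sp :=
  match k with
  | 0%N => segment (fp w (a%:R + 2^-1) (0, -1#8, 0)%qfrac) (cross w a.+1 q0) `|`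
           segment (cross w a.+1 q0) (leaf_pt a.+1)
  | k.+1 => stub w (a%:R + 2^-1) (a.+1%:R + 2^-1) (leaf_pt a.+1) (crossing false) `|`
            segment (foot a.+1) (fp w (a.+1%:R + 2^-1) (0, 1#8, 0)%qfrac) `|` vine_units w a.+1 k
  end.

Lemma segment_above (k : R) (a : R * R * R * R) (p q x : sp) : k <= ev a p -> k <= ev a q ->
  segment p q x -> k <= ev a x.
Proof.
by move=> hp hq /segmentP[t /andP[t0 t1] <-]; rewrite ev_lerp; nra.
Qed.

(** A convex zone around the vine from the next crossing on; by convexity, membership of a segment
    is checked at its ends. *)
Definition vine_zone (w al : R) : set sp :=
  [set p | [/\ al + 2^-1 <= p.1.1, 0 <= p.1.2 - p.1.1 + w & al + 1 <= p.1.2 + w]].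

Lemma zone_segment w al p q : vine_zone w al p -> vine_zone w al q ->
  segment p q `<=` vine_zone w al.
Proof.
move=> [p1 p2 p3] [q1 q2 q3] x xpq.
have h1 := @segment_above (al + 2^-1) (1, 0, 0, 0) _ _ _ _ _ xpq.
have h2 := @segment_above 0 (-1, 1, 0, w) _ _ _ _ _ xpq.
have h3 := @segment_above (al + 1) (0, 1, 0, w) _ _ _ _ _ xpq.
by move: h1 h2 h3; rewrite /ev /= => h1 h2 h3; split; [have := h1|have := h2|have := h3]; lra.
Qed.

Lemma zone_cross w al (b : nat) z : al + 1 <= b%:R + 2^-1 -> vine_zone w al (cross w b z).
Proof. by move=> h; rewrite /vine_zone /cross /fp /ap /= /q2r /=; split; lra. Qed.

Lemma vine_rest_zone n a k : n = (a + k)%N.+1 ->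
  vine_rest (n%:R + 2^-1) a k `<=` vine_zone (n%:R + 2^-1) (a%:R + 2^-1).
Proof.
have S1 m : m.+1%:R = m%:R + 1 :> R by rewrite -addn1 natrD.
elim: k a => [|k IH] a nE.
  apply: zone_segment; first by apply: zone_cross; rewrite (S1 a); lra.
  by rewrite nE addn0 /vine_zone /leaf_pt /= (S1 a); split; lra.
have k0 : 0 <= k%:R :> R by [].
have zl : vine_zone (n%:R + 2^-1) (a%:R + 2^-1) (leaf_pt a.+1).
  by rewrite nE /vine_zone /leaf_pt /= (S1 a) (S1 (a + _)%N) natrD (S1 k); split; lra.
move=> p /= [[|[|[|//]]]|].
- by apply: zone_segment => //; apply: zone_cross; rewrite (S1 a); lra.
- by apply: zone_segment; apply: zone_cross; rewrite ?(S1 a.+1) (S1 a); lra.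
- apply: zone_segment; first by apply: zone_cross; rewrite (S1 a); lra.
  by rewrite nE /vine_zone /foot /= (S1 a) (S1 (a + _)%N) natrD (S1 k); split; lra.
move/(IH a.+1); rewrite addSnnS => /(_ nE); rewrite /vine_zone /= (S1 a) => -[h1 h2 h3].
by split; lra.
Qed.

(** The crossings are treated from left to right: the strand leaving a new box at its SE corner is
    the one that enters the next crossing. *)
Lemma vine_move n a k : n = (a + k)%N.+1 -> let w := n%:R + 2^-1 in
  move_in [set p : sp | a%:R + 2^-1 < p.1.1 /\ p.1.2 < 0]
    (segment (fp w (a%:R + 2^-1) (0, -1#8, 0)%qfrac) (cross w a.+1 q0) `|` vine_rest w a k)
    (vine_units w a k).
Proof.
have S1 m : m.+1%:R = m%:R + 1 :> R by rewrite -addn1 natrD.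
elim: k a => [|k IH] a nE w; first exact: move_in_refl.
have nE' : n = (a.+1 + k)%N.+1 by rewrite addSnnS.
set al : R := a%:R + 2^-1; set be : R := a.+1%:R + 2^-1.
have beE : be = al + 1 by rewrite /be (S1 a) /al; ring.
have wE : w = be + 1 + k%:R by rewrite /w nE /be (S1 a) (S1 (a + _)%N) natrD (S1 k); ring.
have cE : be + 1 = a.+2%:R + 2^-1 by rewrite /be (S1 a.+1) (S1 a); ring.
have Zb p : vine_rest w a.+1 k p -> [/\ be + 2^-1 <= p.1.1, 0 <= p.1.2 - p.1.1 + w & be + 1 <= p.1.2 + w].
  exact: vine_rest_zone.
have al0 : 0 <= al by rewrite /al addr_ge0// invr_ge0.
have lE : (al + 2^-1, 0, 0) = leaf_pt a.+1 :> sp by rewrite /leaf_pt /al (S1 a); congr (_, _, _); lra.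
have := vine_step al0 (ler0n _ k) beE wE Zb; rewrite /= lE cE => M1.
have Zout p : (stub w al be (leaf_pt a.+1) (crossing false) `|`
    segment (foot a.+1) (fp w be (0, 1#8, 0)%qfrac)) p -> ~ [set p : sp | be < p.1.1 /\ p.1.2 < 0] p.
  move=> H [h _]; have : p.1.1 <= be; last lra.
  case: H => [/stub_between|] H.
    suff /andP[] : al <= p.1.1 <= be by [].
    by apply: H => //=; [exact: crossing_slab|lra|rewrite /al /be (S1 a); lra].
  suff /andP[] : be <= p.1.1 <= be by [].
  by apply: segment_between H; rewrite /foot /fp /= ?/q2r /= -/be; apply/andP; split; lra.
have M2 := move_inU Zout (IH _ nE'); rewrite -/be -/w in M2.
have US : [set p : sp | be < p.1.1 /\ p.1.2 < 0] `<=` [set p : sp | al < p.1.1 /\ p.1.2 < 0].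
  by move=> p [h1 h2]; split=> //; lra.
apply: (move_in_trans (move_in_eq _ _) (move_in_trans M1 (move_in_trans (move_in_eq _ _)
  (move_in_trans (move_in_sub US M2) (move_in_eq _ _))))).
- by rewrite /= /cross /q0 /q1 -/al -/be; scene_ac.
- by rewrite setUC.
- by rewrite /= setUC.
Qed.

End Vine.

(** * Symbolic moves of the outer strands *)

Local Open Scope qfrac_scope.
(** The two parameters are the numbers of leaves of the subtrees of the root, each minus one. *)
Definition top_n : lf := [:: 2#1; 1; 1].
Definition top_v : lf := [:: 3#2; 1].
Definition top_h : lf := [:: 1; 1; 1].
Definition top_w : lf := [:: 5#2; 1; 1].
Definition top_k : lf := [:: 3#1; 1; 1].
Definition lhalf : lf := lcst (1#2).
Definition top_pt x y z := sfp top_w top_w (x, y, z).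
Definition pt_v : spt := (top_v, top_h, 0).
Definition pt_g : spt := sfp top_w lhalf (0, -1#8, 0).
Definition pt_leaf : spt := (top_n, [::], 0).
Definition pt0 : spt := (top_v, top_n, 0).
Definition pt1 : spt := ([::], top_n, 0).
Definition pt2 : spt := ([::], lopp top_n, 0).
Definition pt3 : spt := (lcst (3#2), lopp top_n, 0).
Definition pt0' : spt := (top_k, top_n, -1#1).
Definition pt1' : spt := (top_k, top_h, -2#1).
Definition pt2' : spt := top_pt (1#2) (-2#1) (-3#1).
Definition pt2'' : spt := sfp top_w [::] (0, -2#1, 0).
Definition first_cross : spt := sfp top_w (lcst (3#2)) (0, 0, 0).
Definition prev_cross : spt := sfp top_w (lf_plus (-1#1) top_w) (0, 0, 1).
Definition last_cross : spt := top_pt 0 0 0.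
Definition pt_m := top_pt (-3#16) 0 0.
Definition pt_e1 := top_pt (1#4) (1#4) 0.
Definition pt_e2 := top_pt (1#4) (-1#4) 0.

Definition y_gt (k : lf) : saff := (0, 1, [::], lopp k).
Definition z_lt0 : saff := (0, 0, lcst (-1#1), [::]).

Definition zone_T := [:: y_gt [::]; eta_gt top_w (1#2)].
Definition zone_V := [:: x_lt (lf_plus (-1#2) top_n); y_gt (lopp top_h)].

Definition stage1_src := SScene [:: (pt_v, pt0); (pt0, pt1); (pt1, pt2); (pt3, pt2); (first_cross, pt3); (prev_cross, pt_leaf)] [::].
Definition stage1_tgt := SScene [:: (pt_v, pt0); (pt0, pt1); (pt1, pt2); (pt2, pt_g); (pt_g, first_cross);
   (prev_cross, last_cross); (last_cross, pt_leaf)] [::].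
Definition stage1_moves :=
  bend 5 [:: x_gt (lf_plus (-1#2) top_n); eta_lt top_w (1#2)] prev_cross pt_leaf last_cross ++
  star [:: x_gt [::]; y_lt (lopp top_h)] pt3 pt_g.

(** The rest of the link has [x >= 1/2] and [z >= 0], so it lies on one side of the two planes
    through the line [x = 1/2, z = 0] given by the first two functionals. *)
Definition zone_Q : seq saff := [:: (1, 0, top_w, lcst (-1#2)); (2#1, 0, top_w, lcst (-1#1));
  x_lt (lf_plus (-5#16) top_w); y_lt top_h; eta_gt top_w (-1#8)].
Definition stage2_tgt := SScene [:: (pt_v, pt0'); (pt0', pt1'); (pt1', pt_e1); (pt_e1, pt_m); (pt_m, pt_e2);
  (pt_e2, pt2'); (pt2', pt2''); (pt2'', pt_g)] [::].
Definition stage2_src := SScene [:: (pt_v, pt0); (pt0, pt1); (pt1, pt2); (pt2, pt_g)] [::].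
(** The outer arc, on the left of the diagram, is swung behind it, at negative heights, to its
    right. The bends at [pt_m], [pt_e1] and [pt_e2] then bring part of it to the last box, as the
    future right arc of [V]. *)
Definition stage2_moves :=
  star [:: y_gt top_h; x_gt [::]] pt0 pt0' ++
  star [:: (-1#1, 0, lopp top_w, lhalf); y_gt (lopp top_n)] pt1 pt1' ++
  star [:: (-2#1, 0, lopp top_w, lcst 1)] pt2 pt2' ++
  bend 3 [:: eta_lt top_w (-1#8); x_lt top_k] pt2' pt_g pt2'' ++
  bend 2 [:: x_gt (lf_plus (-1#4) top_w); y_lt top_h; eta_gt top_w (-2#1)] pt1' pt2' pt_m ++
  bend 2 [:: x_gt (lf_plus (-3#16) top_w); y_lt top_h; eta_gt top_w 0] pt1' pt_m pt_e1 ++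
  bend 4 [:: x_gt (lf_plus (-3#16) top_w); eta_lt top_w 0; eta_gt top_w (-2#1)] pt_m pt2' pt_e2.

Definition closing_source : seq (qpt * qpt) :=
  [:: ((-3#8, 1#8, 0), (-1#4, 1, -1#1)); ((-1#4, 1, -1#1), (1#4, 1#4, 0));
      ((1#4, 1#4, 0), (0, 1#8, 0)); ((0, 1#8, 0), (-1#8, 1#8, 0));
      ((-3#8, -1#8, 0), (-1#2, -1#2, 0)); ((-1#2, -1#2, 0), (-3#8, -1#1, -1#1));
      ((-3#8, -1#1, -1#1), (1#4, -1#4, 0)); ((1#4, -1#4, 0), (0, -1#8, 0));
      ((0, -1#8, 0), (-1#8, -1#8, 0))]%qfrac.

Definition corner_nw := top_pt (-3#8) (1#8) 0.
Definition corner_ne := top_pt (-1#8) (1#8) 0.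
Definition corner_sw := top_pt (-3#8) (-1#8) 0.
Definition corner_se := top_pt (-1#8) (-1#8) 0.
Definition pt_ne := top_pt 0 (1#8) 0.
Definition pt_se := top_pt 0 (-1#8) 0.
Definition pt_a := top_pt (-1#4) 1 (-1#1).
Definition pt_b := top_pt (-3#8) (-1#1) (-1#1).
Definition pt_c := top_pt (-1#2) (-1#2) 0.
Definition stage3_src := SScene [:: (corner_nw, pt_v); (pt_v, pt0'); (pt0', pt1'); (pt1', pt_e1);
  (pt_e1, pt_ne); (pt_ne, corner_ne); (corner_se, pt_se); (pt_se, pt_e2);
  (pt_e2, pt2'); (pt2', pt2''); (pt2'', pt_g); (pt_g, corner_sw)] [:: (0%N, top_w)].
Definition stage3_tgt := SScene (slift top_w top_w closing_source) [:: (0%N, top_w)].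
(** The segments of [stage3_src] grouped as in [stub]; [stage3_src] follows the strands, so that
    neighbours in the list can be merged. *)
Definition stage3_stub := SScene [:: (pt_v, corner_nw); (pt_g, corner_sw); (corner_ne, pt_ne); (corner_se, pt_se);
  (pt_v, pt0'); (pt0', pt1'); (pt1', pt_e1); (pt_e1, pt_ne); (pt_se, pt_e2);
  (pt_e2, pt2'); (pt2', pt2''); (pt2'', pt_g)] [:: (0%N, top_w)].
Definition stage3_moves :=
  unbend 2 [:: (0, -1#1, lcst (-1#1), top_h); z_lt0; eta_gt top_w (1#8)] pt0' pt1' pt_e1 ++
  star [:: z_lt0; eta_gt top_w (1#8)] pt0' pt_a ++
  unbend 0 [:: x_lt (lf_plus (-1#4) top_w); eta_gt top_w (1#8)] corner_nw pt_v pt_a ++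
  star [:: z_lt0; eta_lt top_w (-1#8)] pt2' pt_b ++
  unbend 7 [:: eta_lt top_w (-1#8); x_lt (lf_plus (-3#8) top_w)] pt_b pt2'' pt_g ++
  star [:: x_lt (lf_plus (-3#8) top_w)] pt_g pt_c.

Lemma stage1_connects : sconnects top_w [::] [:: zone_T; zone_V] stage1_moves stage1_src stage1_tgt.
Proof. by vm_compute. Qed.

Lemma stage2_connects : sconnects top_w [::] [:: zone_Q] stage2_moves stage2_src stage2_tgt.
Proof. by vm_compute. Qed.

Lemma stage3_connects : sconnects top_w [::] [::] stage3_moves stage3_src stage3_tgt.
Proof. by vm_compute. Qed.

Close Scope qfrac_scope.

Definition left_arc_walls : seq qaff :=
  [:: (1, 0, 0, 1); (0, 1, 0, 1); (0, -1#1, 0, 1#2); (-1#1, 0, 0, 1#4)]%qfrac.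

Definition left_arc_source : seq (qpt * qpt) :=
  [:: ((-1#1, -1#8, 0), (0, 0, 0)); ((0, 0, 0), (-1#2, 1#2, 0))]%qfrac.

Definition left_arc_target : seq (qpt * qpt) :=
  [:: ((-1#1, -1#8, 0), (-3#8, -1#8, 0)); ((-3#8, -1#8, 0), (-5#16, 0, 0));
      ((-5#16, 0, 0), (-3#8, 1#8, 0)); ((-1#2, 1#2, 0), (-3#8, 1#8, 0))]%qfrac.

Definition right_arc_walls : seq qaff :=
  [:: (1, 0, 0, 1#4); (-1#1, 0, 0, 1#4); (0, 1, 0, 1#4); (0, -1#1, 0, 1#4)]%qfrac.

Definition right_arc_source : seq (qpt * qpt) :=
  [:: ((1#4, 1#4, 0), (-3#16, 0, 0)); ((-3#16, 0, 0), (1#4, -1#4, 0))]%qfrac.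

Definition right_arc_target : seq (qpt * qpt) :=
  [:: ((1#4, 1#4, 0), (0, 1#8, 0)); ((-1#8, 1#8, 0), (0, 1#8, 0));
      ((-3#16, 0, 0), (-1#8, 1#8, 0)); ((-1#8, -1#8, 0), (-3#16, 0, 0));
      ((-1#8, -1#8, 0), (0, -1#8, 0)); ((0, -1#8, 0), (1#4, -1#4, 0))]%qfrac.

(** * Formation of the vertical arcs, and normalisation of the closure *)

Section TopMoves.
Context {R : realType}.
Local Notation sp := (space R).

Lemma const_move w g walls moves l l' : connects walls moves (qsegs l ++ [::]) (qsegs l' ++ [::]) ->
  move_in (support (window w g walls) : set sp) (scene (fl w g l)) (scene (fl w g l')).
Proof.
have envs k : (fun _ : nat => @set0 sp) k `<=` slab by [].
by move/(frame_connects w g envs); rewrite [draw _ [::]]/= image_set0 !setU0.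
Qed.

(** With [right_arc_move] this creates [V] at the last leaf: its left arc is a bend of the strand
    that ends at this leaf, its right arc a bend of the outer arc. *)
Lemma left_arc_move w g : move_in (support (window w g left_arc_walls) : set sp)
  (scene (fl w g left_arc_source)) (scene (fl w g left_arc_target)).
Proof. by apply: (@const_move _ _ _ left_arc_moves); vm_compute. Qed.

Lemma right_arc_move w g : move_in (support (window w g right_arc_walls) : set sp)
  (scene (fl w g right_arc_source)) (scene (fl w g right_arc_target)).
Proof. by apply: (@const_move _ _ _ right_arc_moves); vm_compute. Qed.

Lemma closing_move w g (A : set sp) : A `<=` slab ->
  move_in setT (scene (fl w g closing_source) `|` box w g A)
    (ap (frame w g) @` (ap (map2r qbox) @` closed_up A)).
Proof.
move=> As; have envs k : (fun _ : nat => A) k `<=` slab by [].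
have H : connects [::] closure_moves (qsegs closing_source ++ [:: Box 0 qbox])
    (qsegs [::] ++ (flat qbox (Var 0) ++ place qbox qclosure_segs)) by vm_compute.
have := frame_connects w g envs H; rewrite draw_closure [draw _ [:: _]]/= setU0 set0U.
move=> M; apply: (move_in_sub _ M) => p _; exact: I.
Qed.

Lemma segment_avoids (s : seq (saff * lf)) (ps : seq R) (l : seq (spt * spt)) :
  all (fun x => 0 <= x) ps -> all (fun e => smisses s [:: e.1; e.2]) l ->
  forall p, scene (map (seg2r ps) l) p -> exists2 a, List.In a s & ev (saff2r ps a.1) p <= 0.
Proof.
move=> ps0; elim: l => //= e l IH /andP[/(smissesP ps0)[a sa H] /IH hl] p [|/hl //].
move=> /segmentP[t /andP[t0 t1] <-]; exists a => //; rewrite ev_lerp.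
have h1 := H _ (or_introl erefl); have h2 := H _ (or_intror (or_introl erefl)).
have u0 : 0 <= 1 - t by rewrite subr_ge0.
by have := mulr_ge0_le0 u0 h1; have := mulr_ge0_le0 t0 h2; lra.
Qed.

Lemma zone_scene (z : seq saff) (ps : seq R) (l : seq (spt * spt)) :
  all (fun x => 0 <= x) ps ->
  all (fun e => all (fun c => lge0 (sev c e.1) && lge0 (sev c e.2)) z) l ->
  forall p, scene (map (seg2r ps) l) p -> forall c, List.In c z -> 0 <= ev (saff2r ps c) p.
Proof.
move=> ps0; elim: l => //= e l IH /andP[H /IH hl] p [|/hl //] xp c cz.
have /andP[/(lval_ge0 ps0) + /(lval_ge0 ps0)] := allIn H cz; rewrite !sevE => h1 h2.
exact: segment_above h1 h2 xp.
Qed.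

(** On a set where [a] stays between 0 and 1, the push with the single functional [a] is an affine
    map. Shears, dilations and translations of bounded sets are obtained in this way. *)
Lemma affine_move (a : R * R * R * R) (d : sp) X : 0 < 1 + slope a d ->
  (forall p, X p -> 0 <= ev a p <= 1) ->
  move_in setT X ((fun p => translate p d (ev a p)) @` X).
Proof.
move=> ad Xa; exists (push [:: a] d).
  have [? ? ? _] : supported_homeo (support [:: a]) (push [:: a] d).
    by apply: push_supported => b; rewrite inE => /eqP ->.
  by split=> // p /(_ I).
apply: eq_imagel => p /Xa /andP[h0 h1]; have e1 : ev one_aff p = 1 by rewrite /ev /= !mul0r !add0r.
rewrite (@push_active _ _ _ a)//; first by rewrite !inE eqxx orbT.
by split=> // b; rewrite !inE => /orP[/eqP ->|/eqP ->]; rewrite ?e1.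
Qed.

Lemma closed_up_bound A : A `<=` slab -> forall p : sp, closed_up A p ->
  -1 <= p.1.1 <= 1 /\ -2 <= p.1.2 <= 2.
Proof.
have H (p q x : sp) : -1 <= p.1.1 <= 1 -> -1 <= q.1.1 <= 1 -> -2 <= p.1.2 <= 2 ->
    -2 <= q.1.2 <= 2 -> segment p q x -> -1 <= x.1.1 <= 1 /\ -2 <= x.1.2 <= 2.
  move=> p1 q1 /andP[p2 p3] /andP[q2 q3] xpq; split; first exact: segment_between xpq.
  move: xpq => /segmentP[t /andP[t0 t1] <-] /=; apply/andP; split; nra.
move=> As p [[[[/As[h1 /andP[h2 h3] _]|]|]|]|].
  by split=> //; apply/andP; split; lra.
all: by apply: H; rewrite /at_height /=; apply/andP; split; lra.
Qed.

Lemma rescale_move w (A : set sp) : A `<=` slab ->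
  move_in setT (closed_up A) (ap (frame w w) @` (ap (map2r qbox) @` closed_up A)).
Proof.
move=> As; have Xb := closed_up_bound As.
(* The target map is [(x, y) -> (x/8 - 1/4 + w, (x + y)/8 - 1/4)]. It is factored into a shear, a
   contraction by 8 of each coordinate and a translation; the functionals are scaled to [[0, 1]] on
   the successive bounding boxes. *)
pose f1 (p : sp) := translate p (0, 2, 0) (ev (2^-1, 0, 0, 2^-1) p).
pose f2 (p : sp) := translate p (-7/4, 0, 0) (ev (2^-1, 0, 0, 2^-1) p).
pose f3 (p : sp) := translate p (0, -21/4, 0) (ev (0, 6^-1, 0, 3^-1) p).
pose f4 (p : sp) := translate p (5/8 + w, 11/8 + 0, 0) (ev one_aff p).
have m1 : move_in setT (closed_up A) (f1 @` closed_up A).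
  apply: affine_move; first by rewrite /slope /=; lra.
  by move=> p /Xb[/andP[h1 h2] /andP[h3 h4]]; rewrite /ev /=; apply/andP; split; lra.
have m2 : move_in setT (f1 @` closed_up A) (f2 @` (f1 @` closed_up A)).
  apply: affine_move; first by rewrite /slope /=; lra.
  move=> _ [p /Xb[/andP[h1 h2] /andP[h3 h4]] <-]; rewrite /ev /f1 /ev /translate /=.
  by apply/andP; split; lra.
have m3 : move_in setT (f2 @` (f1 @` closed_up A)) (f3 @` (f2 @` (f1 @` closed_up A))).
  apply: affine_move; first by rewrite /slope /=; lra.
  move=> _ [_ [p /Xb[/andP[h1 h2] /andP[h3 h4]] <-] <-]; rewrite /ev /f1 /f2 /ev /translate /=.
  by apply/andP; split; lra.
have m4 : move_in setT (f3 @` (f2 @` (f1 @` closed_up A))) (f4 @` (f3 @` (f2 @` (f1 @` closed_up A)))).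
  apply: affine_move; first by rewrite /slope /=; lra.
  by move=> p _; rewrite /ev /one_aff /=; apply/andP; split; lra.
apply: move_in_trans m1 _; apply: move_in_trans m2 _; apply: move_in_trans m3 _.
apply: move_in_trans m4 _; apply: move_in_eq; rewrite !image_comp; congr image.
have e1 : f1 = fun p => (p.1.1, p.1.1 + p.1.2 + 1, p.2).
  by apply/funext => p; rewrite /f1 /translate /ev /=; congr (_, _, _); field.
have e2 : f2 = fun p => (p.1.1 / 8 - 7/8, p.1.2, p.2).
  by apply/funext => p; rewrite /f2 /translate /ev /=; congr (_, _, _); field.
have e3 : f3 = fun p => (p.1.1, p.1.2 / 8 - 7/4, p.2).
  by apply/funext => p; rewrite /f3 /translate /ev /=; congr (_, _, _); field.
have e4 : f4 = fun p => (p.1.1 + 5/8 + w, p.1.2 + 11/8, p.2).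
  by apply/funext => p; rewrite /f4 /translate /ev /=; congr (_, _, _); field.
apply/funext => -[[x y] z]; rewrite e1 e2 e3 e4 /ap /frame /map2r /qbox /= /q2r /=.
by congr (_, _, _); field.
Qed.

End TopMoves.

(** * The lower tangle and the collapsed picture in terms of tree and vine *)

Section Decompose.
Context {R : realType}.
Local Notation sp := (space R).

Lemma natrS m : m.+1%:R = m%:R + 1 :> R.
Proof. by rewrite -addn1 natrD. Qed.

Fixpoint vine_body (w : R) (a k : nat) : set sp :=
  match k with
  | 0%N => scene [:: (cross w a.+1 q1, leaf_pt a.+1); (cross w a.+1 q0, foot a.+1)]
  | k.+1 => scene [:: (cross w a.+1 q1, leaf_pt a.+1); (cross w a.+1 q1, cross w a.+2 q0);
                 (cross w a.+1 q0, foot a.+1)] `|` vine_body w a.+1 k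
  end.

Fixpoint vine_heads (w : R) (a k : nat) : set sp :=
  match k with
  | 0%N => set0
  | k.+1 => stub w (a%:R + 2^-1) (a.+1%:R + 2^-1) (leaf_pt a.+1) (crossing false) `|`
            segment (foot a.+1) (fp w (a.+1%:R + 2^-1) (0, 1#8, 0)%qfrac) `|` vine_heads w a.+1 k
  end.

Lemma vine_restE w a k : vine_rest w a k.+1 = vine_body w a k `|`
  (segment (cross w (a + k).+1 q1) (cross w (a + k).+2 q0) `|`
   segment (cross w (a + k).+2 q0) (leaf_pt (a + k).+2)).
Proof.
elim: k a => [|k IH] a; first by rewrite /= addn0; scene_ac.
rewrite [LHS]/= -/(vine_rest w a.+1 k.+1) IH addSnnS [vine_body _ _ _.+1]/=.
by rewrite !setUA.
Qed.

Lemma vine_unitsE w a k : vine_units w a k = vine_heads w a k `|`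
  (segment (fp w ((a + k)%:R + 2^-1) (0, -1#8, 0)%qfrac) (cross w (a + k).+1 q0) `|`
   segment (cross w (a + k).+1 q0) (leaf_pt (a + k).+1)).
Proof.
elim: k a => [|k IH] a; first by rewrite /= addn0 set0U.
by rewrite /= IH addSnnS !setUA.
Qed.

Lemma vine_headsS w a k : vine_heads w a k.+1 =
  stub w (a%:R + 2^-1) (a.+1%:R + 2^-1) (leaf_pt a.+1) (crossing false) `|`
  segment (foot a.+1) (fp w (a.+1%:R + 2^-1) (0, 1#8, 0)%qfrac) `|` vine_heads w a.+1 k.
Proof. by []. Qed.

Lemma vine_headsD w a j k : vine_heads w a (j.+1 + k) = vine_heads w a j `|`
  (stub w ((a + j)%:R + 2^-1) ((a + j).+1%:R + 2^-1) (leaf_pt (a + j).+1) (crossing false) `|`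
   segment (foot (a + j).+1) (fp w ((a + j).+1%:R + 2^-1) (0, 1#8, 0)%qfrac)) `|`
  vine_heads w (a + j.+1) k.
Proof.
elim: j a => [|j IH] a; first by rewrite /= addn0 addn1 set0U.
by rewrite addSn 2!vine_headsS IH !addSnnS !setUA.
Qed.

Lemma nleaves_vine k : nleaves (right_vine k) = k.+1.
Proof. by elim: k => //= k ->. Qed.

Definition mirror : R * R * R * R * R * R := (1, 0, 0, -1, 0, 0).

Lemma mirrorE (X : set sp) : [set (q.1.1, - q.1.2, q.2) | q in X] = ap mirror @` X.
Proof. by congr image; apply/funext => q; rewrite /ap /=; congr (_, _, _); ring. Qed.

(** Along a right vine the height drops by one as the abscissa grows by one; after reflection all
    crossings lie on [y = x - w] with [w = n + 1/2]. *)
Lemma mirror_vertex n a k : n = (a + k).+2 ->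
  ap mirror (vertex a (right_vine k.+1), 0) = cross (n%:R + 2^-1) a.+1 q0 /\
  ap mirror (vertex a (right_vine k.+1), 1) = cross (n%:R + 2^-1) a.+1 q1.
Proof.
move=> ->; rewrite /= nleaves_vine /cross /fp /ap /mirror /= /q2r /= addn1.
rewrite (natrS (a + k).+1) (natrS (a + k)) natrD (natrS a) (natrS k).
by split; congr (_, _, _); field.
Qed.

Lemma mirror_leaf a : ap mirror (a%:R, 0, 0) = leaf_pt a.
Proof. by rewrite /ap /mirror /leaf_pt /=; congr (_, _, _); ring. Qed.

Lemma mirror_foot a : ap mirror (a%:R + 2^-1, 0, 0) = foot a.
Proof. by rewrite /ap /mirror /foot /=; congr (_, _, _); ring. Qed.

Lemma lower_vineE n a k : n = (a + k).+2 ->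
  ap mirror @` below_root a (right_vine k.+1) = vine_body (n%:R + 2^-1) a k `|`
  segment (cross (n%:R + 2^-1) (a + k).+1 q1) (leaf_pt (a + k).+2).
Proof.
elim: k a => [|k IH] a nE.
  have [e0 e1] := mirror_vertex nE.
  have -> : below_root a (right_vine 1) = segment (vertex a (right_vine 1), 1) (leaf_pt a.+1)
     `|` segment (vertex a (right_vine 1), 1) (leaf_pt a.+2)
     `|` segment (vertex a (right_vine 1), 0) (foot a.+1) :> set sp.
    by rewrite /= !setU0 addn1.
  rewrite !image_setU !ap_segment e0 e1 !mirror_leaf mirror_foot addn0 [vine_body _ _ _]/=.
  scene_ac.
have nE' : n = (a.+1 + k).+2 by rewrite addSnnS.
have [e0 e1] := mirror_vertex nE; have [e0' _] := mirror_vertex nE'.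
have -> : below_root a (right_vine k.+2) = segment (vertex a (right_vine k.+2), 1) (leaf_pt a.+1)
   `|` segment (vertex a (right_vine k.+2), 1) (vertex a.+1 (right_vine k.+1), 0)
   `|` segment (vertex a (right_vine k.+2), 0) (foot a.+1) `|` below_root a.+1 (right_vine k.+1) :> set sp.
  by rewrite /= setU0 addn1.
rewrite image_setU (IH _ nE') !image_setU !ap_segment e0 e1 e0' mirror_leaf mirror_foot addSnnS.
by rewrite [vine_body _ _ _.+1]/=; scene_ac.
Qed.

Lemma vertex_le a T : (vertex a T).1 <= (a + nleaves T)%:R :> R.
Proof.
case: T => [|l r] /=; first by rewrite addn1.
rewrite addnA [X in _ <= X]natrD.
have : 1 <= (nleaves r)%:R :> R by rewrite ler1n nleaves_gt0.
lra.
Qed.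

Lemma below_root_bound a T p : below_root a T p ->
  [/\ a%:R + 2^-1 <= p.1.1 <= (a + nleaves T)%:R, 0 <= p.1.2 <= (vertex a T).2 & (0 : R) <= p.2].
Proof.
have segb (x1 x2 h : R) (p0 q x : sp) : x1 <= p0.1.1 <= x2 -> x1 <= q.1.1 <= x2 ->
    0 <= p0.1.2 <= h -> 0 <= q.1.2 <= h -> 0 <= p0.2 -> 0 <= q.2 -> segment p0 q x ->
    [/\ x1 <= x.1.1 <= x2, 0 <= x.1.2 <= h & 0 <= x.2].
  move=> p1 q1 /andP[p2 p3] /andP[q2 q3] p4 q4 xpq; split; first exact: segment_between xpq.
    by move: xpq => /segmentP[t /andP[t0 t1] <-] /=; apply/andP; split; nra.
  by move: xpq => /segmentP[t /andP[t0 t1] <-] /=; nra.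
elim: T a p => [|l IHl r IHr] a p; first by [].
set b := (a + nleaves l)%N; set v : R * R := vertex a (Node l r).
have [a1 [b1 [a10 b10 xlE hlE nlE]]] := @vertex_params R a l.
have [c1 [d1 [c10 d10 xrE hrE nrE]]] := @vertex_params R b r.
have gE : (a + nleaves (Node l r))%:R = a%:R + a1 + b1 + 1 + c1 + d1 + 1 :> R.
  by rewrite /= addnA !natrD nlE nrE; ring.
have hE : v.2 = a1 + b1 + c1 + d1 + 1 :> R.
  by rewrite /v /= -subn1 natrB ?addn_gt0 ?nleaves_gt0// natrD nlE nrE; ring.
have hE0 : (nleaves l + nleaves r).-1%:R = a1 + b1 + c1 + d1 + 1 :> R := hE.
have bE : b%:R = a%:R + a1 + b1 + 1 :> R by rewrite /b natrD nlE; ring.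
have vE : v.1 = b%:R + 2^-1 by [].
have a0 : 0 <= a%:R :> R by [].
have xl2 : (vertex a l).1 <= b%:R :> R by exact: vertex_le.
have xr2 : (vertex b r).1 <= (b + nleaves r)%:R :> R by exact: vertex_le.
have gE' : (b + nleaves r)%:R = (a + nleaves (Node l r))%:R :> R by rewrite /= addnA.
rewrite [below_root _ _]/= -/b -/v.
move=> [[[[|]|]|/IHl[/andP[h1 h2] /andP[h3 h4] h5]]|/IHr[/andP[h1 h2] /andP[h3 h4] h5]].
- by apply: segb => /=; try (apply/andP; split); lra.
- by apply: segb => /=; try (apply/andP; split); lra.
- by apply: segb => /=; try (apply/andP; split); lra.
- by rewrite -/b in h2; split => //; apply/andP; split; lra.
- by split => //; apply/andP; split; lra.
Qed.

End Decompose.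

Section Units.
Context {R : realType}.
Local Notation sp := (space R).

(** The vertical strand below an interior vertex is cut at the x-axis: its upper part is the new
    edge of the tree, its lower part leads to the vine crossing between the same two leaves. *)
Lemma spread_split n a T (B : set sp) : (a + nleaves T <= n)%N -> let w := n%:R + 2^-1 in
  spread w a T B = below_root a T `|` (vine_heads w a (nleaves T).-1 `|`
    stub w ((a + nleaves T).-1%:R + 2^-1) ((a + nleaves T)%:R + 2^-1) (leaf_pt (a + nleaves T)) B).
Proof.
elim: T a B => [|l IHl r IHr] a B aT w; first by rewrite /= addn1 !set0U.
set b := (a + nleaves l)%N.
have blr : (b + nleaves r <= n)%N by rewrite /b -addnA.
have ble : (b <= n)%N by apply: leq_trans blr; exact: leq_addr.
rewrite [spread _ _ _ _]/= [below_root _ _]/= -/b -/w (IHl _ _ ble) (IHr _ _ blr) -/b -/w.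
set v : R := (nleaves l + nleaves r).-1%:R.
have v0 : 0 <= v by [].
have [j jE] : exists j, nleaves l = j.+1 by exists (nleaves l).-1; rewrite prednK// nleaves_gt0.
have [m mE] : exists m, nleaves r = m.+1 by exists (nleaves r).-1; rewrite prednK// nleaves_gt0.
have bE : b = (a + j).+1 by rewrite /b jE addnS.
have rE : (a + nleaves (Node l r) = b + nleaves r)%N by rewrite /= addnA.
have -> : (nleaves (Node l r)).-1 = (j.+1 + m)%N by rewrite /= jE mE addnS.
rewrite rE vine_headsD addnS -bE jE mE !succnK bE succnK -bE.
have mn : m%:R + 1 + b%:R <= n%:R :> R by rewrite -natrS -natrD ler_nat addnC -mE.
have m0 : 0 <= m%:R :> R by [].
rewrite (@vertical_split _ (b%:R + 2^-1) v 0 0); first last.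
- by rewrite /fp /ap /= /q2r /= /w; apply/andP; split; lra.
- by rewrite /fp /ap /= /q2r /=; field.
- by rewrite /fp /ap /= /q2r /=; field.
rewrite /planar_segment /at_height /foot /=.
scene_ac.
Qed.

Lemma stub_bound w al ga x0 (A : set sp) p : A `<=` slab -> al + 1 <= ga -> ga + 1 <= w ->
  al <= x0 <= ga -> stub w al ga (x0, 0, 0) A p ->
  [/\ al <= p.1.1 <= ga, p.1.2 <= 0, 0 <= p.2 & -1/8 <= p.1.2 - p.1.1 + w].
Proof.
move=> As alga gaw x0b; have /andP[x01 x02] := x0b.
have segb (p0 q x : sp) : al <= p0.1.1 <= ga -> al <= q.1.1 <= ga ->
    p0.1.2 <= 0 -> q.1.2 <= 0 -> 0 <= p0.2 -> 0 <= q.2 ->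
    -1/8 <= p0.1.2 - p0.1.1 + w -> -1/8 <= q.1.2 - q.1.1 + w -> segment p0 q x ->
    [/\ al <= x.1.1 <= ga, x.1.2 <= 0, 0 <= x.2 & -1/8 <= x.1.2 - x.1.1 + w].
  move=> p1 q1 p2 q2 p4 q4 p5 q5 xpq; split; first exact: segment_between xpq.
  - by move: xpq => /segmentP[t /andP[t0 t1] <-] /=; nra.
  - by move: xpq => /segmentP[t /andP[t0 t1] <-] /=; nra.
  - have := @segment_above _ (-1/8) (-1, 1, 0, w) _ _ _ _ _ xpq; rewrite /ev /= => h.
    by rewrite [X in _ <= X](_ : _ = -1 * x.1.1 + 1 * x.1.2 + 0 * x.2 + w); [apply: h; lra|ring].
case=> [|/(box_slab As)[/andP[h1 h2] /andP[h3 h4] /andP[h5 h6]]].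
  rewrite /scene /=; case=> [|[|[|[|//]]]]; apply: segb; rewrite /fp /ap /= ?/q2r /=;
    try (apply/andP; split); lra.
by split; try (apply/andP; split); lra.
Qed.

Lemma vine_heads_bound n a k p : n = (a + k).+1 -> let w : R := n%:R + 2^-1 in vine_heads w a k p ->
  [/\ a%:R + 2^-1 <= p.1.1 <= n%:R - 2^-1, p.1.2 <= 0, 0 <= p.2 & -1/8 <= p.1.2 - p.1.1 + w].
Proof.
elim: k a => [//|k IH] a nE w.
have nR : n%:R = a%:R + 1 + k%:R + 1 :> R by rewrite nE (natrS (a + k.+1)) natrD (natrS k); ring.
have k0 : 0 <= k%:R :> R by [].
rewrite vine_headsS => -[[|]|].
- move=> /stub_bound[]; rewrite ?(natrS a).
  + exact: crossing_slab.
  + by lra.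
  + by rewrite /w nR; lra.
  + by apply/andP; split; lra.
  + move=> /andP[h1 h2] h3 h4 h5; split=> //; apply/andP; split; lra.
- rewrite /foot => xpq.
  have xb : a.+1%:R + 2^-1 <= p.1.1 <= a.+1%:R + 2^-1.
    by apply: segment_between xpq; rewrite /fp /ap /= ?/q2r /=; apply/andP; split; lra.
  have h := @segment_above _ (-1/8) (-1, 1, 0, w) _ _ _ _ _ xpq.
  rewrite (natrS a) in xb h xpq; move/andP: xb => [h1 h2].
  have h3 : -1/8 <= p.1.2 - p.1.1 + w.
    rewrite [X in _ <= X](_ : _ = ev (-1, 1, 0, w) p); last by rewrite /ev /=; ring.
    by apply: h; rewrite /ev /fp /ap /= ?/q2r /= /w nR; lra.
  move: xpq => /segmentP[t /andP[t0 t1] pE]; rewrite -pE /fp /ap /= ?/q2r /= in h1 h2 h3 *.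
  by rewrite /w nR in h3 *; split; [apply/andP; split; lra|nra|nra|lra].
- move/(IH a.+1); rewrite addSnnS => /(_ nE)[/andP[h1 h2] h3 h4 h5].
  by rewrite (natrS a) in h1; split=> //; apply/andP; split; lra.
Qed.

Lemma vine_body_le w a k p : vine_body w a k p -> p.1.1 <= (a + k).+1%:R + 2^-1 :> R.
Proof.
have key (K : R) (p0 q x : sp) : p0.1.1 <= K -> q.1.1 <= K -> segment p0 q x -> x.1.1 <= K.
  by move=> h1 h2 /segmentP[t /andP[t0 t1] <-] /=; nra.
elim: k a => [|k IH] a.
  rewrite addn0 /= => -[|[|//]]; apply: key;
    rewrite /cross /leaf_pt /foot /fp /ap /= ?/q2r /= ?(natrS a); lra.
have hk : a.+2%:R <= (a + k.+1).+1%:R :> R by rewrite ler_nat addnS !ltnS leq_addr.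
rewrite (natrS a.+1) in hk.
move=> /= [[|[|[|//]]]|/IH]; last by rewrite addSnnS.
- apply: key; rewrite /cross /leaf_pt /foot /fp /ap /= ?/q2r /=; lra.
- apply: key; rewrite /cross /leaf_pt /foot /fp /ap /= ?/q2r /= ?(natrS a.+1); lra.
- apply: key; rewrite /cross /leaf_pt /foot /fp /ap /= ?/q2r /=; lra.
Qed.

End Units.

(** * From the Thompson diagram to the closure of a tangle *)

Section Assembly.
Context {R : realType}.
Local Notation sp := (space R).

Lemma box_vertical_arcs w g : box w g vertical_arcs = scene (fl w g
  [:: ((-1#8, -1#8, 0), (-3#16, 0, 0)); ((-3#16, 0, 0), (-1#8, 1#8, 0));
      ((-3#8, -1#8, 0), (-5#16, 0, 0)); ((-5#16, 0, 0), (-3#8, 1#8, 0))]%qfrac) :> set sp.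
Proof.
have rhoE (A : set sp) : rho A = ap (0, 1, 1, 0, 0, 0) @` A.
  by congr image; apply/funext => q; rewrite /ap /=; congr (_, _, _); ring.
rewrite /box /vertical_arcs rhoE /horizontal_arcs /planar_segment !image_setU !ap_segment /=.
rewrite setU0 !setUA; congr (segment _ _ `|` segment _ _ `|` segment _ _ `|` segment _ _);
  by rewrite /fp /ap /at_height /map2r /qbox /= /q2r /=; congr (_, _, _); field.
Qed.

Theorem thompson_move T k : nleaves T = k.+2 ->
  move_in (setT : set sp) (upper_tangle T `|` lower_tangle (right_vine k.+1))
    (closed_up (fill T vertical_arcs)).
Proof.
case: T => [//|l r] Tk; set T := Node l r.
have nl1 : 1 <= (nleaves l)%:R :> R by rewrite ler1n nleaves_gt0.
have nr1 : 1 <= (nleaves r)%:R :> R by rewrite ler1n nleaves_gt0.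
pose n := k.+2; pose w : R := n%:R + 2^-1.
have nE : n%:R = (nleaves l)%:R + (nleaves r)%:R :> R by rewrite /n -Tk natrD.
have kE : k%:R = n%:R - 2 :> R by rewrite /n (natrS k.+1) (natrS k); ring.
have hE : (nleaves T).-1%:R = n%:R - 1 :> R by rewrite [nleaves T]Tk /= /n (natrS k.+1); ring.
have hE2 : (vertex 0 T).2 = n%:R - 1 :> R := hE.
have {}Tk : nleaves T = k.+2 /\ True by [].
pose ps := [:: (nleaves l)%:R - 1; (nleaves r)%:R - 1 : R].
have ps0 : all (fun x => 0 <= x) ps by rewrite /= !subr_ge0 nl1 nr1.
have EW : lval ps top_w = w by rewrite /w nE /lval /ps /= /q2r /=; field.
have EN : lval ps top_n = n%:R by rewrite nE /lval /ps /= /q2r /=; field.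
have EH : lval ps top_h = n%:R - 1 by rewrite nE /lval /ps /= /q2r /=; field.
have EV : lval ps top_v = (nleaves l)%:R + 2^-1 by rewrite /lval /ps /= /q2r /=; field.
have Ehalf : lval ps lhalf = 0%:R + 2^-1 by rewrite lval_cst /q2r /=; field.
have E32 : lval ps (lcst (3#2)%qfrac) = 1%:R + 2^-1 by rewrite lval_cst /q2r /=; field.
have Eprev : lval ps (lf_plus (-1#1)%qfrac top_w) = k.+1%:R + 2^-1.
  by rewrite lvalD EW lval_cst /w /n (natrS k.+1) /q2r /=; field.
have Pv : spt2r ps pt_v = (vertex 0 T, 0).
  by rewrite /spt2r /= EV EH -hE /= /q2r /=; congr (_, _, _); field.
have P0 : spt2r ps pt0 = ((vertex 0 T).1, n%:R, 0).
  by rewrite /spt2r /= EV EN /q2r /=; congr (_, _, _); field.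
have P1 : spt2r ps pt1 = (0, n%:R, 0) by rewrite /spt2r /= EN lval_nil /q2r /=; congr (_, _, _); field.
have P2 : spt2r ps pt2 = (0, - n%:R, 0) by rewrite /spt2r /= lvalN EN lval_nil /q2r /=; congr (_, _, _); field.
have P3 : spt2r ps pt3 = (1%:R + 2^-1, - n%:R, 0) by rewrite /spt2r /= lvalN EN E32 /q2r /=; congr (_, _, _); field.
have Pleaf : spt2r ps pt_leaf = leaf_pt n by rewrite /spt2r /= EN lval_nil /q2r /=; congr (_, _, _); field.
pose BT : set sp := below_root 0 T; pose body := vine_body w 0 k; pose heads := vine_heads w 0 k.+1.
pose env (_ : nat) : set sp := fill T vertical_arcs.
have slab_vert : (vertical_arcs : set sp) `<=` slab by apply: rho_slab; exact: arcs_slab.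
have envs j : env j `<=` slab by exact: fill_slab.
have BTb p : BT p -> [/\ 2^-1 <= p.1.1 <= n%:R, 0 <= p.1.2 <= n%:R - 1 & 0 <= p.2].
  by move=> /below_root_bound; rewrite hE2 add0n [nleaves T](proj1 Tk) add0r.
have inT (X : set sp) : X `<=` setT by [].
have Z1 : BT `|` body `<=` in_zones ps [:: zone_T; zone_V].
  have k2 : n = (0 + k.+1).+1 by [].
  have w1 : w = k.+1%:R + 2^-1 + 1 by rewrite /w /n (natrS k.+1); ring.
  move=> p [/BTb[/andP[h1 h2] /andP[h3 h4] h5]|bp].
    exists zone_T; first by left.
    move=> u [<-|[<-|//]]; rewrite /ev /= ?(lvalB, lvalN, lval_cst, lval_nil, EW) /q2r /= /w; lra.
  exists zone_V; first by right; left.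
  have bx := vine_body_le bp.
  have [h1 h2 h3] : vine_zone w (0%:R + 2^-1) p.
    by apply: (vine_rest_zone k2); rewrite vine_restE; left.
  have wN : w = n%:R + 2^-1 by [].
  clear k2; move=> u [<-|[<-|//]]; rewrite /ev /= ?(lvalB, lvalD, lvalN, lval_cst, lval_nil, EN, EH) /q2r /=; lra.
apply: (@move_in_trans _ (draw_scene env ps top_w stage1_src `|` (BT `|` body))).
  apply: move_in_eq.
  have nV : (n = (0 + k).+2)%N by [].
  have [V0 _] := @mirror_vertex R n 0 k nV.
  rewrite /lower_tangle mirrorE /upper_tangle [X in ap mirror @` X](_ : _ = below_root 0 (right_vine k.+1)
    `|` segment (vertex 0 (right_vine k.+1), 0) (1%:R + 2^-1, n%:R, 0)
    `|` segment (1%:R + 2^-1, n%:R, 0) (0, n%:R, 0) `|` segment (0, n%:R, 0) (0%:R, 0, 0)); last first.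
    by rewrite nleaves_vine; exact: erefl.
  rewrite 3!image_setU (@lower_vineE R n 0 k nV) !ap_segment V0 mirror_leaf.
  have M1 : ap mirror (1%:R + 2^-1, n%:R, 0) = (1%:R + 2^-1, - n%:R, 0) :> sp.
    by rewrite /ap /mirror /=; congr (_, _, _); ring.
  have M2 : ap mirror (0, n%:R, 0) = (0, - n%:R, 0) :> sp.
    by rewrite /ap /mirror /=; congr (_, _, _); ring.
  rewrite M1 M2 -/body [nleaves T](proj1 Tk).
  rewrite /draw_scene /= /seg2r /= Pv P0 P1 P2 P3 Pleaf !sfpE EW E32 Eprev.
  rewrite (@vertical_split _ 0 n%:R 0 0 (0, - n%:R, 0))//=; last by apply/andP; split; lra.
  rewrite [segment (0, 0, 0) (0, - n%:R, 0)]segmentC /planar_segment /at_height /BT /cross /q0 /q1 /=.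
  scene_ac.
(* The last edge of the vine now passes through the point of the line following the last crossing,
   next to which [V] will be formed. *)
apply: move_in_trans (move_in_sub (inT _) (sconnectsP envs ps0 Z1 stage1_connects)) _.
pose chain2 := scene (map (seg2r ps) (segs stage2_src)).
pose inc := segment (fp w (0%:R + 2^-1) (0, -1#8, 0)%qfrac) (cross w 1 q0).
apply: (@move_in_trans _ ((inc `|` vine_rest w 0 k.+1) `|` (chain2 `|` BT))).
  apply: move_in_eq; rewrite vine_restE -/body /inc /chain2.
  rewrite /draw_scene /= /seg2r /= Pv P0 P1 P2 Pleaf !sfpE EW E32 Eprev Ehalf /cross.
  have -> : k.+2%:R + 2^-1 = w by [].
  rewrite /q0 /q1; scene_ac.
have vpos : 0 <= (nleaves l)%:R :> R by [].
have C2 p : (chain2 `|` BT) p -> ~ [set p : sp | 0%:R + 2^-1 < p.1.1 /\ p.1.2 < 0] p.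
  case=> [|/BTb[_ /andP[h1 h2] _] [_ h]]; last lra.
  move=> /(segment_avoids (s := [:: (x_gt lhalf, [::]); (y_lt [::], [::])]) ps0); case; first by vm_compute.
  by move=> a [<-|[<-|//]] + [h1 h2]; rewrite /ev /= ?lvalN ?Ehalf ?lval_nil /q2r /=; lra.
(* All vine crossings become boxes, while the tree and the outer arc stay off the quadrant in which
   this happens. *)
apply: move_in_trans (move_in_sub (inT _) (move_inU C2 (@vine_move R n 0 k.+1 erefl))) _.
rewrite vine_unitsE -/w -/heads.
pose Y3 := heads `|` (chain2 `|` BT).
have C3 p : Y3 p -> ~ support (window w w left_arc_walls) p.
  move=> Yp /support_cons[h1 /support_cons[_ /support_cons[h3 _]]].
  move: h1 h3; rewrite /ev /fa /= /q2r /=; move: Yp => [|[|]].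
  - by move=> /(@vine_heads_bound R n 0 k.+1 _ erefl)[/andP[_ h] _ _ _]; rewrite -/w /w; lra.
  - move=> /(segment_avoids (s := [:: (x_gt (lf_plus (-1#1)%qfrac top_w), [::]); (eta_lt top_w (1#2)%qfrac, [::])]) ps0).
    case; first by vm_compute.
    move=> a [<-|[<-|//]]; rewrite /ev /= ?lvalN ?lvalB ?lvalD ?lval_cst ?lval_nil EW /q2r /=; clear; lra.
  - by move=> /BTb[/andP[_ h] /andP[h' _] _]; rewrite /w; lra.
have M3 := move_inU C3 (@left_arc_move R w w).
apply: (@move_in_trans _ (scene (fl w w left_arc_source) `|` Y3)).
  apply: move_in_eq; rewrite /Y3 /fl /=.
  have -> : fp w w (-1#1, -1#8, 0)%qfrac = fp w ((0 + k.+1)%:R + 2^-1) (0, -1#8, 0)%qfrac :> sp.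
    by rewrite /fp /ap /= /q2r /= /w /n (natrS k.+1); congr (_, _, _); field.
  have -> : fp w w (-1#2, 1#2, 0)%qfrac = leaf_pt n :> sp.
    by rewrite /fp /ap /= /q2r /= /leaf_pt /w; congr (_, _, _); field.
  rewrite /cross /q0; scene_ac.
apply: move_in_trans (move_in_sub (inT _) M3) _.
pose arcs := scene (fl w w left_arc_target).
pose Q := BT `|` heads `|` arcs.
have w0 : 0 <= w by rewrite /w addr_ge0// invr_ge0.
have n2 : 2 <= n%:R :> R by lra.
have arcsE : arcs = scene (map (seg2r ps) (slift top_w top_w left_arc_target)) by rewrite sliftE EW.
have zQ p : [/\ 2^-1 <= p.1.1 <= w - 5/16, p.1.2 <= n%:R - 1, 0 <= p.2 &
    -1/8 <= p.1.2 - p.1.1 + w] -> in_zones ps [:: zone_Q] p.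
  move=> [/andP[h1 h2] h3 h4 h5]; exists zone_Q; first by left.
  have wz : 0 <= w * p.2 by exact: mulr_ge0.
  move=> u [<-|[<-|[<-|[<-|[<-|//]]]]]; rewrite /ev /= ?(lvalB, lvalD, lvalN, lval_cst, lval_nil, EW, EH) /q2r /=; clear -h1 h2 h3 h4 h5 wz; lra.
have Qz : Q `<=` in_zones ps [:: zone_Q].
  move=> p [[/BTb[/andP[h1 h2] /andP[h3 h4] h5]|]|].
  - by apply: zQ; rewrite /w; split=> //; clear -h1 h2 h3 h4 h5 n2; [apply/andP; split; lra|lra].
  - move=> /(@vine_heads_bound R n 0 k.+1 _ erefl)[/andP[h1 h2] h3 h4 h5].
    by apply: zQ; rewrite /w; split=> //; clear -h1 h2 h3 h4 h5 n2; [apply/andP; split; lra|lra].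
  - rewrite arcsE => /(zone_scene (z := zone_Q) ps0) H; exists zone_Q; first by left.
    by apply: H; vm_compute.
have Qx p : Q p -> p.1.1 <= w - 5/16.
  move=> /Qz[z [<-|//]] /(_ _ (or_intror (or_intror (or_introl erefl)))).
  by rewrite /ev /= lvalD lval_cst lval_nil EW /q2r /=; lra.
apply: (@move_in_trans _ (draw_scene env ps top_w stage2_src `|` Q)).
  apply: move_in_eq; rewrite /draw_scene -/chain2 [draw_boxes _ _ _ _]/= setU0 /Q /Y3 -/arcs.
  scene_ac.
(* The outer arc passes behind everything that has been built so far, collected in [Q]. *)
apply: move_in_trans (move_in_sub (inT _) (sconnectsP envs ps0 Qz stage2_connects)) _.
pose chain3 := scene (map (seg2r ps) [:: (pt_v, pt0'); (pt0', pt1'); (pt1', pt_e1);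
  (pt_e2, pt2'); (pt2', pt2''); (pt2'', pt_g)]).
apply: (@move_in_trans _ (scene (fl w w right_arc_source) `|` (chain3 `|` Q))).
  apply: move_in_eq; rewrite /draw_scene /chain3 /fl /= /seg2r /= !sfpE EW.
  clearbody Q; scene_ac.
have C4 p : (chain3 `|` Q) p -> ~ support (window w w right_arc_walls) p.
  move=> Yp /support_cons[h1 /support_cons[h2 /support_cons[h3 /support_cons[h4 _]]]].
  move: h1 h2 h3 h4; rewrite /ev /fa /= /q2r /=; move: Yp => [|/Qx]; last by lra.
  move=> /(segment_avoids (s := [:: (x_gt (lf_plus (-1#4)%qfrac top_w), [::]); (x_lt (lf_plus (1#4)%qfrac top_w), [::]);
    (eta_gt top_w (-1#4)%qfrac, [::]); (eta_lt top_w (1#4)%qfrac, [::])]) ps0).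
  case; first by vm_compute.
  move=> a [<-|[<-|[<-|[<-|//]]]]; rewrite /ev /= ?lvalN ?lvalB ?lvalD ?lval_cst ?lval_nil ?EW /q2r /=; clear; lra.
apply: move_in_trans (move_in_sub (inT _) (move_inU C4 (@right_arc_move R w w))) _.
pose chain4 := scene (map (seg2r ps) [:: (pt_v, pt0'); (pt0', pt1'); (pt1', pt_e1); (pt_e1, pt_ne); (pt_se, pt_e2);
  (pt_e2, pt2'); (pt2', pt2''); (pt2'', pt_g)]).
have le_n : (0 + nleaves T <= n)%N by rewrite (proj1 Tk).
have EnT : (0 + nleaves T)%:R + 2^-1 = w by rewrite (proj1 Tk).
apply: (@move_in_trans _ (spread w 0 T vertical_arcs `|` chain4)).
  apply: move_in_eq.
  rewrite (@spread_split R n 0 T vertical_arcs le_n) -/BT -/w EnT (proj1 Tk) -/heads /Q /arcs /stub box_vertical_arcs.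
  have -> : (0 + k.+2)%N = n by []; have -> : n.-1 = k.+1 by [].
  have -> : fp w (k.+1%:R + 2^-1) (0, -1#8, 0)%qfrac = fp w w (-1#1, -1#8, 0)%qfrac :> sp.
    by rewrite /fp /ap /= /q2r /= /w /n (natrS k.+1); congr (_, _, _); field.
  have <- : fp w w (-1#2, 1#2, 0)%qfrac = leaf_pt n :> sp.
    by rewrite /fp /ap /= /q2r /= /leaf_pt /w; congr (_, _, _); field.
  rewrite /chain3 /chain4 /fl /= /seg2r /= !sfpE EW.
  scene_ac.
have C5 p : chain4 p -> ~ strip w (0%:R + 2^-1) ((0 + nleaves T)%:R + 2^-1) (vertex 0 T).2 p.
  (* The strip is a union of two convex pieces, one for each disjunct in its definition; the chain
     is shown to miss each of them. *)
  rewrite EnT hE2 => Yp [h1 h2 h3 h4]; case: h4 => h4.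
    move: Yp => /(segment_avoids (s := [:: (x_gt lhalf, [::]); (x_lt top_w, [::]);
      (eta_gt top_w (-1#1)%qfrac, [::]); (y_lt top_h, [::])]) ps0); case; first by vm_compute.
    by move=> a [<-|[<-|[<-|[<-|//]]]]; rewrite /ev /= ?lvalN ?lvalB ?lval_cst ?lval_nil ?EW ?Ehalf ?EH /q2r /=; clear -h1 h2 h3 h4; lra.
  move: Yp => /(segment_avoids (s := [:: (x_gt lhalf, [::]); (x_lt top_w, [::]);
    (eta_gt top_w (-1#1)%qfrac, [::]); (y_lt_z top_h, [::])]) ps0); case; first by vm_compute.
  by move=> a [<-|[<-|[<-|[<-|//]]]]; rewrite /ev /= ?lvalN ?lvalB ?lval_cst ?lval_nil ?EW ?Ehalf ?EH /q2r /=; clear -h1 h2 h3 h4; lra.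
have M5 := @spread_move R n 0 T vertical_arcs le_n slab_vert; cbv zeta in M5.
(* The vine crossings and [V] are now in place below the tree, which collapses onto them. *)
apply: move_in_trans (move_in_sub (inT _) (move_inU C5 M5)) _.
apply: (@move_in_trans _ (draw_scene env ps top_w stage3_src `|` set0)).
  apply: move_in_eq; rewrite setU0 -(@same_sceneP R env ps top_w stage3_stub stage3_src); last by vm_compute.
  rewrite EnT /stub /draw_scene /chain4 /= /seg2r /= Pv !sfpE EW Ehalf -/w.
  scene_ac.
have Z0 : @set0 sp `<=` in_zones ps [::] by [].
apply: move_in_trans (move_in_sub (inT _) (sconnectsP envs ps0 Z0 stage3_connects)) _.
apply: (@move_in_trans _ (scene (fl w w closing_source) `|` box w w (fill T vertical_arcs))).
  by apply: move_in_eq; rewrite setU0 /draw_scene sliftE [draw_boxes _ _ _ _]/= setU0 EW.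
apply: move_in_trans (closing_move w w (envs 0%N)) _.
(* The closure was reached in the small sheared box at [w]; it is brought back to the standard
   square. *)
exact: move_in_sym (rescale_move w (envs 0%N)).
Qed.

End Assembly.

(** * Bipartite trees as binary trees, and the equivalence *)

Fixpoint kids (T : btree) : seq wtree :=
  if T is Node l r then WNode 1 [:: WNode (-1) (kids l)] :: kids r else [::].

Fixpoint wsize (t : wtree) : nat := let: WNode _ ts := t in (sumn (map wsize ts)).+1.

Lemma kids_bipartite T : all (bipartite_at (Some (-1))) (kids T).
Proof. by elim: T => //= l IHl r IHr; rewrite IHl IHr eqxx implybT. Qed.

(** The left-child right-sibling correspondence, with each child of weight 1 contracted into its
    only child: [l] codes the children of that grandchild, [r] the remaining siblings. *)
Lemma bipartite_kids ts : all (bipartite_at (Some (-1))) ts -> exists T, ts = kids T.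
Proof.
have [n] := ubnP (sumn (map wsize ts)); elim: n ts => // n IH [|[w us] ts] /=; first by exists Leaf.
move=> ts_n /andP[/and5P[+ w1 _ us2 +] hts].
rewrite !inE => /orP[/eqP w_1|/eqP w_1]; last by rewrite w_1 eqxx in w1.
(* A vertex of weight 1 in the list has a parent, so valency 2 leaves it exactly one child. *)
move: us2; rewrite w_1 eqxx /= addn1 eqSS; case: us ts_n => [|[w' vs] [|? ?]] //= ts_n _.
rewrite andbT => /and5P[+ w'1 _ _ hvs]; rewrite !inE => /orP[/eqP w'_1|/eqP w'_1].
  by rewrite w'_1 eqxx in w'1.
rewrite w'_1 in hvs.
have [|l ->] := IH vs _ hvs; first by lia.
have [|r ->] := IH ts _ hts; first by lia.
by exists (Node l r); rewrite w'_1.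
Qed.

Section Links.
Context {R : realType}.
Local Notation sp := (space R).

Lemma foldr_kids T (B : set sp) :
  foldr (fun s A => hsum (rho (tau s)) A) B (kids T) = fill T B.
Proof. by elim: T B => //= l IHl r IHr B; rewrite IHr -IHl. Qed.

End Links.

Theorem theorem1 (R : realType) (L : set (sphere3 R)) (node_hl : link L) :
  (exists T : btree, (2 <= nleaves T)%N /\ isotopic L (positive_thompson_link T))
  <->
  (exists t : wtree, bipartite t /\ isotopic L (closure_link (tau t))).
Proof.
have link_move T : (2 <= nleaves T)%N -> move_in (setT : set (space R))
    (upper_tangle T `|` lower_tangle (right_vine (nleaves T).-1)) (closed_up (fill T vertical_arcs)).
  by case E : (nleaves T) => [|[|k]] // _; exact: thompson_move.
have tangle_slab : (hsum (stack (crossing false)) (crossing false) : set (space R)) `<=` slab.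
  by apply: hsum_slab; [apply: stack_slab|]; exact: crossing_slab.
split=> [[T [T2 LT]]|[[w ts] [/andP[/eqP/= -> /= /andP[_ bts]] Lt]]].
  (* The additional children change the final summand from [E(-1)] to [hsum (stack E(-1)) E(-1)],
     which can be moved to [V]. *)
  exists (WNode (-1) (kids T ++ kids (Node Leaf Leaf))); split.
    by rewrite /bipartite /= all_cat !kids_bipartite eqxx implybT.

  have /(isotopic_move_in (link_move T T2)) := LT.
  have /closure_move/isotopic_move_in : move_in square (fill T vertical_arcs)
      (fill T (hsum (stack (crossing false)) (crossing false)) : set (space R)).
    by apply: move_in_sym; apply: fill_move => //; exact: twist_move.
  by move=> /[apply]; rewrite /closure_link /= foldr_cat foldr_kids.
(* For this tree, [fill] with [V] is the tangle of [unwind_move] around [A = fill T E(-1)]. *)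
have [T tsE] := bipartite_kids bts; exists (Node (Node T Leaf) Leaf); split.
  by rewrite /= !addn1.
apply: (isotopic_move_in (move_in_sym (link_move _ _))); first by rewrite /= !addn1.
have Tslab : (fill T (crossing false) : set (space R)) `<=` slab.
  by apply: fill_slab; exact: crossing_slab.
apply: (isotopic_move_in (move_in_sym (unwind_move Tslab))).
by move: Lt; rewrite /closure_link /= tsE foldr_kids.
Qed.
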